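(* Let $1\le k\le n$ be integers. Let $T_0\in I_k^{loc}(\{0\}\times\mathbb{R}^n)$ be an integral $k$-cycle (i.e. $\partial T_0=0$) of finite mass and compact support, with $\mathbf{M}[T_0]>0$. Let $(T,\{\nu_t\}_{t\ge 0})$ be an enhanced motion corresponding to $T_0$, and let $F_{\mathrm{opt}}$ be an optimal filling of $T_0$. Then the extinction time $\tau=\sup\{t\ge 0 \;|\; \nu_t(\mathbb{R}^n)>0\}$ of $\{\nu_t\}_{t\ge0}$ satisfies $$\tau\;\ge\;\left(\frac{\mathbf{M}[F_{\mathrm{opt}}]}{\mathbf{M}[T_0]}\right)^2 .$$
   Context: Notation: $\mathbb{R}^{1,n}=\mathbb{R}\times\mathbb{R}^n$ with points $(t,x)$, $\mathbb{R}^{1,n}_+=\mathbb{R}_+\times\mathbb{R}^n$; $\{0\}\times\mathbb{R}^n$ is identified with $\mathbb{R}^n$. $I_j(U)$ (resp. $I_j^{loc}(U)$) denotes the integral (resp. locally integral) $j$-currents in $U$, $\mathbf{M}$ denotes mass, and $\nu_Q$ denotes the mass measure of a current $Q$. $\pi_x:\mathbb{R}^{1,n}_+\to\mathbb{R}^n$ is the projection $(t,x)\mapsto x$; for measurable $B\subseteq\mathbb{R}$, $|B|$ is its Lebesgue measure and $T_B=T\lfloor (B\times\mathbb{R}^n)$; $T_t$ is the slice of $T$ at time $t$. Optimal filling: $F_{\mathrm{opt}}\in I_{k+1}(\mathbb{R}^n)$ with $\partial F_{\mathrm{opt}}=T_0$ and $\mathbf{M}[F_{\mathrm{opt}}]\le\mathbf{M}[F]$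 for every $F\in I_{k+1}(\mathbb{R}^n)$ with $\partial F=T_0$ (it exists by Federer–Fleming). Brakke flow: a family of Radon measures $\{\nu_t\}_{t\ge0}$ on $\mathbb{R}^n$ is a $k$-dimensional Brakke flow if for all $t\ge0$ and all $\phi\in C_c^1(\mathbb{R}^n,\mathbb{R}_+)$ one has $\overline{D}_t\nu_t(\phi)\le\mathcal{B}(\nu_t,\phi)$, where $\overline{D}_{t_0}f=\limsup_{t\to t_0}\frac{f(t)-f(t_0)}{t-t_0}$ and $$\mathcal{B}(\nu,\phi)=\int -\phi H^2+\nabla\phi\cdot S^\perp\cdot\vec H\,d\nu$$ whenever $\nu\lfloor\{\phi>0\}$ is a $k$-rectifiable Radon measure, the first variation measure $|\delta V|\lfloor\{\phi>0\}$ of the associated varifold $V=V_\nu\lfloor\{\phi>0\}$ is a Radon measure absolutely continuous with respect to $\nu\lfloor\{\phi>0\}$, and $\phi H^2$ is $\nu$-integrable; otherwise $\mathcal{B}(\nu,\phi)=-\infty$. Here $\vec H$ is the generalized mean curvature vector, $H=|\vec H|$, and $S$ is the approximate tangent space, identified with the orthogonal projection onto it ($S^\perp$ being the projection onto its orthogonal complement). Enhanced motion corresponding to (starting from) $T_0$: a pair $(T,\{\nu_t\}_{t\ge0})$ where $T\in I_{k+1}^{loc}(\mathbb{R}^{1,n}_+)$ with $\partial T=T_0$, $\{\nu_t\}_{t\ge0}$ is a $k$-dimensional Brakke flow with $\nu_0=\nu_{T_0}$, and: (i) $\nu_t\ge\nu_{T_t}$ for $t\geq 0$ (the slices $T_t$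 being defined for a.e. $t$); (ii) $\mathbf{M}[(\pi_x)_\#(T_B)]\le|B|^{1/2}\mathbf{M}[T_0]$; (iii) $\mathbf{M}[T_B]\le(|B|+|B|^{1/2})\mathbf{M}[T_0]$, for all measurable $B\subseteq\mathbb{R}$. *)

(* Defs.v *)
From HB Require Import structures.
From mathcomp Require Import all_boot all_order all_algebra.
From mathcomp Require Import all_classical all_reals all_analysis.
Set Implicit Arguments. Unset Strict Implicit. Unset Printing Implicit Defensive.
Import Order.TTheory GRing.Theory Num.Theory.
Import numFieldNormedType.Exports.
Local Open Scope classical_set_scope.
Local Open Scope ring_scope.

Definition borel (R : realType) (N : nat) := g_sigma_algebraType (@open 'rV[R]_N).

Lemma open_measurable_borel (R : realType) N (U : set (borel R N)) :
  @open 'rV[R]_N U -> measurable U.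
Proof. by move=> oU; apply: sub_gen_smallest. Qed.

Lemma continuous_measurable_borel (R : realType) N
  (f : 'rV[R]_N -> R) : continuous f ->
  measurable_fun [set: borel R N] (f : borel R N -> R).
Proof.
move=> cf; apply: (measurability _ (measurable_realfun.RGenOInfty.measurableE R)).
move=> _ [_ [a ->] <-]; rewrite setTI; apply: open_measurable_borel.
apply: (@open_comp 'rV[R]_N R f) => [x _|]; first exact: cf.
exact: interval_open.
Qed.

Section cons.
Variables (R : realType) (m : nat).

Definition row_cons (p : measurableTypeR R * borel R m) : borel R (1 + m) :=
  row_mx (p.1)%:M (p.2 : 'rV[R]_m).

Definition row_uncons (x : borel R (1 + m)) : measurableTypeR R * borel R m :=
  (lsubmx (x : 'rV[R]_(1 + m)) 0 0, rsubmx (x : 'rV[R]_(1 + m))).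

Lemma row_consK : cancel row_cons row_uncons.
Proof.
by case=> t x; rewrite /row_uncons /row_cons /= row_mxKl row_mxKr mxE eqxx mulr1n.
Qed.
Lemma row_unconsK : cancel row_uncons row_cons.
Proof.
move=> x; rewrite /row_uncons /row_cons /= -[RHS]hsubmxK; congr row_mx.
by apply/rowP => i; rewrite !ord1 !mxE eqxx mulr1n.
Qed.
End cons.

Section boxes.
Variables (R : realType) (N : nat).
Definition ratbox (q : 'rV[rat]_N * 'rV[rat]_N) : set (borel R N) :=
  [set x | forall i, ratr (q.1 0 i) < (x : 'rV[R]_N) 0 i < ratr (q.2 0 i)].

Lemma borel_generated_boxes (U : set (borel R N)) : @open 'rV[R]_N U ->
  U = \bigcup_(q in [set q | ratbox q `<=` U]) ratbox q.
Proof.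
move=> oU; apply/seteqP; split=> [x Ux|x [q qU] /qU//].
have /nbhs_ballP[e /= e0 eU] : nbhs (x : 'rV[R]_N) U by apply: open_nbhs_nbhs.
have lo i : exists q : rat, ratr q \in `](x : 'rV[R]_N) 0 i - e, (x : 'rV[R]_N) 0 i[.
  have /rat_in_itvoo[q qi] : (x : 'rV[R]_N) 0 i - e < (x : 'rV[R]_N) 0 i by rewrite ltrBlDr ltrDl.
  by exists q.
have hi i : exists q : rat, ratr q \in `](x : 'rV[R]_N) 0 i, (x : 'rV[R]_N) 0 i + e[.
  have /rat_in_itvoo[q qi] : (x : 'rV[R]_N) 0 i < (x : 'rV[R]_N) 0 i + e by rewrite ltrDl.
  by exists q.
have [l Hl] := choice lo; have [h Hh] := choice hi.
exists (\row_i l i, \row_i h i).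
- move=> y /= Hy; apply: eU; split => // j i; rewrite !ord1.
  have := Hy i; rewrite !mxE /= => /andP[y1 y2].
  move: (Hl i) (Hh i); rewrite !in_itv/= => /andP[a1 a2] /andP[b1 b2].
  rewrite /ball /= ltr_distlC; apply/andP; split.
    exact: lt_trans a1 y1.
  exact: lt_trans y2 b2.
- move=> i /=; rewrite !mxE.
  move: (Hl i) (Hh i); rewrite !in_itv/= => /andP[a1 ->] /andP[b1 b2] //=.
Qed.
End boxes.


Section mcons.
Variables (R : realType) (m : nat).
Lemma measurable_row_cons : measurable_fun setT (@row_cons R m).
Proof.
apply: (@measurability _ _ _ _ setT (@row_cons R m) (@open 'rV[R]_(1 + m)) erefl).
move=> _ [U oU <-]; rewrite setTI (borel_generated_boxes oU) preimage_bigcup.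
rewrite bigcup_mkcond; apply: countable_bigcupT_measurable; first exact: countableP.
move=> q; case: ifPn => // _.
have -> : @row_cons R m @^-1` ratbox q =
    [set t | ratr (q.1 0 (lshift m 0)) < t < ratr (q.2 0 (lshift m 0))] `*`
    ratbox (rsubmx (q.1 : 'rV_(1 + m)), rsubmx (q.2 : 'rV_(1 + m))).
  apply/seteqP; split => [[t x] /= H|[t x] /= [Ht Hx] i].
    split=> /= [|i]; first by have := H (lshift m 0); rewrite row_mxEl mxE eqxx mulr1n.
    by have := H (rshift 1 i); rewrite row_mxEr !mxE.
  rewrite -(splitK i); case: (fintype.split i) => j /=; last first.
    by have := Hx j; rewrite row_mxEr !mxE.
  by rewrite !ord1 row_mxEl mxE eqxx mulr1n.
apply: measurableX; last first.
  rewrite /ratbox.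
  have -> : [set x : borel R m | forall i, ratr ((rsubmx (q.1 : 'rV_(1 + m)), rsubmx (q.2 : 'rV_(1 + m))).1 0 i) < (x : 'rV[R]_m) 0 i < ratr ((rsubmx (q.1 : 'rV_(1 + m)), rsubmx (q.2 : 'rV_(1 + m))).2 0 i)] = \bigcap_(i in [set: 'I_m]) ((fun x : 'rV[R]_m => x 0 i) @^-1` [set` `]ratr ((rsubmx (q.1 : 'rV_(1 + m))) 0 i), ratr ((rsubmx (q.2 : 'rV_(1 + m))) 0 i)[]).
    apply/seteqP; split => x /= H i; last by have := H i I; rewrite /= in_itv.
    by move=> _ /=; rewrite in_itv; exact: H.
  apply: fin_bigcap_measurable => // i _.
  apply: open_measurable_borel; apply: open_comp; last exact: interval_open.
  by move=> x _; exact: coord_continuous.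
have -> : [set t : measurableTypeR R | ratr (q.1 0 (lshift m 0)) < t < ratr (q.2 0 (lshift m 0))] = [set` `]ratr (q.1 0 (lshift m 0)), ratr (q.2 0 (lshift m 0))[].
  by apply/seteqP; split => t /=; rewrite in_itv.
exact: measurable_itv.
Qed.

Lemma measurable_row_uncons : measurable_fun setT (@row_uncons R m).
Proof.
apply: measurable_fun_pair.
  have -> : (fun x : borel R (1 + m) => lsubmx (x : 'rV[R]_(1 + m)) 0 0) =
      (fun x => (x : 'rV[R]_(1 + m)) 0 (lshift m 0)).
    by apply/funext => x; rewrite mxE.
  apply: (@continuous_measurable_borel R (1 + m)).
  exact: coord_continuous.
apply: (@measurability _ _ (borel R (1 + m)) (borel R m) setT
  (fun x => rsubmx (x : 'rV[R]_(1 + m))) (@open 'rV[R]_m) erefl).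
move=> _ [U oU <-]; rewrite setTI; apply: open_measurable_borel.
by apply: (@open_comp 'rV[R]_(1 + m) 'rV[R]_m rsubmx) => // x _; exact: continuous_rsubmx.
Qed.
End mcons.

Section lebesgue_cons.
Variables (R : realType) (m : nat).
Variable mu : {sigma_finite_measure set (borel R m) -> \bar R}.

Let mrc := @measurable_row_cons R m.
Definition lebesgue_cons : set (borel R (1 + m)) -> \bar R :=
  pushforward (@lebesgue_measure R \x mu)%E (@row_cons R m).
Let lebesgue_cons0 : lebesgue_cons set0 = 0%E.
Proof. by rewrite /lebesgue_cons /pushforward preimage_set0 measure0. Qed.
Let lebesgue_cons_ge0 A : (0 <= lebesgue_cons A)%E.
Proof. exact: integral_ge0. Qed.
Let lebesgue_cons_sigma_additive : semi_sigma_additive lebesgue_cons.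
Proof.
exact: (@measure_semi_sigma_additive _ _ _
  (measure_function_pushforward__canonical__measure_function_Measure
     (@lebesgue_measure R \x mu)%E mrc)).
Qed.
HB.instance Definition _ := isMeasure.Build _ _ _ lebesgue_cons
  lebesgue_cons0 lebesgue_cons_ge0 lebesgue_cons_sigma_additive.
Let lebesgue_cons_sigma_finite : sigma_finite setT lebesgue_cons.
Proof.
have /sigma_finiteP[F [TF ndF Foo]] := sigma_finiteT (@lebesgue_measure R).
have /sigma_finiteP[G [TG ndG Goo]] := sigma_finiteT mu.
exists (fun i => @row_uncons R m @^-1` (F i `*` G i)).
  rewrite -preimage_bigcup (_ : \bigcup_i _ = setT) ?preimage_setT//.
  rewrite predeqE => -[x y]; split=> // _.
  have [n _ Fnx] : (\bigcup_i F i) x by rewrite -TF.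
  have [k _ Gky] : (\bigcup_i G i) y by rewrite -TG.
  exists (maxn n k) => //; split.
  - by move: x Fnx; exact/subsetPset/ndF/leq_maxl.
  - by move: y Gky; exact/subsetPset/ndG/leq_maxr.
move=> i; have [mF Fi] := Foo i; have [mG Gi] := Goo i; split.
  rewrite -[X in measurable X]setTI; apply: measurable_row_uncons => //.
  exact: measurableX.
rewrite /lebesgue_cons /pushforward -comp_preimage.
rewrite (_ : _ \o _ = id) ?preimage_id; last exact/funext/row_consK.
by rewrite product_measure1E// lte_mul_pinfty// ge0_fin_numE.
Qed.
HB.instance Definition _ := Measure_isSigmaFinite.Build _ _ _ lebesgue_cons
  lebesgue_cons_sigma_finite.
End lebesgue_cons.

(* Lebesgue measure on R^m as the m-fold product measure, transported along
   [row_cons] because library products live on pairs. *)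
Fixpoint lebesgue_rV (R : realType) (m : nat) :
    {sigma_finite_measure set (borel R m) -> \bar R} :=
  match m with
  | 0%N => [the {sigma_finite_measure set (borel R 0) -> \bar R} of
              @dirac _ (borel R 0) (0 : 'rV[R]_0) R]
  | m'.+1 => [the {sigma_finite_measure set (borel R (1 + m')) -> \bar R} of
                lebesgue_cons (lebesgue_rV R m')]
  end.

Arguments lebesgue_rV : clear implicits.

(* The norm of 'rV[R]_N in the library is the sup norm. *)
Definition enorm (R : realType) N (x : 'rV[R]_N) : R :=
  Num.sqrt ((x *m x^T) 0 0).

Definition orthonormal (R : realType) m N (v : 'M[R]_(m, N)) : Prop :=
  v *m v^T = 1%:M.

Definition radon (R : realType) N
    (mu : {measure set (borel R N) -> \bar R}) : Prop :=
  forall K : set 'rV[R]_N, compact K -> (mu K < +oo)%E.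

(* Row i is the partial derivative of f in direction e_i. *)
Definition partials (R : realType) a b (f : 'rV[R]_a -> 'rV[R]_b)
    (x : 'rV[R]_a) : 'M[R]_(a, b) :=
  \matrix_(i, j) 'D_(delta_mx 0 i) (fun y => f y 0 j) x.

Definition iter_partial (R : realType) N (f : 'rV[R]_N -> R)
    (s : seq 'I_N) : 'rV[R]_N -> R :=
  foldr (fun i (g : 'rV[R]_N -> R) => fun x => 'D_(delta_mx 0 i) g x) f s.

Definition smooth (R : realType) N (f : 'rV[R]_N -> R) : Prop :=
  forall s : seq 'I_N, continuous (iter_partial f s) /\
    forall i x, derivable (iter_partial f s) x (delta_mx 0 i).

Definition multilinear (R : realType) m N (a : 'M[R]_(m, N) -> R) : Prop :=
  forall (i : 'I_m) (A B C : 'M[R]_(m, N)) (b c : R),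
    row i A = b *: row i B + c *: row i C ->
    row' i B = row' i A -> row' i C = row' i A -> a A = b * a B + c * a C.

Definition alternating (R : realType) m N (a : 'M[R]_(m, N) -> R) : Prop :=
  multilinear a /\
  forall (A : 'M[R]_(m, N)) i j, i != j -> row i A = row j A -> a A = 0.

(* [w x v] is the value of the form at the point x on the m rows of v. *)
Definition dform (R : realType) m N := 'rV[R]_N -> 'M[R]_(m, N) -> R.

Definition form_supp (R : realType) m N (w : dform R m N) : set 'rV[R]_N :=
  closure [set x | exists v, w x v != 0].

Definition test_form (R : realType) m N (w : dform R m N) : Prop :=
  [/\ forall x, alternating (w x), forall v, smooth (w^~ v)
    & compact (form_supp w)].

(* Unit simple m-vectors are the wedges of orthonormal frames, so this says
   that the comass of [w] is at most M everywhere. *)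
Definition comass_le (R : realType) m N (M : R) (w : dform R m N) : Prop :=
  forall x v, orthonormal v -> `|w x v| <= M.

(* Degree m.-1 so that the boundary is defined uniformly; for m = 0 the sum is
   empty. *)
Definition ext_deriv (R : realType) m N (w : dform R m.-1 N) : dform R m N :=
  fun x v => \sum_(j < m) (-1) ^+ j *
    'D_(row j v) (fun y => w y (row' j v)) x.

Definition pullback (R : realType) m a b (f : 'rV[R]_a -> 'rV[R]_b)
    (w : dform R m b) : dform R m a :=
  fun x v => w (f x) (v *m partials f x).

(* Only the values on test forms are meaningful. *)
Definition functional (R : realType) m N := dform R m N -> R.

Definition functional_eq (R : realType) m N (T S : functional R m N) : Prop :=
  forall w, test_form w -> T w = S w.

(* The last clause is continuity for the usual topology of the space of test
   forms. *)
Definition is_current (R : realType) m N (T : functional R m N) : Prop :=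
  (forall (a : R) w e, test_form w -> test_form e ->
     T (fun x v => a * w x v + e x v) = a * T w + T e) /\
  (forall K : set 'rV[R]_N, compact K -> exists (C : R) (r : nat),
     forall (w : dform R m N) (M : R), test_form w -> form_supp w `<=` K ->
       (forall s : seq 'I_N, (size s <= r)%N ->
          comass_le M (fun x v => iter_partial (w^~ v) s x)) ->
       `|T w| <= C * M).

Definition supported_in (R : realType) m N (T : functional R m N)
    (A : set 'rV[R]_N) : Prop :=
  forall w, test_form w -> form_supp w `&` A = set0 -> T w = 0.

Definition boundary (R : realType) m N (T : functional R m N) :
    functional R m.-1 N :=
  fun w => T (ext_deriv w).

Definition mass_in (R : realType) m N (T : functional R m N)
    (U : set 'rV[R]_N) : \bar R :=
  ereal_sup [set (T w)%:E | w in
    [set w | [/\ test_form w, form_supp w `<=` U & comass_le 1 w]]].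

Definition mass (R : realType) m N (T : functional R m N) : \bar R :=
  mass_in T setT.

(* The mass measure nu_T, as a function on all sets. *)
Definition mass_measure (R : realType) m N (T : functional R m N)
    (A : set 'rV[R]_N) : \bar R :=
  ereal_inf [set mass_in T U | U in [set U | open U /\ A `<=` U]].

Definition cube (R : realType) m : set (borel R m) :=
  [set x | forall i, 0 <= (x : 'rV[R]_m) 0 i <= 1].

(* The image under f of the current of integration over the unit cube. *)
Definition cube_current (R : realType) m N (f : 'rV[R]_m -> 'rV[R]_N) :
    functional R m N :=
  fun w => \int[lebesgue_rV R m]_(x in @cube R m) pullback f w x 1%:M.

Definition lipschitz_chain (R : realType) m N p (z : 'I_p -> int)
    (f : 'I_p -> 'rV[R]_m -> 'rV[R]_N) : functional R m N :=
  fun w => \sum_(i < p) (z i)%:~R * cube_current (f i) w.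

(* Federer-Fleming: mass limits of integral Lipschitz chains (a Lipschitz image
   of an integral polyhedral m-chain is a finite integral combination of
   Lipschitz images of the m-cube). *)
Definition rectifiable (R : realType) m N (T : functional R m N) : Prop :=
  is_current T /\
  forall e : R, 0 < e ->
    exists p (z : 'I_p -> int) (f : 'I_p -> 'rV[R]_m -> 'rV[R]_N),
      (forall i, lipschitz (f i)) /\
      (mass (fun w => T w - lipschitz_chain z f w)%R <= e%:E)%E.

Definition loc_rectifiable (R : realType) m N (T : functional R m N) : Prop :=
  is_current T /\
  forall x : 'rV[R]_N, exists Q : functional R m N, rectifiable Q /\
    exists U : set 'rV[R]_N, [/\ open U, U x &
      forall w, test_form w -> form_supp w `<=` U -> T w = Q w].

(* The class I_m^loc, following Federer: T and its boundary are both locally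
   rectifiable. *)
Definition loc_integral (R : realType) m N (T : functional R m N) : Prop :=
  loc_rectifiable T /\ loc_rectifiable (boundary T).

(* The class I_m; compact support is not required. *)
Definition integral_current (R : realType) m N (T : functional R m N) : Prop :=
  [/\ loc_integral T, (mass T < +oo)%E & (mass (boundary T) < +oo)%E].

Definition basis_frame (R : realType) m N (s : {ffun 'I_m -> 'I_N}) :
    'M[R]_(m, N) :=
  \matrix_(i < m) delta_mx 0 (s i).

(* <w, xi> for the m-vector field xi = \sum_s xi_s e_(s 0) ^ ... ^ e_(s (m-1));
   summing over all s instead of the increasing ones gives the same
   m-vectors. *)
Definition pairing (R : realType) m N (w : dform R m N)
    (xi : {ffun 'I_m -> 'I_N} -> 'rV[R]_N -> R) (x : 'rV[R]_N) : R :=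
  \sum_s xi s x * w x (basis_frame R s).

(* T(w) = \int <w, xi> d mu: T is representable by integration. *)
Definition represents (R : realType) m N
    (mu : {measure set (borel R N) -> \bar R})
    (xi : {ffun 'I_m -> 'I_N} -> 'rV[R]_N -> R) (T : functional R m N) : Prop :=
  [/\ radon mu,
      forall s, measurable_fun [set: borel R N] (xi s : borel R N -> R),
      forall s (K : set 'rV[R]_N), compact K ->
        mu.-integrable K (fun x => (xi s x)%:E) &
      forall w, test_form w -> T w = \int[mu]_x pairing w xi x].

(* The value on a Borel form w of the extension of T by integration; it does not
   depend on the chosen representation. *)
Definition extend (R : realType) m N (T : functional R m N) (w : dform R m N) : R :=
  get [set r : R | exists mu xi, represents mu xi T /\
                     r = \int[mu]_x pairing w xi x].

Definition restrict_current (R : realType) m N (T : functional R m N)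
    (A : set 'rV[R]_N) : functional R m N :=
  fun w => extend T (fun x v => \1_A x * w x v).

(* T(f^# w); the use of [extend] covers smooth f and T of finite mass, without properness
   of f on the support of T. *)
Definition push_current (R : realType) m a b (f : 'rV[R]_a -> 'rV[R]_b)
    (T : functional R m a) : functional R m b :=
  fun w => extend T (pullback f w).

Definition C1 (R : realType) n (f : 'rV[R]_n -> R) : Prop :=
  forall i, (forall x, derivable f x (delta_mx 0 i)) /\
    continuous (fun x => 'D_(delta_mx 0 i) f x).

Definition supp (R : realType) n p (X : 'rV[R]_n -> 'rV[R]_p) : set 'rV[R]_n :=
  closure [set x | X x != 0].

Definition supp1 (R : realType) n (f : 'rV[R]_n -> R) : set 'rV[R]_n :=
  closure [set x | f x != 0].

Definition C1c_field (R : realType) n (X : 'rV[R]_n -> 'rV[R]_n) : Prop :=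
  (forall j, C1 (fun x => X x 0 j)) /\ compact (supp X).

Definition unit_ball_volume (R : realType) k : R :=
  fine (lebesgue_rV R k [set x | enorm x <= 1]).

(* d i bounds the diameter of C i. *)
Definition hausdorff_cover (R : realType) n (delta : R) (A : set 'rV[R]_n)
    (C : nat -> set 'rV[R]_n) (d : nat -> R) : Prop :=
  A `<=` \bigcup_i C i /\
  forall i, 0 <= d i <= delta /\
    forall x y, C i x -> C i y -> enorm (x - y) <= d i.

Definition hausdorff (R : realType) n k (A : set 'rV[R]_n) : \bar R :=
  ereal_sup [set ereal_inf
      [set (\sum_(0 <= i <oo) (unit_ball_volume R k * (Cd.2 i / 2) ^+ k)%:E)%E |
        Cd in [set Cd | hausdorff_cover delta A Cd.1 Cd.2]] |
    delta in [set delta : R | 0 < delta]].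

Definition countably_rectifiable (R : realType) n k (M : set 'rV[R]_n) : Prop :=
  exists (M0 : set 'rV[R]_n) (f : nat -> 'rV[R]_k -> 'rV[R]_n),
    [/\ hausdorff k M0 = 0%E, forall i, lipschitz (f i) &
        M `<=` M0 `|` \bigcup_i range (f i)].

(* nu restricted to W is theta H^k restricted to M; H is the restriction of the
   Hausdorff measure to the Borel sets. *)
Definition rectifiable_measure (R : realType) n k
    (nu : {measure set (borel R n) -> \bar R}) (W : set 'rV[R]_n) : Prop :=
  exists (H : {measure set (borel R n) -> \bar R}) (M : set (borel R n))
         (theta : borel R n -> R),
    [/\ forall A : set (borel R n), measurable A -> H A = hausdorff k A,
        measurable M, countably_rectifiable k M,
        measurable_fun setT theta /\ (forall x, M x -> 0 < theta x) &
        forall A : set (borel R n), measurable A ->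
          nu (A `&` W) = (\int[H]_(x in A `&` M) (theta x)%:E)%E].

(* P is the orthogonal projection onto the approximate tangent k-plane at x of
   nu restricted to W; the rows of e are an orthonormal basis of that plane. *)
Definition is_approx_tangent (R : realType) n k
    (nu : {measure set (borel R n) -> \bar R}) (W : set 'rV[R]_n)
    (x : 'rV[R]_n) (P : 'M[R]_n) : Prop :=
  exists (theta : R) (e : 'M[R]_(k, n)),
    [/\ 0 < theta, orthonormal e, P = e^T *m e &
      forall f : 'rV[R]_n -> R, continuous f -> compact (supp1 f) ->
        (fun l : R => l ^- k * \int[nu]_(y in W) f (l^-1 *: (y - x)))
          @ 0^'+ --> theta * \int[lebesgue_rV R k]_z f (z *m e)].

Definition approx_tangent (R : realType) n k
    (nu : {measure set (borel R n) -> \bar R}) (W : set 'rV[R]_n)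
    (x : 'rV[R]_n) : 'M[R]_n :=
  get (is_approx_tangent k nu W x).

(* First variation of the varifold associated with nu restricted to W; the
   trace is the divergence of X along the approximate tangent plane. *)
Definition first_variation (R : realType) n k
    (nu : {measure set (borel R n) -> \bar R}) (W : set 'rV[R]_n)
    (X : 'rV[R]_n -> 'rV[R]_n) : R :=
  \int[nu]_(x in W) \tr (approx_tangent k nu W x *m partials X x).

(* The total variation measure |delta V| on subsets of the open set W. *)
Definition variation_measure (R : realType) n k
    (nu : {measure set (borel R n) -> \bar R}) (W A : set 'rV[R]_n) : \bar R :=
  ereal_inf [set ereal_sup [set (first_variation k nu W X)%:E | X in
      [set X | [/\ C1c_field X, supp X `<=` U & forall x, enorm (X x) <= 1]]] |
    U in [set U | [/\ open U, A `<=` U & U `<=` W]]].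

Definition is_mean_curvature (R : realType) n k
    (nu : {measure set (borel R n) -> \bar R}) (W : set 'rV[R]_n)
    (H : 'rV[R]_n -> 'rV[R]_n) : Prop :=
  (forall j, measurable_fun [set: borel R n]
               ((fun x => H x 0 j) : borel R n -> R)) /\
  (forall j (K : set 'rV[R]_n), compact K -> K `<=` W ->
     nu.-integrable K (fun x => (H x 0 j)%:E)) /\
  (forall X, C1c_field X -> supp X `<=` W ->
     first_variation k nu W X = - \int[nu]_(x in W) (X x *m (H x)^T) 0 0).

Definition mean_curvature (R : realType) n k
    (nu : {measure set (borel R n) -> \bar R}) (W : set 'rV[R]_n) :
    'rV[R]_n -> 'rV[R]_n :=
  get (is_mean_curvature k nu W).

Definition gradient (R : realType) n (f : 'rV[R]_n -> R) (x : 'rV[R]_n) :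
    'rV[R]_n :=
  \row_i 'D_(delta_mx 0 i) f x.

(* |delta V| restricted to W is required to be Radon on the open set W, that is,
   finite on the compact subsets of W. *)
Definition brakke_admissible (R : realType) n k
    (nu : {measure set (borel R n) -> \bar R}) (phi : 'rV[R]_n -> R) : Prop :=
  let W := [set x | 0 < phi x] in
  [/\ rectifiable_measure k nu W,
      forall K : set 'rV[R]_n, compact K -> K `<=` W ->
        (variation_measure k nu W K < +oo)%E,
      forall A : set (borel R n), measurable A -> A `<=` W -> nu A = 0%E ->
        variation_measure k nu W A = 0%E &
      nu.-integrable W
        (fun x => (phi x * enorm (mean_curvature k nu W x) ^+ 2)%:E)].

(* The integrand vanishes outside W, where phi and its gradient are 0. *)
Definition brakke_rhs (R : realType) n k
    (nu : {measure set (borel R n) -> \bar R}) (phi : 'rV[R]_n -> R) : \bar R :=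
  let W := [set x | 0 < phi x] in
  let H := mean_curvature k nu W in
  let S := approx_tangent k nu W in
  if `[< brakke_admissible k nu phi >] then
    (\int[nu]_(x in W)
       (- (phi x * enorm (H x) ^+ 2) +
        (gradient phi x *m (1%:M - S x) *m (H x)^T) 0 0)%R%:E)%E
  else -oo%E.

(* The time domain is [0, +oo[. *)
Definition upper_deriv (R : realType) (f : R -> R) (t0 : R) : \bar R :=
  limf_esup (fun t => ((f t - f t0) / (t - t0))%:E)
            (within [set t | 0 <= t] t0^').

Definition brakke_flow (R : realType) n k
    (nu : R -> {measure set (borel R n) -> \bar R}) : Prop :=
  (forall t, 0 <= t -> radon (nu t)) /\
  (forall (t : R) (phi : 'rV[R]_n -> R), 0 <= t ->
     C1 phi -> compact (supp1 phi) -> (forall x, 0 <= phi x) ->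
     (upper_deriv (fun s => \int[nu s]_x phi x)%R t <= brakke_rhs k (nu t) phi)%E).

(* In R^(1 + n) the first coordinate is time. *)
Definition time (R : realType) n (p : 'rV[R]_(1 + n)) : R := lsubmx p 0 0.

Definition pi_x (R : realType) n (p : 'rV[R]_(1 + n)) : 'rV[R]_n := rsubmx p.

Definition slab (R : realType) n (B : set R) : set 'rV[R]_(1 + n) :=
  [set p | B (time p)].

Definition at_time0 (R : realType) n (x : 'rV[R]_n) : 'rV[R]_(1 + n) :=
  row_mx 0 x.

(* Up to orientation, the slice <T, time, t->; this sign is the one for which
   T_t starts from T_0 = boundary T. *)
Definition slice (R : realType) k n (T : functional R k.+1 (1 + n)) (t : R) :
    functional R k (1 + n) :=
  fun w => boundary (restrict_current T (@slab R n [set s | t <= s])) w -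
           restrict_current (boundary T) (@slab R n [set s | t <= s]) w.

(* The half-space is closed, so currents in it are currents in R^(1 + n) supported
   in it. The boundary condition identifies T0 with its image at time 0, and the
   mass measure of the slice is carried to R^n by pi_x. *)
Definition enhanced_motion (R : realType) k n (T0 : functional R k n)
    (T : functional R k.+1 (1 + n))
    (nu : R -> {measure set (borel R n) -> \bar R}) : Prop :=
  [/\ loc_integral T /\ supported_in T (@slab R n [set s | 0 <= s]),
      forall w, test_form w -> boundary T w = T0 (pullback (@at_time0 R n) w),
      brakke_flow k nu /\
        (forall A : set (borel R n), measurable A -> nu 0 A = mass_measure T0 A),
      {ae @lebesgue_measure R, forall t, 0 <= t ->
        forall A : set (borel R n), measurable A ->
          (mass_measure (slice T t) (@pi_x R n @^-1` A) <= nu t A)%E} &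
      forall B : set (measurableTypeR R), measurable B ->
        (mass (push_current (@pi_x R n) (restrict_current T (@slab R n B)))
           <= lebesgue_measure B `^ 2^-1 * mass T0)%E /\
        (mass (restrict_current T (@slab R n B))
           <= (lebesgue_measure B + lebesgue_measure B `^ 2^-1) * mass T0)%E].

Definition optimal_filling (R : realType) k n (T0 : functional R k n)
    (F : functional R k.+1 n) : Prop :=
  [/\ integral_current F, functional_eq (boundary F) T0 &
      forall G : functional R k.+1 n, integral_current G ->
        functional_eq (boundary G) T0 -> (mass F <= mass G)%E].

Definition extinction_time (R : realType) n
    (nu : R -> {measure set (borel R n) -> \bar R}) : \bar R :=
  ereal_sup [set t%:E | t in [set t : R | 0 <= t /\ (0 < nu t setT)%E]].

(* Main.v *)
Require Import Defs.
From HB Require Import structures.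
From mathcomp Require Import all_boot all_order all_algebra.
From mathcomp Require Import perm.
From mathcomp Require Import all_classical all_reals all_analysis.
From mathcomp Require Import measurable_realfun.
From mathcomp Require Import ring lra.
(* Again last: the libraries shadow [alternating] and [orthonormal]. *)
Require Import Defs.
Set Implicit Arguments. Unset Strict Implicit. Unset Printing Implicit Defensive.
Import Order.TTheory GRing.Theory Num.Theory.
Import numFieldNormedType.Exports.
Local Open Scope classical_set_scope.
Local Open Scope ring_scope.

(* If the flow dies before r = (M(F_opt) / M(T_0))^2, almost every t slightly
   larger than the extinction time has nu_t = 0, hence a vanishing slice T_t.
   Then T restricted to [0, t) has no boundary at time t, so its projection to
   space is a filling G of T_0 with M(G) <= t^(1/2) M(T_0) < M(F_opt), against
   minimality.

   For G to compete it has to be an integral current.  Being locally a mass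
   limit of Lipschitz chains, T is integration against L^1 coefficients a_s with
   respect to a single finite measure, the one dominating countably many
   Lipschitz images of the cube.  The extension of T to Borel forms is then
   computed by these coefficients, and G is a mass limit of Lipschitz chains
   because a chain restricted to a Borel set is such a limit: subdivide the cubes and keep
   the subcubes in which a smooth approximation of the indicator exceeds 1/2. *)

(** * Smooth functions and cutoffs *)

(** Restriction and push-forward are defined through [extend], which selects some unknown
    representation of the current by a measure and a coefficient field. Every value must therefore
    be shown independent of the selection, and this rests on [quasi_dense]: densities that agree on
    test functions agree on Borel sets. A form pulled back by [pi_x] has no compact support in time;
    integrals of such forms make sense because the slab bound on the mass of the restricted motion
    turns locally integrable coefficients into integrable ones. Lipschitz maps are treated with the
    convention that a derivative that does not exist is 0. With it the formulas for composition with
    [pi_x] and with the affine maps onto subcubes hold at every point, so a pushed chain is computed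
    by composing its maps. The boundary of the filling agrees with [T0] on test forms and inherits
    its rectifiability from [T0]; only the filling itself has to be approximated by chains. *)

Section flat.
Variable R : realType.
Implicit Types (n : nat) (t : R).

(* The index n makes the family stable under differentiation, see [is_derive_flat]. *)
Definition flat n t : R := if 0 < t then t ^- n * expR (- t^-1) else 0.

Lemma flat_le0 n t : t <= 0 -> flat n t = 0.
Proof. by move=> t0; rewrite /flat ltNge t0. Qed.

Lemma flat_gt0 n t : 0 < t -> 0 < flat n t.
Proof. by move=> t0; rewrite /flat t0 mulr_gt0 ?expR_gt0// invr_gt0 exprn_gt0. Qed.

Lemma flat_ge0 n t : 0 <= flat n t.
Proof.
by case: (ltP 0 t) => t0; [exact/ltW/flat_gt0|rewrite flat_le0].
Qed.

(** With [t = (n+1) * s] this is [s <= 1 + s <= expR s] raised to the power [n+1]. *)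
Lemma expr_expRN_le n t : 0 < t -> t ^+ n.+1 * expR (- t) <= n.+1%:R ^+ n.+1.
Proof.
move=> t0; rewrite expRN ler_pdivrMr ?expR_gt0//.
have n0 : (n.+1%:R : R) != 0 by rewrite pnatr_eq0.
have -> : t = n.+1%:R * (t / n.+1%:R) by rewrite mulrC divfK.
rewrite exprMn ler_pM2l ?exprn_gt0// expRM_natl.
rewrite lerXn2r// ?nnegrE ?expR_ge0//; first by rewrite divr_ge0// ltW.
by apply: le_trans (expR_ge1Dx _); rewrite lerDr.
Qed.

(** The quadratic bound makes the difference quotient at 0 tend to 0 in [is_derive_flat]. *)
Lemma flat_bound n t : flat n t <= n.+2%:R ^+ n.+2 * t ^+ 2.
Proof.
case: (ltP 0 t) => t0; last first.
  by rewrite flat_le0// mulr_ge0// exprn_even_ge0.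
rewrite /flat t0 -ler_pdivrMr ?exprn_gt0//.
have := @expr_expRN_le n.+1 t^-1; rewrite invr_gt0 => /(_ t0); apply: le_trans.
by rewrite !exprVn mulrAC -invfM -exprD addn2.
Qed.

Lemma is_derive_flat n t :
  is_derive t 1 (flat n) (- n%:R * flat n.+1 t + flat n.+2 t).
Proof.
have [t0|t0|->] := ltgtP t 0.
- rewrite !flat_le0 ?ltW// mulr0 addr0.
  apply: (@near_eq_is_derive _ _ _ (cst (0:R))).
  by near=> x; rewrite flat_le0//; near: x; exact: lt_le_nbhsl.
- have t'0 : t != 0 by rewrite gt_eqF.
  apply: (@near_eq_is_derive _ _ _ (((fun t : R => t^-1) ^+ n) * (expR \o (fun t => - t^-1)))).
    near=> x; rewrite /flat ifT ?fctE/= ?exprVn//; near: x.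
    exact: lt_nbhsr.
  have di : is_derive t 1 (fun t : R => t^-1) (- t^-2).
    apply: is_derive_eq; first exact: is_deriveV.
    by rewrite scaler1.
  have de : is_derive t 1 (expR \o (fun t => - t^-1)) (expR (- t^-1) * t ^- 2).
    apply: is_derive1_comp; rewrite -[X in is_derive _ _ _ X]opprK.
    exact: is_deriveN.
  apply: is_derive_eq.
  rewrite /flat t0 fctE /= ![_ *: _]mulrC.
  case: n => [|n]; first by rewrite !expr0 oppr0 !mul0r mulr0 mul0r add0r addr0 mulr1 mulrC.
  rewrite /= !exprVn !exprS; field.
  by rewrite t'0/= expf_neq0.
- rewrite !flat_le0// mulr0 addr0.
  suff H : (fun h : R => h^-1 *: ((flat n \o shift 0) (h *: 1) - flat n 0)) @ 0^' --> (0 : R).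
    by apply: DeriveDef; [apply/cvg_ex; exists 0|exact/cvg_lim].
  apply/cvgr0Pnorm_le => e e0; near=> h.
  have h0 : h != 0 by near: h; exact: nbhs_dnbhs_neq.
  rewrite /= addr0 (flat_le0 n (lexx 0)) subr0 [h *: 1]mulr1 [_ *: _]mulrC mulrC normrM normfV ler_pdivrMl ?normr_gt0//.
  rewrite (ger0_norm (flat_ge0 _ _)) (le_trans (flat_bound _ _))//.
  rewrite -real_normK ?num_real// mulrC expr2 -mulrA ler_pM2l ?normr_gt0//.
  rewrite -ler_pdivlMr ?exprn_gt0//.
  by near: h; apply: dnbhs0_le; rewrite divr_gt0 ?exprn_gt0.
Unshelve. all: by end_near.
Qed.

End flat.


Section smc.
Variables (R : realType) (N : nat).
Implicit Types (f g : 'rV[R]_N -> R).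

(** Reduces a directional derivative to one real variable, where the chain rule and the mean value
    theorem are available. *)
Lemma is_derive_lineP f (x v : 'rV[R]_N) (df : R) :
  is_derive x v f df <-> is_derive (0 : R) 1 (fun h : R => f (h *: v + x)) df.
Proof.
have E : 'D_v f x = 'D_1 (fun h : R => f (h *: v + x)) 0.
  rewrite /derive.
  set g1 := (X in X @ _); set g2 := (X in _ = lim (X @ _)).
  suff -> : g1 = g2 by [].
  apply/funext => h; rewrite /g1 /g2 /= addr0 scale0r add0r.
  by rewrite [h *: 1](mulr1).
split=> -[d1 d2]; apply: DeriveDef.
- exact: (iffLR (derivable1P f x v) d1).
- exact: etrans (esym E) d2.
- exact: (iffRL (derivable1P f x v) d1).
- exact: etrans E d2.
Qed.

Lemma is_derive_comp_real f (h : R -> R) (x v : 'rV[R]_N) (df dh : R) :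
  is_derive x v f df -> is_derive (f x) 1 h dh -> is_derive x v (h \o f) (dh * df).
Proof.
move=> /is_derive_lineP df' dh'; apply/is_derive_lineP.
apply: (@is_derive1_comp _ h (fun h : R => f (h *: v + x))) => //.
by rewrite scale0r add0r.
Qed.

Lemma is_derive_coord (i : 'I_N) (x v : 'rV[R]_N) :
  is_derive x v (fun x : 'rV[R]_N => x 0 i) (v 0 i).
Proof.
apply/is_derive_lineP.
rewrite (_ : (fun h => _) = (fun h : R => h * v 0 i + x 0 i)); last first.
  by apply/funext => h; rewrite !mxE.
apply: is_derive_eq; rewrite ?addr0 ?scaler0 ?add0r ?addr0 ?scaler1 //.
Qed.

(* Stable under partial derivatives, so all members are smooth by [smooth_coind]. *)
Inductive smc : ('rV[R]_N -> R) -> Prop :=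
| smc_smooth f : smooth f -> smc f
| smc_flat n i c d : smc (fun x => flat n (c * x 0 i + d))
| smc_cst c : smc (fun=> c)
| smc_add f g : smc f -> smc g -> smc (fun x => f x + g x)
| smc_mul f g : smc f -> smc g -> smc (fun x => f x * g x)
| smc_inv f : (forall x, f x != 0) -> smc f -> smc (fun x => (f x)^-1).

Lemma smooth_partial f i : smooth f -> smooth ('D_(delta_mx 0 i) f).
Proof.
move=> sf s; have := sf (rcons s i).
by rewrite /iter_partial foldr_rcons.
Qed.

Lemma smooth_continuous f : smooth f -> continuous f.
Proof. by move=> /(_ [::])[]. Qed.

Lemma smooth_derivable f i x : smooth f -> derivable f x (delta_mx 0 i).
Proof. by move=> /(_ [::])[_]; apply. Qed.

(** Coinduction: iterated partial derivatives never leave [S]. *)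
Lemma smooth_coind (S : set ('rV[R]_N -> R)) :
  (forall f, S f -> [/\ continuous f, forall i x, derivable f x (delta_mx 0 i)
     & forall i, S ('D_(delta_mx 0 i) f)]) ->
  forall f, S f -> smooth f.
Proof.
move=> H f Sf s.
suff: S (iter_partial f s) by move=> /H[].
elim: s => [|i s IH] //=.
by case: (H _ IH) => _ _; apply.
Qed.

Lemma smc_continuous f : smc f -> continuous f.
Proof.
elim => {f}[f /smooth_continuous//|n i c d|c|f g _ cf _ cg|f g _ cf _ cg|f f0 _ cf] x.
- apply: (@continuous_comp _ _ _ (fun x : 'rV[R]_N => c * x 0 i + d) (flat n)).
    apply: (@continuousD _ _ _ (fun x : 'rV[R]_N => c * x 0 i) (cst d)); last exact: cst_continuous.
    by apply: (@continuousM _ _ (cst c) (fun x : 'rV[R]_N => x 0 i)); [exact: cst_continuous|exact: coord_continuous].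
  apply: differentiable_continuous; apply/derivable1_diffP.
  by have [] := is_derive_flat n (c * x 0 i + d).
- exact: cst_continuous.
- by apply: continuousD; [exact: cf|exact: cg].
- by apply: continuousM; [exact: cf|exact: cg].
- by apply: (@continuousV _ _ f) => //; exact: cf.
Qed.

Lemma smc_derive f i : smc f ->
  exists2 g, smc g & forall x, is_derive x (delta_mx 0 i) f (g x).
Proof.
elim => {f}[f sf|n j c d|c|f g sf [f' sf' df] sg [g' sg' dg]|f g sf [f' sf' df] sg [g' sg' dg]|f f0 sf [f' sf' df]].
- exists ('D_(delta_mx 0 i) f) => [|x]; first exact/smc_smooth/smooth_partial.
  by apply: DeriveDef => //; exact: smooth_derivable.
- exists (fun x => (- n%:R * flat n.+1 (c * x 0 j + d) + flat n.+2 (c * x 0 j + d)) *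
     (c * (delta_mx 0 i : 'rV[R]_N) 0 j)).
    apply: smc_mul; last exact: smc_cst.
    apply: smc_add; last exact: smc_flat.
    by apply: smc_mul; [exact: smc_cst|exact: smc_flat].
  move=> x; apply: (@is_derive_comp_real (fun x => c * x 0 j + d) (flat n)).
    have := is_derive_coord j x (delta_mx 0 i) => dc.
    by apply: is_derive_eq; rewrite addr0.
  exact: is_derive_flat.
- by exists (fun=> 0) => [|x]; [exact: smc_cst|exact: is_derive_cst].
- exists (fun x => f' x + g' x); first exact: smc_add.
  by move=> x; apply: is_deriveD.
- exists (fun x => f x * g' x + g x * f' x) => [|x]; last exact: is_deriveM.
  by apply: smc_add; exact: smc_mul.
- exists (fun x => - ((f x)^-1 * (f x)^-1) * f' x) => [|x].
    apply: smc_mul => //.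
    rewrite (_ : (fun x => _) = (fun x => -1 * ((f x)^-1 * (f x)^-1))); last first.
      by apply/funext => y; rewrite mulN1r.
    by apply: smc_mul; [exact: smc_cst|apply: smc_mul; exact: smc_inv].
  have [d1 d2] := df x; apply: DeriveDef; first exact: derivableV.
  by rewrite deriveV// d2 /= expr2 invfM.
Qed.

Lemma smc_is_smooth f : smc f -> smooth f.
Proof.
apply: (smooth_coind (S := smc)) => {}f sf; split.
- exact: smc_continuous.
- by move=> i x; have [g _ /(_ x)[]] := smc_derive i sf.
- move=> i; have [g sg dg] := smc_derive i sf.
  by rewrite (_ : 'D__ f = g)//; apply/funext => x; have [] := dg x.
Qed.
End smc.


Section gate.
Variable R : realType.
Implicit Types (t : R).

(* A smooth step: 0 for t <= 0 and 1 for t >= 1. *)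
Definition gate t : R := flat 0 t / (flat 0 t + flat 0 (1 - t)).

Lemma gate_den_gt0 t : 0 < flat 0 t + flat 0 (1 - t).
Proof.
have [t0|t0] := ltP 0 t; first by rewrite ltr_wpDr ?flat_ge0// flat_gt0.
by rewrite ltr_wpDl ?flat_ge0// flat_gt0// subr_gt0 (le_lt_trans t0).
Qed.

Lemma gate_le0 t : t <= 0 -> gate t = 0.
Proof. by move=> t0; rewrite /gate flat_le0// mul0r. Qed.

Lemma gate_ge1 t : 1 <= t -> gate t = 1.
Proof.
move=> t1; rewrite /gate (@flat_le0 _ 0 (1 - t)) ?subr_le0// addr0 divff// gt_eqF//.
by rewrite flat_gt0// (lt_le_trans ltr01).
Qed.

Lemma gate_ge0 t : 0 <= gate t.
Proof. by rewrite divr_ge0 ?flat_ge0// ltW// gate_den_gt0. Qed.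

Lemma gate_le1 t : gate t <= 1.
Proof. by rewrite ler_pdivrMr ?gate_den_gt0// mul1r lerDl flat_ge0. Qed.
End gate.

Section smooth_theory.
Variables (R : realType) (N : nat).
Implicit Types (f g : 'rV[R]_N -> R).

Lemma smooth_cst c : smooth (fun=> c : R) (N := N).
Proof. by apply: smc_is_smooth; exact: smc_cst. Qed.

Lemma smoothD f g : smooth f -> smooth g -> smooth (fun x => f x + g x).
Proof. by move=> sf sg; apply/smc_is_smooth/smc_add; exact: smc_smooth. Qed.

Lemma smoothM f g : smooth f -> smooth g -> smooth (fun x => f x * g x).
Proof. by move=> sf sg; apply/smc_is_smooth/smc_mul; exact: smc_smooth. Qed.

Lemma smooth_sum I (r : seq I) (F : I -> 'rV[R]_N -> R) :
  (forall i, smooth (F i)) -> smooth (fun x => \sum_(i <- r) F i x).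
Proof.
move=> sF; elim: r => [|i r IH].
  by under eq_fun do rewrite big_nil; exact: smooth_cst.
by under eq_fun do rewrite big_cons; exact: (smoothD (sF i) IH).
Qed.

Lemma smooth_prod I (r : seq I) (F : I -> 'rV[R]_N -> R) :
  (forall i, smooth (F i)) -> smooth (fun x => \prod_(i <- r) F i x).
Proof.
move=> sF; elim: r => [|i r IH].
  by under eq_fun do rewrite big_nil; exact: smooth_cst.
by under eq_fun do rewrite big_cons; exact: (smoothM (sF i) IH).
Qed.

Lemma smooth_gate (i : 'I_N) (c d : R) :
  smooth (fun x : 'rV[R]_N => gate (c * x 0 i + d)).
Proof.
apply/smc_is_smooth/smc_mul; first exact: smc_flat.
apply: smc_inv => [x|]; first by rewrite gt_eqF ?gate_den_gt0.
apply: smc_add; first exact: smc_flat.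
rewrite (_ : (fun x => _) = (fun x : 'rV[R]_N => flat 0 (- c * x 0 i + (1 - d)))); first exact: smc_flat.
by apply/funext => x; congr flat; ring.
Qed.

(** The intermediate [t] lies between 0 and [a], which may have either sign; hence the two
    applications of the mean value theorem. *)
Lemma MVT_coord f i (y : 'rV[R]_N) (a : R) :
  (forall x, derivable f x (delta_mx 0 i)) ->
  exists2 t : R, `|t| <= `|a| &
    f (a *: delta_mx 0 i + y) - f y = a * 'D_(delta_mx 0 i) f (t *: delta_mx 0 i + y).
Proof.
move=> df; set e := delta_mx 0 i.
have dg (s : R) : is_derive s 1 (fun s : R => f (s *: e + y)) ('D_e f (s *: e + y)).
  have dl : is_derive (0 : R) 1 (fun h : R => f (h *: e + (s *: e + y))) ('D_e f (s *: e + y)).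
    by apply/is_derive_lineP; apply: DeriveDef.
  rewrite (_ : (fun s => _) = (fun h : R => f (h *: e + (s *: e + y))) \o (fun r => r - s)); last first.
    by apply/funext => r /=; rewrite addrA -scalerDl subrK.
  rewrite -[X in is_derive _ _ _ X]mulr1.
  apply: is_derive1_comp; rewrite ?subrr//.
  by apply: is_derive_eq; rewrite subr0.
have cg : continuous (fun s : R => f (s *: e + y)).
  by move=> s; apply/differentiable_continuous/derivable1_diffP; have [] := dg s.
have [a0|a0] := leP 0 a.
  have [c] := MVT_segment a0 (fun x _ => dg x) (continuous_subspaceT cg).
  rewrite in_itv/= => /andP[c0 ca] E; exists c; first by rewrite !ger0_norm.
  by move: E; rewrite subr0 scale0r add0r mulrC.
have [c] := MVT_segment (ltW a0) (fun x _ => dg x) (continuous_subspaceT cg).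
rewrite in_itv/= => /andP[ca c0] E; exists c.
  by rewrite !ler0_norm ?lerN2// ltW.
move: E; rewrite scale0r add0r sub0r => /(congr1 -%R).
by rewrite opprB => ->; rewrite mulrN opprK mulrC.
Qed.

(* Builds the directional derivative one coordinate at a time; applied along a basis
   it shows that continuous partial derivatives suffice for linearity in the direction. *)
Lemma is_derive_addcoord f i (x u : 'rV[R]_N) (c d : R) : smooth f ->
  is_derive x u f d ->
  is_derive x (c *: delta_mx 0 i + u) f (c * 'D_(delta_mx 0 i) f x + d).
Proof.
move=> sf [du1 du2]; set e := delta_mx 0 i.
have cD : continuous ('D_e f) by exact/smooth_continuous/smooth_partial.
(* The intermediate point of the mean value theorem for the step [h * c]. It tends to 0 with [h], so
   continuity of the partial derivative yields the limit of the first summand in [H1]. *)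
pose th (h : R) := sval (cid2 (MVT_coord (h *: u + x) (h * c) (fun y => @smooth_derivable _ _ f i y sf))).
have thP h : `|th h| <= `|h * c| /\ f ((h * c) *: e + (h *: u + x)) - f (h *: u + x) =
   (h * c) * 'D_e f (th h *: e + (h *: u + x)).
  by rewrite /th; case: cid2.
suff H : (fun h : R => h^-1 *: ((f \o shift x) (h *: (c *: e + u)) - f x)) @ 0^' --> (c * 'D_e f x + d).
  by apply: DeriveDef; [apply/cvg_ex; eexists; exact: H|exact/cvg_lim].
have H1 : (fun h : R => c * 'D_e f (th h *: e + (h *: u + x)) +
    h^-1 *: ((f \o shift x) (h *: u) - f x)) @ 0^' --> (c * 'D_e f x + d).
  apply: cvgD; last by rewrite -du2; exact: du1.
  apply: cvgM; first exact: cvg_cst.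
  apply: (@cvg_comp _ _ _ (fun h : R => th h *: e + (h *: u + x)) ('D_e f) _ (nbhs x)); last exact: cD.
  suff : (fun h : R => th h *: e + (h *: u + x)) @ 0^' --> 0 + x by rewrite add0r.
  apply: cvgD.
    rewrite -[X in _ --> X](scale0r e); apply: cvgZr_tmp.
    apply/cvgr0Pnorm_le => eps e0; have [c0|c0] := eqVneq c 0.
      by near=> h; rewrite (le_trans (proj1 (thP h)))// c0 mulr0 normr0 ltW.
    near=> h; apply: le_trans (proj1 (thP h)) _; rewrite normrM.
    rewrite -ler_pdivlMr ?normr_gt0//; near: h; apply: dnbhs0_le.
    by rewrite divr_gt0 ?normr_gt0.
  rewrite -[X in _ --> X]add0r; apply: cvgD; last exact: cvg_cst.
  rewrite -[X in _ --> X](scale0r u); apply: cvgZr_tmp.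
  by apply/cvgr0Pnorm_le => eps e0; exact: dnbhs0_le.
apply: cvg_trans H1; apply: near_eq_cvg; near=> h.
have h0 : h != 0 by near: h; exact: nbhs_dnbhs_neq.
have -> : (f \o shift x) (h *: (c *: e + u)) = f ((h * c) *: e + (h *: u + x)).
  by rewrite /= scalerDr scalerA addrA.
have -> : f ((h * c) *: e + (h *: u + x)) =
  (h * c) * 'D_e f (th h *: e + (h *: u + x)) + f (h *: u + x).
  by rewrite -(proj2 (thP h)) subrK.
by rewrite /= ![h^-1 *: _]mulrC; field.
Unshelve. all: by end_near.
Qed.

Lemma smooth_is_derive f (x v : 'rV[R]_N) : smooth f ->
  is_derive x v f (\sum_i v 0 i * 'D_(delta_mx 0 i) f x).
Proof.
move=> sf; rewrite [X in is_derive _ X](row_sum_delta v).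
elim: (index_enum _) => [|i r IH]; first by rewrite !big_nil; exact: is_derive0.
by rewrite !big_cons; exact: is_derive_addcoord.
Qed.

Lemma smooth_deriveE f (v x : 'rV[R]_N) : smooth f ->
  'D_v f x = \sum_i v 0 i * 'D_(delta_mx 0 i) f x.
Proof. by move=> sf; have [] := smooth_is_derive x v sf. Qed.

Lemma smooth_derive f (v : 'rV[R]_N) : smooth f -> smooth ('D_v f).
Proof.
move=> sf.
have -> : 'D_v f = fun x => \sum_i v 0 i * 'D_(delta_mx 0 i) f x.
  by apply/funext => x; exact: smooth_deriveE.
apply: (@smooth_sum _ _ (fun i x => v 0 i * 'D_(delta_mx 0 i) f x)) => i.
exact: (smoothM (smooth_cst (v 0 i)) (smooth_partial i sf)).
Qed.

Lemma smooth_derive_lin f (a b : R) (u v x : 'rV[R]_N) : smooth f ->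
  'D_(a *: u + b *: v) f x = a * 'D_u f x + b * 'D_v f x.
Proof.
move=> sf; rewrite !(smooth_deriveE _ _ sf) !mulr_sumr -big_split; apply: eq_bigr => i _ /=.
by rewrite !mxE mulrDl !mulrA.
Qed.

Lemma smooth_derivable_dir f (v x : 'rV[R]_N) : smooth f -> derivable f x v.
Proof. by move=> sf; have [] := smooth_is_derive x v sf. Qed.

End smooth_theory.

Section testfun.
Variables (R : realType) (N : nat).
Implicit Types (f g : 'rV[R]_N -> R).

Definition testfun f := smooth f /\ compact (supp1 f).

Lemma norm_rV_le (x : 'rV[R]_N) (r : R) : 0 <= r ->
  (`|x| <= r) <-> (forall i, `|x 0 i| <= r).
Proof.
move=> r0; split=> [xr i|H].
  apply: le_trans xr; rewrite /Num.norm /= mx_normrE.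
  exact: (le_bigmax _ (fun ij => `|x ij.1 ij.2|) (0, i)).
by rewrite /Num.norm /= mx_normrE; apply: bigmax_le => // -[i j] _ /=; rewrite ord1.
Qed.

Lemma closed_cball (c : 'rV[R]_N) (r : R) : closed [set x : 'rV[R]_N | `|x - c| <= r].
Proof.
rewrite (_ : [set x | _] = (fun x : 'rV[R]_N => `|x - c|) @^-1` [set t | t <= r])//.
apply: closed_comp => [x _|]; last exact: closed_le.
apply: (@continuous_comp _ _ _ (fun x : 'rV[R]_N => x - c)); last exact: norm_continuous.
by apply: (@continuousB _ _ _ id (cst c)); [move=> ? ?|exact: cst_continuous].
Qed.

Lemma compact_cball (c : 'rV[R]_N) (r : R) : compact [set x : 'rV[R]_N | `|x - c| <= r].
Proof.
apply: bounded_closed_compact; last exact: closed_cball.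
exists (r + `|c|); split; first exact: num_real.
move=> M rM x /= xr; apply: ltW; apply: le_lt_trans rM.
by rewrite -[X in `|X| <= _](subrK c) (le_trans (ler_normD _ _))// lerD2r.
Qed.

Lemma supp1_sub_closed f (A : set 'rV[R]_N) : closed A ->
  (forall x, f x != 0 -> A x) -> supp1 f `<=` A.
Proof. by move=> cA H; rewrite [X in _ `<=` X](closure_id A).1//; exact: closure_subset. Qed.

Lemma testfun_cball f (c : 'rV[R]_N) (r : R) : smooth f ->
  (forall x, f x != 0 -> `|x - c| <= r) -> testfun f.
Proof.
move=> sf H; split => //; have cB := @compact_cball c r.
refine (@subclosed_compact _ _ _ _ cB _); first exact: closed_closure.
by apply: supp1_sub_closed => //; exact: closed_cball.
Qed.

Lemma supp1_out f x : ~ supp1 f x -> f x = 0.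
Proof.
by move=> H; apply: contrapT => /eqP fx; apply: H; exact: subset_closure.
Qed.

Lemma compact_supp_bounded (A : set 'rV[R]_N) : compact A ->
  exists2 r : R, 0 < r & forall x, A x -> `|x| <= r.
Proof.
move=> /compact_bounded[M [Mr HM]]; exists (`|M| + 1); first by rewrite ltr_wpDl.
move=> x Ax; apply: HM => //; rewrite (le_lt_trans (ler_norm M))// ltrDl//.
Qed.

Lemma testfun_cont f : testfun f -> continuous f.
Proof. by case=> /smooth_continuous. Qed.

Lemma testfun_measurable f : testfun f -> measurable_fun setT (f : borel R N -> R).
Proof. by move=> tf; apply: continuous_measurable_borel; exact: testfun_cont. Qed.

Lemma compact_closure_sub (A B : set 'rV[R]_N) :
  A `<=` B -> compact (closure B) -> compact (closure A).
Proof.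
move=> AB cB; apply: (subclosed_compact _ cB); first exact: closed_closure.
exact: closure_subset.
Qed.

Lemma testfunMr f g : testfun f -> smooth g -> testfun (fun x => f x * g x).
Proof.
move=> [sf cf] sg; split; first exact: smoothM.
apply: compact_closure_sub cf => x /=; apply: contraNneq => ->.
by rewrite mul0r.
Qed.

Lemma testfunMl f g : smooth f -> testfun g -> testfun (fun x => f x * g x).
Proof.
by move=> sf tg; under eq_fun do rewrite mulrC; exact: testfunMr.
Qed.

Lemma testfunD f g : testfun f -> testfun g -> testfun (fun x => f x + g x).
Proof.
move=> [sf cf] [sg cg]; split; first exact: smoothD.
apply: (@compact_closure_sub _ (supp1 f `|` supp1 g)).
  move=> x /= fg; have [f0|f0] := eqVneq (f x) 0; [right|left]; apply: subset_closure => //=.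
  by move: fg; rewrite f0 add0r.
rewrite -(closure_id _).1; first exact: compactU.
by apply: closedU; exact: closed_closure.
Qed.

Lemma testfun0 : testfun (fun=> 0 : R).
Proof.
split; first exact: smooth_cst.
rewrite /supp1 (_ : [set x | _] = set0) ?closure0; first exact: compact0.
by rewrite -subset0 => x /=; rewrite eqxx.
Qed.

Lemma testfun_bounded f : testfun f -> exists2 M : R, 0 < M & forall x, `|f x| <= M.
Proof.
move=> tf; have cf := testfun_cont tf; case: tf => _ sc.
have [M [Mr HM]] : bounded_set (f @` supp1 f).
  apply/compact_bounded/continuous_compact => //.
  exact: continuous_subspaceT.
exists (`|M| + 1); first by rewrite ltr_wpDl.
move=> x; have [fx|/supp1_out->] := pselect (supp1 f x); last by rewrite normr0 addr_ge0.
apply: HM; last by exists x.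
by rewrite (le_lt_trans (ler_norm M))// ltrDl.
Qed.

(** Balls of the sup norm are cubes, so a product over the coordinates gives a cutoff that is 1 on
    the ball of radius [r] and 0 outside the ball of radius [2 * r]. *)
Definition plateau (c : 'rV[R]_N) (r : R) (x : 'rV[R]_N) : R :=
  \prod_i (gate (r^-1 * x 0 i + (2 - c 0 i / r)) * gate (- r^-1 * x 0 i + (2 + c 0 i / r))).

Lemma smooth_plateau c r : smooth (plateau c r).
Proof.
apply: (@smooth_prod _ _ _ _ (fun i (x : 'rV[R]_N) => gate (r^-1 * x 0 i + (2 - c 0 i / r)) * gate (- r^-1 * x 0 i + (2 + c 0 i / r)))) => i.
apply: smoothM; exact: smooth_gate.
Qed.

Lemma plateau_ge0 c r x : 0 <= plateau c r x.
Proof. by apply: prodr_ge0 => i _; rewrite mulr_ge0 ?gate_ge0. Qed.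

Lemma plateau_le1 c r x : plateau c r x <= 1.
Proof.
by apply: prodr_ile1 => i _; rewrite mulr_ge0 ?gate_ge0//= mulr_ile1 ?gate_ge0 ?gate_le1.
Qed.

Lemma plateau1 c r x : 0 < r -> `|x - c| <= r -> plateau c r x = 1.
Proof.
move=> r0 /(norm_rV_le _ (ltW r0)).1 H; apply: big1 => i _.
have := H i; rewrite !mxE ler_norml => /andP[h1 h2].
have {}h1 : -1 <= (x 0 i - c 0 i) / r by rewrite ler_pdivlMr// mulN1r.
have {}h2 : (x 0 i - c 0 i) / r <= 1 by rewrite ler_pdivrMr// mul1r.
rewrite !gate_ge1 ?mulr1//.
  rewrite (_ : _ + _ = 2 - (x 0 i - c 0 i) / r); first lra.
  by ring.
rewrite (_ : _ + _ = 2 + (x 0 i - c 0 i) / r); first lra.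
by ring.
Qed.

Lemma plateau_supp c r x : 0 < r -> plateau c r x != 0 -> `|x - c| <= 2 * r.
Proof.
move=> r0 /prodf_neq0 H; apply/norm_rV_le => [|i]; first by rewrite mulr_ge0// ltW.
have := H i isT; rewrite mulf_eq0 negb_or !mxE => /andP[h1 h2].
rewrite ler_norml; apply/andP; split.
  rewrite leNgt; apply: contraNN h1 => h; apply/eqP/gate_le0.
  have : (x 0 i - c 0 i) / r < -2 by rewrite ltr_pdivrMr// mulNr.
  by rewrite (_ : r^-1 * _ + _ = 2 + (x 0 i - c 0 i) / r); [lra|ring].
rewrite leNgt; apply: contraNN h2 => h; apply/eqP/gate_le0.
have : 2 < (x 0 i - c 0 i) / r by rewrite ltr_pdivlMr.
by rewrite (_ : - r^-1 * _ + _ = 2 - (x 0 i - c 0 i) / r); [lra|ring].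
Qed.

Lemma testfun_plateau c r : 0 < r -> testfun (plateau c r).
Proof.
move=> r0; apply: (@testfun_cball _ c (2 * r)) => [|x]; first exact: smooth_plateau.
exact: plateau_supp.
Qed.

Definition obox (a b : 'rV[R]_N) : set 'rV[R]_N := [set x | forall i, a 0 i < x 0 i < b 0 i].

(** Each gate opens inside the box, over a width [1/n]: the product vanishes off the open box and
    converges to its indicator at every point. *)
Definition boxfun (n : nat) (a b x : 'rV[R]_N) : R :=
  \prod_i (gate (n%:R * x 0 i + - (n%:R * a 0 i)) * gate (- n%:R * x 0 i + n%:R * b 0 i)).

Lemma smooth_boxfun n a b : smooth (boxfun n a b).
Proof.
apply: (@smooth_prod _ _ _ _ (fun i (x : 'rV[R]_N) => gate (n%:R * x 0 i + - (n%:R * a 0 i)) * gate (- n%:R * x 0 i + n%:R * b 0 i))) => i.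
apply: smoothM; exact: smooth_gate.
Qed.

Lemma boxfun_ge0 n a b x : 0 <= boxfun n a b x.
Proof. by apply: prodr_ge0 => i _; rewrite mulr_ge0 ?gate_ge0. Qed.

Lemma boxfun_le1 n a b x : boxfun n a b x <= 1.
Proof.
by apply: prodr_ile1 => i _; rewrite mulr_ge0 ?gate_ge0//= mulr_ile1 ?gate_ge0 ?gate_le1.
Qed.

Lemma boxfun_out n a b x : ~ obox a b x -> boxfun n a b x = 0.
Proof.
move=> /existsNP[i /negP]; rewrite negb_and -!leNgt => /orP H.
apply/eqP/prodf_eq0; exists i => //=.
rewrite mulf_eq0; case: H => h; apply/orP; [left|right]; rewrite gate_le0//.
  by rewrite subr_le0 ler_wpM2l.
by rewrite mulNr addrC subr_le0 ler_wpM2l.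
Qed.

Lemma boxfun_cvg a b x : boxfun n a b x @[n --> \oo] --> (\1_(obox a b) x : R).
Proof.
have [xb|xb] := pselect (obox a b x); last first.
  rewrite indicE memNset//; under eq_cvg do rewrite boxfun_out//.
  exact: cvg_cst.
rewrite indicE mem_set//; apply: cvg_near_cst.
have H i : \forall n \near \oo, gate (n%:R * x 0 i + - (n%:R * a 0 i)) * gate (- n%:R * x 0 i + n%:R * b 0 i) = 1.
  have /andP[ax xb'] := xb i; near=> n.
  rewrite !gate_ge1 ?mulr1//.
    rewrite mulNr addrC -mulrBr -ler_pdivrMr ?subr_gt0// div1r.
    by near: n; exact: nbhs_infty_ger.
  rewrite -mulrBr -ler_pdivrMr ?subr_gt0// div1r.
  by near: n; exact: nbhs_infty_ger.
near=> n; apply: big1 => i _.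
by move: i isT; near: n; apply: filter_forall => i; near=> n => _; near: n; exact: H.
Unshelve. all: by end_near.
Qed.

Lemma testfun_boxfun n a b : testfun (boxfun n a b).
Proof.
have [M [Mr HM]] : bounded_set (obox a b).
  exists (`|a| + `|b|); split; first exact: num_real.
  move=> M rM x /= xr; apply: ltW; apply: le_lt_trans rM.
  apply/norm_rV_le => [|i]; first by rewrite addr_ge0.
  have /andP[h1 h2] := xr i.
  have ha : `|a 0 i| <= `|a| by apply: (norm_rV_le a (normr_ge0 a)).1.
  have hb : `|b 0 i| <= `|b| by apply: (norm_rV_le b (normr_ge0 b)).1.
  rewrite ler_norml; move: ha hb; rewrite !ler_norml => /andP[? ?] /andP[? ?]; lra.
apply: (@testfun_cball _ 0 (M + 1)) => [|x]; first exact: smooth_boxfun.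
move=> bx; rewrite subr0; apply: HM; first by rewrite ltrDl.
by apply: contrapT => /boxfun_out E; rewrite E eqxx in bx.
Qed.
End testfun.

(** * Multilinear algebra and test forms *)

Section multilinear.
Variables (R : realType) (m N : nat).
Implicit Types (A B : 'M[R]_(m, N)) (a b : 'M[R]_(m, N) -> R) (s t : {ffun 'I_m -> 'I_N}).

(** Replacing a row turns the relational definition of [multilinear] into equations that can be
    rewritten with. *)
Definition setrow (i : 'I_m) (u : 'rV[R]_N) A : 'M[R]_(m, N) :=
  \matrix_(i', j) if i' == i then u 0 j else A i' j.

Lemma row_setrow i u A : row i (setrow i u A) = u.
Proof. by apply/rowP => j; rewrite !mxE eqxx. Qed.

Lemma row_setrow_neq i j u A : j != i -> row j (setrow i u A) = row j A.
Proof. by move=> ij; apply/rowP => k; rewrite !mxE (negbTE ij). Qed.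

Lemma row'_setrow i u A : row' i (setrow i u A) = row' i A.
Proof. by apply/matrixP => k j; rewrite !mxE eq_sym (negbTE (neq_lift _ _)). Qed.

Lemma setrow_id i A : setrow i (row i A) A = A.
Proof. by apply/matrixP => k j; rewrite !mxE; case: eqVneq => // ->. Qed.

Lemma setrowC i j u v A : i != j -> setrow i u (setrow j v A) = setrow j v (setrow i u A).
Proof.
move=> ij; apply/matrixP => k l; rewrite !mxE.
by case: (eqVneq k i) => [->|//]; rewrite (negbTE ij).
Qed.

Lemma multilinear_setrow a i (u v : 'rV[R]_N) (b c : R) A : multilinear a ->
  a (setrow i (b *: u + c *: v) A) = b * a (setrow i u A) + c * a (setrow i v A).
Proof. by move=> ma; apply: (ma i); rewrite ?row_setrow ?row'_setrow. Qed.

Lemma multilinear_setrow_sum a i I (r : seq I) (c : I -> R) (u : I -> 'rV[R]_N) A :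
  multilinear a ->
  a (setrow i (\sum_(j <- r) c j *: u j) A) = \sum_(j <- r) c j * a (setrow i (u j) A).
Proof.
move=> ma; elim: r => [|j r IH].
  rewrite !big_nil -[0 in LHS](_ : 0 *: 0 + 0 *: (0 : 'rV[R]_N) = 0); last by rewrite !scaler0 addr0.
  by rewrite multilinear_setrow// !mul0r addr0.
rewrite !big_cons -[\sum_(_ <- _) _ *: _]scale1r multilinear_setrow// mul1r.
by rewrite IH.
Qed.

Lemma multilinear_row_expand a i A : multilinear a ->
  a A = \sum_j A i j * a (setrow i (delta_mx 0 j) A).
Proof.
move=> ma; rewrite -[in LHS](setrow_id i A) [row i A in LHS]row_sum_delta.
rewrite multilinear_setrow_sum//; apply: eq_bigr => j _; by rewrite mxE.
Qed.

Lemma multilinear_eq0 a : multilinear a ->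
  (forall s, a (basis_frame R s) = 0) -> forall A, a A = 0.
Proof.
move=> ma a0.
(* Induction on the number [k] of leading rows that may be arbitrary; the rows from index [k] on are
   basis vectors. *)
suff H : forall k : nat, forall A, (forall i : 'I_m, (k <= i)%N -> exists j, row i A = delta_mx 0 j) -> a A = 0.
  by move=> A; apply: (H m) => i; rewrite leqNgt ltn_ord.
elim=> [|k IH] A HA.
  pose s : {ffun 'I_m -> 'I_N} := [ffun i => sval (cid (HA i (leq0n _)))].
  rewrite -[A](_ : basis_frame R s = A) ?a0//.
  by apply/row_matrixP => i; rewrite rowK ffunE; case: cid => j /= ->.
have [km|km] := ltnP k m; last first.
  by apply: IH => i ki; have := leq_trans km ki; rewrite leqNgt ltn_ord.
rewrite (multilinear_row_expand (Ordinal km))//; apply: big1 => j _.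
rewrite IH ?mulr0// => i ki; have [->|ik] := eqVneq i (Ordinal km).
  by exists j; rewrite row_setrow.
rewrite row_setrow_neq//; apply: HA; rewrite ltn_neqAle ki andbT.
by apply: contraNneq ik => E; apply/eqP/val_inj.
Qed.

Lemma multilinear_sum I (r : seq I) (c : I -> R) (F : I -> 'M[R]_(m, N) -> R) :
  (forall i, multilinear (F i)) -> multilinear (fun A => \sum_(i <- r) c i * F i A).
Proof.
move=> mF i A B C b d r1 r2 r3; rewrite !mulr_sumr -big_split; apply: eq_bigr => j _ /=.
by rewrite (mF j i A B C b d)// mulrDr !mulrA ![c j * _]mulrC.
Qed.

Lemma multilinear_prod s : multilinear (fun A => \prod_i A i (s i)).
Proof.
move=> i A B C b c r1 r2 r3.
have D1 A' : \prod_j A' j (s j) = A' i (s i) * \prod_(j | j != i) A' j (s j) by rewrite (bigD1 i).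
rewrite !D1.
have EB : \prod_(j | j != i) B j (s j) = \prod_(j | j != i) A j (s j).
  apply: eq_bigr => j; rewrite eq_sym => /unlift_some[k -> _].
  by move/matrixP: r2 => /(_ k (s (lift i k))); rewrite !mxE.
have EC : \prod_(j | j != i) C j (s j) = \prod_(j | j != i) A j (s j).
  apply: eq_bigr => j; rewrite eq_sym => /unlift_some[k -> _].
  by move/matrixP: r3 => /(_ k (s (lift i k))); rewrite !mxE.
rewrite EB EC; move/rowP: r1 => /(_ (s i)); rewrite !mxE => ->.
by rewrite mulrDl !mulrA.
Qed.

Lemma multilinear_eq a b : multilinear a -> multilinear b ->
  (forall s, a (basis_frame R s) = b (basis_frame R s)) -> a = b.
Proof.
move=> ma mb ab; apply/funext => A; apply/eqP; rewrite -subr_eq0; apply/eqP.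
apply: (@multilinear_eq0 (fun A => a A - b A)) => [i A' B C c d r1 r2 r3|s]; last by rewrite ab subrr.
by rewrite (ma i A' B C c d)// (mb i A' B C c d)//; ring.
Qed.

Lemma basis_frameE s i j : basis_frame R s i j = (j == s i)%:R.
Proof. by rewrite !mxE. Qed.

Lemma multilinear_expand a A : multilinear a ->
  a A = \sum_(s : {ffun 'I_m -> 'I_N}) (\prod_i A i (s i)) * a (basis_frame R s).
Proof.
move=> ma; under eq_bigr do rewrite mulrC.
rewrite -[RHS]/((fun A => \sum_(s : {ffun 'I_m -> 'I_N}) a (basis_frame R s) * (fun A => \prod_i A i (s i)) A) A).
apply: (congr1 (fun h => h A)); apply: multilinear_eq => //.
  by apply: multilinear_sum => s; exact: multilinear_prod.
move=> t; rewrite (bigD1 t)//= [X in _ * X]big1 => [|i _]; last first.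
  by rewrite basis_frameE eqxx.
rewrite mulr1 big1 ?addr0// => s st.
have [i] : exists i, s i != t i.
  by apply/existsP; apply: contraR st => /existsPn H; apply/eqP/ffunP => i; apply/eqP; rewrite -[_ == _]negbK.
by move=> si; rewrite (bigD1 i)//= basis_frameE (negbTE si) mul0r mulr0.
Qed.

(** Polarization: the form vanishes when [u + v] stands in both rows, and the expansion leaves only
    the two mixed terms. *)
Lemma alternating_xrow a i j A : alternating a -> i != j -> a (xrow i j A) = - a A.
Proof.
move=> [ma aa] ij; apply/eqP; rewrite -addr_eq0; apply/eqP.
set u := row i A; set v := row j A.
pose M (p q : 'rV[R]_N) := setrow i p (setrow j q A).
have E1 : xrow i j A = M v u.
  apply/matrixP => k l; rewrite !mxE; case: (tpermP i j k) => [->|->|/eqP ki /eqP kj].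
  - by rewrite eqxx.
  - by rewrite eq_sym (negbTE ij) eqxx.
  - by rewrite (negbTE ki) (negbTE kj).
have E2 : A = M u v.
  by apply/matrixP => k l; rewrite !mxE; case: eqVneq => [->//|_]; case: eqVneq => [->|].
have H p : a (M p p) = 0.
  apply: (aa _ i j) => //; rewrite /M row_setrow row_setrow_neq ?row_setrow//.
  by rewrite eq_sym.
have H2 : a (M (1 *: u + 1 *: v) (1 *: u + 1 *: v)) = a (M u v) + a (M v u).
  rewrite /M multilinear_setrow// !(setrowC _ _ _ ij) !multilinear_setrow//.
  have := H u; have := H v; rewrite /M !(setrowC _ _ _ ij) => -> ->.
  by rewrite !mul1r add0r addr0 addrC.
rewrite [in X in _ + X]E2 E1 addrC -H2; exact: H.
Qed.

Lemma alternating_row_perm a (s : 'S_m) A : alternating a ->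
  a (row_perm s A) = (-1) ^+ s * a A.
Proof.
move=> aa; have [ts -> dts] := prod_tpermP s.
elim: ts dts A => [_ A|[i j] ts IH] /=; first by rewrite big_nil row_perm1 odd_perm1 mul1r.
move=> /andP[ij dts] A; rewrite big_cons row_permM odd_permM odd_tperm ij.
rewrite -/(xrow i j _) alternating_xrow// IH//.
by case: (odd_perm _); rewrite /= ?expr1 ?expr0 ?mulN1r ?mul1r ?opprK.
Qed.

Lemma basis_frame_perm s (p : 'S_m) :
  basis_frame R [ffun i => s (p i)] = row_perm p (basis_frame R s).
Proof. by apply/matrixP => i j; rewrite !mxE ffunE. Qed.

(* The covector dx_(s 0) ^ ... ^ dx_(s (m-1)). *)
Definition dxf s A : R := \det (colsub s A : 'M[R]_m).

Lemma alternating_dxf s : alternating (dxf s).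
Proof.
split=> [i A B C b c r1 r2 r3|A i j ij r1]; rewrite /dxf.
  apply: (@determinant_multilinear _ _ _ _ _ i).
  - by move/rowP: r1 => r1; apply/rowP => k; have := r1 (s k); rewrite !mxE.
  - by move/matrixP: r2 => r2; apply/matrixP => k l; have := r2 k (s l); rewrite !mxE.
  - by move/matrixP: r3 => r3; apply/matrixP => k l; have := r3 k (s l); rewrite !mxE.
apply: (determinant_alternate ij) => k.
by move/rowP: r1 => /(_ (s k)); rewrite !mxE.
Qed.

Lemma multilinear_alternating a : alternating a -> multilinear a. Proof. by case. Qed.

(* The factor m! appears because the sum runs over all s, not only increasing ones. *)
Lemma alternating_dxf_expand a A : alternating a ->
  a A = (m`!)%:R^-1 * \sum_(s : {ffun 'I_m -> 'I_N}) a (basis_frame R s) * dxf s A.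
Proof.
move=> aa; rewrite mulr_sumr.
rewrite -[RHS]/((fun A => \sum_s _ * _) A); apply: (congr1 (fun h => h A)).
apply: multilinear_eq; first exact: multilinear_alternating.
  move=> i A' B C b c r1 r2 r3; rewrite !mulr_sumr -big_split; apply: eq_bigr => s _ /=.
  by rewrite (multilinear_alternating (alternating_dxf s) r1 r2 r3); ring.
move=> t; rewrite -mulr_sumr.
transitivity ((m`!)%:R^-1 * \sum_(p : 'S_m) a (basis_frame R t)).
  by rewrite sumr_const card_Sn -[X in _ = _ * X]mulr_natl mulrA mulVf ?mul1r// pnatr_eq0 -lt0n fact_gt0.
congr (_ * _); under [RHS]eq_bigr do rewrite /dxf /determinant mulr_sumr.
rewrite exchange_big; apply: eq_bigr => p _ /=.
(* For each permutation [p] only [s = t \o p^-1] contributes, and the sign of the permuted frame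
   cancels the sign in the determinant. *)
rewrite (bigD1 [ffun i => t ((p^-1)%g i)])//= [X in _ + X]big1 ?addr0 => [|s st].
  rewrite basis_frame_perm alternating_row_perm// odd_permV.
  rewrite big1 => [|i _]; last by rewrite !mxE ffunE permK !eqxx.
  by rewrite mulr1 mulrAC -signr_addb addbb mul1r.
have [i] : exists i, s (p i) != t i.
  apply/existsP; apply: contraR st => /existsPn H; apply/eqP/ffunP => i; rewrite ffunE.
  by have := H ((p^-1)%g i); rewrite permKV negbK => /eqP.
by move=> si; rewrite (bigD1 i)//= !mxE (negbTE si) mul0r !mulr0.
Qed.

Lemma orthonormal_basis_frame s : injective s -> orthonormal (basis_frame R s).
Proof.
move=> si; apply/matrixP => i j; rewrite !mxE.
rewrite (bigD1 (s i))//= big1 ?addr0 => [|k ki]; last first.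
  by rewrite basis_frameE (negbTE ki) mul0r.
by rewrite basis_frameE eqxx mul1r mxE basis_frameE (inj_eq si).
Qed.

(** Injective [s] give orthonormal frames; a repeated index gives a repeated row, where the form is
    0. *)
Lemma alternating_basis_frame_le a (M : R) s : alternating a -> 0 <= M ->
  (forall v, orthonormal v -> `|a v| <= M) -> `|a (basis_frame R s)| <= M.
Proof.
move=> [_ aa] M0 H; have [si|] := boolP (injectiveb s).
  by apply: H; apply: orthonormal_basis_frame; exact/injectiveP.
move=> /injectivePn[i [j ij sij]]; rewrite (aa _ i j) ?normr0//.
by rewrite !rowK sij.
Qed.

Lemma orthonormal_le1 A i j : orthonormal A -> `|A i j| <= 1.
Proof.
move=> /matrixP /(_ i i); rewrite !mxE eqxx => E.
rewrite -(ler_pXn2r (n := 2))// ?nnegrE// expr1n real_normK ?num_real//.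
rewrite -(E : _ = 1) (bigD1 j)//= mxE -expr2 lerDl sumr_ge0// => k _.
by rewrite mxE -expr2 sqr_ge0.
Qed.

Lemma dxf_le s A (L : R) : 0 <= L -> (forall i j, `|A i j| <= L) ->
  `|dxf s A| <= (m`!)%:R * L ^+ m.
Proof.
move=> L0 HL; rewrite /dxf /determinant (le_trans (ler_norm_sum _ _ _))//.
rewrite -card_Sn -sumr_const mulr_suml; apply: ler_sum => p _; rewrite mul1r.
rewrite normrM normrX normrN1 expr1n mul1r normr_prod -[X in _ ^+ X]card_ord -prodr_const.
by apply: ler_prod => i _; rewrite normr_ge0 mxE HL.
Qed.
End multilinear.

Section test_forms.
Variables (R : realType) (m N : nat).
Implicit Types (w : dform R m N) (f : 'rV[R]_N -> R) (s : {ffun 'I_m -> 'I_N}).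

Lemma form_supp_sub_closed w (A : set 'rV[R]_N) : closed A ->
  (forall x v, w x v != 0 -> A x) -> form_supp w `<=` A.
Proof.
move=> cA H; rewrite [X in _ `<=` X](closure_id A).1//; apply: closure_subset => x [v]; exact: H.
Qed.

Lemma form_supp_out w x v : ~ form_supp w x -> w x v = 0.
Proof.
move=> H; apply: contrapT => /eqP wx; apply: H; apply: subset_closure; by exists v.
Qed.

Lemma closed_form_supp w : closed (form_supp w). Proof. exact: closed_closure. Qed.

Lemma test_form_testfun w v : test_form w -> testfun (w^~ v).
Proof.
move=> [_ sw cw]; split => //; apply: compact_closure_sub cw => x /= wx; by exists v.
Qed.

Lemma test_form_sub w (A : set 'rV[R]_N) : (forall x, alternating (w x)) -> (forall v, smooth (w^~ v)) ->
  compact A -> closed A -> (forall x v, w x v != 0 -> A x) -> test_form w.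
Proof.
move=> aw sw kA cA H; split => //.
apply: (subclosed_compact _ kA); first exact: closed_form_supp.
exact: form_supp_sub_closed.
Qed.

Lemma alternating_lin (a : R) (u v : 'M[R]_(m, N) -> R) :
  alternating u -> alternating v -> alternating (fun A => a * u A + v A).
Proof.
move=> [mu au] [mv av]; split=> [i A B C b c r1 r2 r3|A i j ij r1].
  by rewrite (mu i A B C b c)// (mv i A B C b c)//; ring.
by rewrite (au A i j)// (av A i j)// mulr0 addr0.
Qed.

Lemma alternatingZ (a : R) (u : 'M[R]_(m, N) -> R) :
  alternating u -> alternating (fun A => a * u A).
Proof.
move=> [mu au]; split=> [i A B C b c r1 r2 r3|A i j ij r1].
  by rewrite (mu i A B C b c)//; ring.
by rewrite (au A i j)// mulr0.
Qed.

Lemma test_form_lin (a : R) w e : test_form w -> test_form e ->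
  test_form (fun x v => a * w x v + e x v).
Proof.
move=> [aw sw cw] [ae se ce]; apply: (@test_form_sub _ (form_supp w `|` form_supp e)).
- by move=> x; apply: alternating_lin.
- by move=> v; exact: (smoothD (smoothM (smooth_cst a) (sw v)) (se v)).
- exact: compactU.
- by apply: closedU; exact: closed_form_supp.
- move=> x v /= H; apply: contrapT => /not_orP[/form_supp_out-/(_ v) E1 /form_supp_out-/(_ v) E2].
  by rewrite E1 E2 mulr0 addr0 eqxx in H.
Qed.

Lemma test_formM f w : smooth f -> test_form w -> test_form (fun x v => f x * w x v).
Proof.
move=> sf [aw sw cw]; apply: (@test_form_sub _ (form_supp w)).
- by move=> x; apply: (alternatingZ (f x) (aw x)).
- by move=> v; exact: (smoothM sf (sw v)).
- exact: cw.
- exact: closed_form_supp.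
- move=> x v; apply: contra_neqP => /form_supp_out ->; exact: mulr0.
Qed.

Lemma test_form_dxf f s : testfun f -> test_form (fun x v => f x * dxf s v).
Proof.
move=> [sf cf]; apply: (@test_form_sub _ (supp1 f)).
- by move=> x; apply: (alternatingZ (f x) (alternating_dxf R s)).
- by move=> v; exact: (smoothM sf (smooth_cst (dxf s v))).
- exact: cf.
- exact: closed_closure.
- move=> x v; apply: contra_neqP => /supp1_out ->; exact: mul0r.
Qed.

Lemma test_form0 : test_form (fun (x : 'rV[R]_N) (v : 'M[R]_(m, N)) => 0 : R).
Proof.
apply: (@test_form_sub _ set0).
- by move=> x; split=> // i A B C b c _ _ _; rewrite !mulr0 addr0.
- by move=> v; exact: smooth_cst.
- exact: compact0.
- exact: closed0.
- by move=> x v; rewrite eqxx.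
Qed.

End test_forms.

Section ext_deriv.
Variables (R : realType) (m N : nat).
Implicit Types (w : dform R m N).

Lemma derive_lin (f g : 'rV[R]_N -> R) (b c : R) (x v : 'rV[R]_N) : smooth f -> smooth g ->
  'D_v (fun y => b * f y + c * g y) x = b * 'D_v f x + c * 'D_v g x.
Proof.
move=> sf sg.
have [_ ->] : is_derive x v (fun y => b * f y + c * g y) (b * 'D_v f x + c * 'D_v g x).
  by apply: is_deriveD; apply: is_deriveZ; apply: DeriveDef => //; exact: smooth_derivable_dir.
by [].
Qed.

Lemma row'_setrow_lift (i : 'I_m.+1) (k : 'I_m) (v : 'M[R]_(m.+1, N)) : row k (row' i v) = row (lift i k) v.
Proof. by apply/rowP => j; rewrite !mxE. Qed.

(** In a given row, the term differentiating along it is linear because ['D_v] is linear in [v], the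
    other terms because the form is multilinear. If rows [i0] and [j0] agree, every other term still
    sees a repeated row, and these two cancel. *)
Lemma alternating_ext_deriv w x : (forall x, alternating (w x)) -> (forall v, smooth (w^~ v)) ->
  alternating (@ext_deriv R m.+1 N w x).
Proof.
move=> aw sw; split=> [i A B C b c r1 r2 r3|A i0 j0 ij r1]; rewrite /ext_deriv.
  rewrite !mulr_sumr -big_split; apply: eq_bigr => j _ /=.
  rewrite !mulrA ![_ * (-1) ^+ _]mulrC -!mulrA -mulrDr; congr (_ * _).
  have [->|ji] := eqVneq j i.
    by rewrite r1 smooth_derive_lin// r2 r3.
  have [k ik _] := unlift_some ji.
  have rB : row j B = row j A.
    move: ji; rewrite eq_sym => /unlift_some[l -> _].
    by rewrite -!row'_setrow_lift r2.
  have rC : row j C = row j A.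
    move: ji; rewrite eq_sym => /unlift_some[l -> _].
    by rewrite -!row'_setrow_lift r3.
  rewrite rB rC -derive_lin//; congr ('D_ _ _ _); apply/funext => y.
  have [mw _] := aw y; apply: (mw k).
  - by rewrite !row'_setrow_lift -ik.
  - apply/matrixP => p q; rewrite !mxE.
    have : lift j (lift k p) != i by rewrite ik (inj_eq (@lift_inj _ j)) eq_sym neq_lift.
    rewrite eq_sym => /unlift_some[l -> _].
    by move/matrixP: r2 => /(_ l q); rewrite !mxE.
  - apply/matrixP => p q; rewrite !mxE.
    have : lift j (lift k p) != i by rewrite ik (inj_eq (@lift_inj _ j)) eq_sym neq_lift.
    rewrite eq_sym => /unlift_some[l -> _].
    by move/matrixP: r3 => /(_ l q); rewrite !mxE.
rewrite (bigD1 i0)//= (bigD1 j0) 1?eq_sym//= big1 ?addr0 => [|k /andP[ki kj]]; last first.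
  rewrite (_ : (fun y => _) = cst 0) ?derive_cst ?mulr0//.
  apply/funext => y; have [_ H] := aw y.
  have [i' ei _] := unlift_some ki; have [j' ej _] := unlift_some kj.
  apply: (H _ i' j'); first by rewrite -(inj_eq (@lift_inj _ k)) -ei -ej.
  by rewrite !row'_setrow_lift -ei -ej.
(* Deleting [i0] from the source and [j0] from the target of the transposition leaves a permutation
   [s] that carries [row' j0 A] to [row' i0 A]. Its parity, read off from [lift_perm], is the one
   that makes the two terms opposite. *)
pose tau := tperm i0 j0.
have inj_s : injective (fun k : 'I_m => odflt k (unlift j0 (tau (lift i0 k)))).
  have H k : lift j0 (odflt k (unlift j0 (tau (lift i0 k)))) = tau (lift i0 k).
    have : j0 != tau (lift i0 k).
      by rewrite -[j0 in X in X != _](tpermL i0 j0) (inj_eq perm_inj) neq_lift.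
    by move=> /unlift_some[l -> ->].
  by move=> k l /= E; apply: (@lift_inj _ i0); apply: (@perm_inj _ tau); rewrite -(H k) -(H l) E.
pose s := perm inj_s.
have Hs k : lift j0 (s k) = tau (lift i0 k).
  rewrite permE; have : j0 != tau (lift i0 k).
    by rewrite -[j0 in X in X != _](tpermL i0 j0) (inj_eq perm_inj) neq_lift.
  by move=> /unlift_some[l -> ->].
have Etau : lift_perm i0 j0 s = tau.
  apply/permP => k; case: (unliftP i0 k) => [l ->|->].
    by rewrite lift_perm_lift Hs.
  by rewrite lift_perm_id tpermL.
have odd_s : odd_perm s = ~~ (odd i0 (+) odd j0).
  have := congr1 (@odd_perm _) Etau; rewrite odd_lift_perm odd_tperm ij.
  by case: (odd i0); case: (odd j0); case: (odd_perm s).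
have Erow : row' i0 A = row_perm s (row' j0 A).
  apply/matrixP => p q; rewrite !mxE Hs.
  rewrite /tau; case: tpermP => [E|E|//].
  - by rewrite E; move/rowP: r1 => /(_ q); rewrite !mxE.
  - by rewrite E; move/rowP: r1 => /(_ q); rewrite !mxE.
have -> : (fun y => w y (row' i0 A)) = (fun y => (-1) ^+ s * w y (row' j0 A) + 0 * w y (row' j0 A)).
  by apply/funext => y; rewrite Erow alternating_row_perm// mul0r addr0.
rewrite derive_lin// mul0r addr0 r1 mulrA -mulrDl.
rewrite -(signr_odd _ i0) -(signr_odd _ j0) odd_s.
by case: (odd i0); case: (odd j0); rewrite /= ?expr0 ?expr1 ?mulr1 ?mulN1r ?mul1r ?opprK ?mulrN1 ?subrr ?addNr mul0r.
Qed.

Lemma ext_deriv_out w x v : ~ form_supp w x -> @ext_deriv R m.+1 N w x v = 0.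
Proof.
move=> wx; apply: big1 => j _; rewrite -[RHS](mulr0 ((-1) ^+ j)); congr (_ * _).
rewrite -(derive_cst 0 x (row j v)); apply: near_eq_derive.
have oA : open (~` form_supp w) by apply: closed_openC; exact: closed_form_supp.
by apply: filterS (open_nbhs_nbhs (conj oA wx)) => y /form_supp_out ->.
Qed.

Lemma test_form_ext_deriv w : test_form w -> test_form (@ext_deriv R m.+1 N w).
Proof.
move=> [aw sw cw]; apply: (@test_form_sub _ _ _ _ (form_supp w)).
- by move=> x; exact: alternating_ext_deriv.
- move=> v; apply: (@smooth_sum _ _ _ _ (fun (j : 'I_m.+1) x => (-1) ^+ j * 'D_(row j v) (w^~ (row' j v)) x)) => j.
  exact: (smoothM (smooth_cst _) (smooth_derive _ (sw _))).
- exact: cw.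
- exact: closed_form_supp.
- by move=> x v; apply: contra_neqP; exact: ext_deriv_out.
Qed.

Lemma ext_deriv_lin (b : R) w e : test_form w -> test_form e ->
  @ext_deriv R m.+1 N (fun x v => b * w x v + e x v) =
  fun x v => b * @ext_deriv R m.+1 N w x v + @ext_deriv R m.+1 N e x v.
Proof.
move=> [_ sw _] [_ se _]; apply/funext => x; apply/funext => v.
rewrite /ext_deriv mulr_sumr -big_split; apply: eq_bigr => j _ /=.
rewrite (_ : (fun y => _) = (fun y => b * w y (row' j v) + 1 * e y (row' j v))); last first.
  by apply/funext => y; rewrite mul1r.
by rewrite derive_lin// mul1r mulrDr mulrCA.
Qed.
End ext_deriv.

(** * Integrals and density of test functions *)

Section L1.
Context d (T : measurableType d) (R : realType) (mu : {measure set T -> \bar R}).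
Implicit Types (f g h : T -> R).

Definition L1 f := mu.-integrable [set: T] (EFin \o f).

Lemma L1_meas f : L1 f -> measurable_fun [set: T] f.
Proof. by move=> /integrableP[/measurable_EFinP]. Qed.

Lemma L1D f g : L1 f -> L1 g -> L1 (fun x => f x + g x).
Proof. by move=> Lf Lg; exact: (integrableD measurableT Lf Lg). Qed.

Lemma L1B f g : L1 f -> L1 g -> L1 (fun x => f x - g x).
Proof. by move=> Lf Lg; exact: (integrableB measurableT Lf Lg). Qed.

Lemma L1Z c f : L1 f -> L1 (fun x => c * f x).
Proof. by move=> Lf; exact: (integrableZl measurableT c Lf). Qed.

Lemma L1_0 : L1 (fun=> 0).
Proof. exact: integrable0. Qed.

Lemma L1_sum I (r : seq I) (F : I -> T -> R) : (forall i, L1 (F i)) ->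
  L1 (fun x => \sum_(i <- r) F i x).
Proof.
move=> LF; elim: r => [|i r IH].
  by under eq_fun do rewrite big_nil; exact: L1_0.
by under eq_fun do rewrite big_cons; exact: (L1D (LF i) IH).
Qed.

Lemma L1_le f g : measurable_fun [set: T] f -> (forall x, `|f x| <= `|g x|) -> L1 g -> L1 f.
Proof.
move=> mf fg Lg; apply: (le_integrable measurableT _ _ Lg); first exact/measurable_EFinP.
by move=> x _; rewrite /= lee_fin.
Qed.

Lemma L1_norm f : L1 f -> L1 (fun x => `|f x|).
Proof.
move=> Lf; apply: (L1_le _ _ Lf) => [|x]; last by rewrite normr_id.
by apply: measurableT_comp => //; exact: L1_meas.
Qed.

Lemma L1M g f (C : R) : measurable_fun [set: T] g -> (forall x, `|g x| <= C) -> L1 f ->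
  L1 (fun x => g x * f x).
Proof.
move=> mg gC Lf; apply: (L1_le _ _ (L1Z C Lf)) => [|x].
  by apply: measurable_funM => //; exact: L1_meas.
by rewrite !normrM ler_wpM2r// (le_trans (gC x))// ler_norm.
Qed.

Lemma L1_ext f g : f =1 g -> L1 f -> L1 g.
Proof. by move=> /funext ->. Qed.

Local Notation I f := (\int[mu]_x f x).

Lemma RintD f g : L1 f -> L1 g -> I (fun x => f x + g x) = I f + I g.
Proof. by move=> Lf Lg; rewrite RintegralD. Qed.

Lemma RintB f g : L1 f -> L1 g -> I (fun x => f x - g x) = I f - I g.
Proof. by move=> Lf Lg; rewrite RintegralB. Qed.

Lemma RintZ c f : L1 f -> I (fun x => c * f x) = c * I f.
Proof. by move=> Lf; rewrite RintegralZl. Qed.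

Lemma Rint0 : I (fun=> 0) = 0.
Proof. by rewrite /Rintegral integral0. Qed.

Lemma Rint_sum J (r : seq J) (F : J -> T -> R) : (forall i, L1 (F i)) ->
  I (fun x => \sum_(i <- r) F i x) = \sum_(i <- r) I (F i).
Proof.
move=> LF; elim: r => [|i r IH].
  by rewrite big_nil; under eq_Rintegral do rewrite big_nil; exact: Rint0.
rewrite big_cons -IH -RintD//; last exact: L1_sum.
by apply: eq_Rintegral => x _; rewrite big_cons.
Qed.

Lemma Rint_le f g : L1 f -> L1 g -> (forall x, f x <= g x) -> I f <= I g.
Proof. by move=> Lf Lg fg; apply: le_Rintegral. Qed.

Lemma Rint_abs f : L1 f -> `|I f| <= I (fun x => `|f x|).
Proof. by move=> Lf; exact: le_normr_Rintegral. Qed.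

Lemma EFin_Rint f : L1 f -> (I f)%:E = (\int[mu]_x (f x)%:E)%E.
Proof. by move=> Lf; rewrite fineK//; exact: integrable_fin_num. Qed.

Lemma Rint_dominated (f_ : nat -> T -> R) f g : (forall n, measurable_fun [set: T] (f_ n)) ->
  (forall x, f_ n x @[n --> \oo] --> f x) -> (forall n x, `|f_ n x| <= g x) -> L1 g ->
  L1 f /\ (I (f_ n) @[n --> \oo] --> I f).
Proof.
move=> mf ff fg Lg.
have mF : measurable_fun [set: T] f by apply: (measurable_fun_cvg mf).
have Lf : L1 f.
  apply: (L1_le _ _ Lg) => // x; rewrite [X in _ <= X]ger0_norm; last first.
    by apply: le_trans (fg 0%N x).
  apply: (closed_cvg (fun y : R => y <= g x) (@closed_le R (g x)) _ _ (cvg_norm (ff x))).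
  by apply: nearW => n; exact: fg.
split => //.
have Lfn n : L1 (f_ n).
  by apply: (L1_le _ _ Lg) => // x; rewrite (le_trans (fg n x))// ler_norm.
have := @dominated_cvg _ _ _ mu _ measurableT (fun n x => (f_ n x)%:E) (fun x => (f x)%:E) (fun x => (g x)%:E).
move=> /(_ _ _ _ Lg) H.
have {}H : (\int[mu]_x (f_ n x)%:E)%E @[n --> \oo] --> (\int[mu]_x (f x)%:E)%E.
  apply: H => [n|x _|//|n x _]; first exact/measurable_EFinP.
    by apply: cvg_EFin; [exact: nearW|exact: ff].
  by rewrite lee_fin.
apply: fine_cvg; rewrite EFin_Rint//.
Qed.
End L1.

Section quasi.
Variables (R : realType) (N : nat).
Implicit Types (A B : set (borel R N)) (E : (borel R N -> R) -> R).

Definition nice (h : borel R N -> R) :=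
  measurable_fun [set: borel R N] h /\ forall x, 0 <= h x <= 1.

(* What the density of test functions uses of E h = \int h |a| dm; keeping E abstract
   lets one test function approximate an indicator for several measures at once. *)
Record quasi E : Prop := Quasi {
  quasi_sub : forall h h1 h2, nice h -> nice h1 -> nice h2 ->
    (forall x, h x <= h1 x + h2 x) -> E h <= E h1 + E h2 ;
  quasi_cvg : forall h : nat -> borel R N -> R, (forall n, nice (h n)) ->
    (forall x, h n x @[n --> \oo] --> 0) -> E (h n) @[n --> \oo] --> 0 }.

Lemma quasiD E1 E2 : quasi E1 -> quasi E2 -> quasi (fun h => E1 h + E2 h).
Proof.
move=> [s1 c1] [s2 c2]; split=> [h h1 h2 n0 n1 n2 H|h nh ch].
  by rewrite addrACA lerD ?s1 ?s2.
by rewrite -[X in _ --> X](addr0 0); apply: cvgD; [exact: c1|exact: c2].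
Qed.

Lemma quasi_int d (T : measurableType d) (m : {measure set T -> \bar R}) (g : T -> borel R N) (a : T -> R) :
  measurable_fun [set: T] g -> L1 m a ->
  quasi (fun h => \int[m]_x (h (g x) * `|a x|)).
Proof.
move=> mg La.
have Lh h : nice h -> L1 m (fun x => h (g x) * `|a x|).
  move=> [mh h01]; apply: (@L1M _ _ _ _ (fun x => h (g x)) (fun x => `|a x|) 1).
  - exact: measurableT_comp.
  - by move=> x; have /andP[h0 h1] := h01 (g x); rewrite ger0_norm.
  - exact: L1_norm.
split=> [h h1 h2 n0 n1 n2 H|h nh ch].
  rewrite -RintD ?Lh//; apply: Rint_le => [||x]; [exact: Lh|exact: (L1D (Lh _ n1) (Lh _ n2))|].
  by rewrite -mulrDl ler_wpM2r.
rewrite -(@Rint0 _ _ _ m).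
have [|x|n x||_] := @Rint_dominated _ _ _ m (fun n x => h n (g x) * `|a x|) (fun=> 0) (fun x => `|a x|).
- by move=> n; exact: L1_meas (Lh _ (nh n)).
- by rewrite -(mul0r `|a x|); apply: cvgM; [exact: ch|exact: cvg_cst].
- have [_ /(_ (g x))/andP[h0 h1]] := nh n.
  by rewrite normrM normr_id ger0_norm// ler_piMl.
- exact: L1_norm.
- by [].
Qed.

Definition err (p : borel R N -> R) A := fun x => `|p x - \1_A x|.

Definition test01 (p : 'rV[R]_N -> R) := testfun p /\ forall x, 0 <= p x <= 1.

Lemma test01_nice p : test01 p -> nice p.
Proof.
by move=> [tp p01]; split=> //; apply: continuous_measurable_borel; exact: testfun_cont tp.
Qed.

Lemma nice_err p A : nice p -> measurable A -> nice (err p A).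
Proof.
move=> [mp p01] mA; split=> [|x].
  by apply: measurableT_comp => //; apply: measurable_funB => //; exact: measurable_indic.
rewrite /err normr_ge0/= ler_norml; have /andP[? ?] := p01 x.
by rewrite indicE; case: (x \in A) => /=; apply/andP; split; lra.
Qed.

Lemma measurable_obox (a b : 'rV[R]_N) : measurable (obox a b : set (borel R N)).
Proof.
rewrite (_ : obox a b = \bigcap_(i in [set: 'I_N]) ((fun x : 'rV[R]_N => x 0 i) @^-1` [set` `]a 0 i, b 0 i[])); last first.
  apply/seteqP; split => x /= H i; last by have := H i I; rewrite /= in_itv.
  by move=> _ /=; rewrite in_itv; exact: H.
apply: fin_bigcap_measurable => // i _.
apply: open_measurable_borel; apply: open_comp; last exact: interval_open.
by move=> x _; exact: coord_continuous.
Qed.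

Definition boxes : set (set (borel R N)) := [set A | exists a b, A = obox a b].

(** Every open set is a countable union of rational boxes. *)
Lemma borel_boxes : @measurable _ (borel R N) = <<s boxes >>.
Proof.
apply/seteqP; split.
  apply: smallest_sub; first exact: smallest_sigma_algebra.
  move=> U oU; rewrite (borel_generated_boxes oU) bigcup_mkcond.
  have [_ _ cU] := smallest_sigma_algebra [set: borel R N] boxes.
  pose F (n : nat) : set (borel R N) := if unpickle n is Some q then (if q \in [set q | ratbox q `<=` U] then ratbox q else set0) else set0.
  rewrite (_ : \bigcup_i _ = \bigcup_n F n); last first.
    apply/seteqP; split=> [x [q _ qx]|x [n _]].
      by exists (pickle q) => //; rewrite /F pickleK.
    by rewrite /F; case: unpickle => // q qx; exists q.
  apply: cU => n; rewrite /F.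
  have s0 : <<s boxes >> set0 by have [] := smallest_sigma_algebra [set: borel R N] boxes.
  case: unpickle => // q; case: ifP => // _; apply: sub_gen_smallest.
  exists (\row_i ratr (q.1 0 i)), (\row_i ratr (q.2 0 i)).
  by rewrite /ratbox /obox; apply/seteqP; split => x H i; have := H i; rewrite !mxE.
apply: smallest_sub; first exact: sigma_algebra_measurable.
by move=> _ [a [b ->]]; exact: measurable_obox.
Qed.

Lemma setI_closed_boxes : setI_closed boxes.
Proof.
move=> _ _ [a [b ->]] [c [e ->]].
exists (\row_i Num.max (a 0 i) (c 0 i)), (\row_i Num.min (b 0 i) (e 0 i)).
apply/seteqP; split => x.
  move=> [H1 H2] i; rewrite !mxE gt_max lt_min.
  by move: (H1 i) (H2 i) => /andP[-> ->] /andP[-> ->].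
move=> H; split=> i; have := H i; rewrite !mxE gt_max lt_min => /andP[/andP[h1 h2] /andP[h3 h4]].
  by rewrite h1 h3.
by rewrite h2 h4.
Qed.

(** Dynkin induction over the open boxes, which are stable under intersection and generate the Borel
    sets. Boxes are approximated by [boxfun]; complements and countable disjoint unions are the two
    closure steps. *)
Lemma quasi_dense E : quasi E -> forall A, measurable A -> forall e : R, 0 < e ->
  exists2 p, test01 p & E (err p A) < e.
Proof.
move=> [Es Ec] A; rewrite borel_boxes => mA.
pose P A := forall e : R, 0 < e -> exists2 p, test01 p & E (err p A) < e.
have chi_tf (n : nat) : test01 (plateau (0 : 'rV[R]_N) n.+1%:R).
  split; first by apply: testfun_plateau.
  by move=> x; rewrite plateau_ge0 plateau_le1.
have chi_nice (n : nat) : nice (fun x => 1 - plateau (0 : 'rV[R]_N) n.+1%:R x).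
  split=> [|x]; first by apply: measurable_funB => //; exact: (test01_nice (chi_tf n)).1.
  by have /andP[? ?] := (chi_tf n).2 x; apply/andP; split; lra.
have chi_cvg : E (fun x => 1 - plateau (0 : 'rV[R]_N) n.+1%:R x) @[n --> \oo] --> 0.
  apply: Ec => // x; apply: cvg_near_cst; near=> n.
  rewrite plateau1 ?subrr// subr0 ltW//.
  rewrite (@le_lt_trans _ _ n%:R) ?ltr_nat//; near: n; exact: nbhs_infty_ger.
have chi_small (e : R) : 0 < e -> exists n : nat, E (fun x => 1 - plateau (0 : 'rV[R]_N) n.+1%:R x) < e.
  move=> e0; have /cvgrPdist_lt/(_ e e0)[n _ /(_ n (leqnn _))] := chi_cvg.
  by rewrite sub0r normrN => /(le_lt_trans (ler_norm _)) H; exists n.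
have PT : P setT.
  move=> e e0; have [n Hn] := chi_small e e0.
  exists (plateau (0 : 'rV[R]_N) n.+1%:R); first exact: chi_tf.
  rewrite (_ : err _ _ = (fun x => 1 - plateau (0 : 'rV[R]_N) n.+1%:R x))//.
  by apply/funext => x; rewrite /err indicT distrC ger0_norm// subr_ge0 plateau_le1.
have E0 : E (fun=> 0) = 0.
  have nice0 : nice (fun=> 0) by split=> // x; rewrite lexx ler01.
  have H : E (fun=> 0) @[n --> \oo] --> 0 by apply: (Ec (fun _ _ => 0)) => // x; exact: cvg_cst.
  exact: (cvg_unique (@Rhausdorff R) (cvg_cst (E (fun=> 0))) H).
have Emono h h1 : nice h -> nice h1 -> (forall x, h x <= h1 x) -> E h <= E h1.
  move=> n0 n1 H; have nice0 : nice (fun=> 0) by split=> // x; rewrite lexx ler01.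
  have := Es h h1 (fun=> 0) n0 n1 nice0; rewrite E0 addr0; apply => x; by rewrite addr0.
apply: (@dynkin_induction _ (borel R N) boxes P) => //.
- exact: borel_boxes.
- exact: setI_closed_boxes.
- move=> _ [a [b ->]] e e0.
  have tb n : test01 (boxfun n a b).
    by split=> [|x]; [exact: testfun_boxfun|rewrite boxfun_ge0 boxfun_le1].
  have : E (err (boxfun n a b) (obox a b)) @[n --> \oo] --> 0.
    apply: Ec => [n|x]; first by apply: nice_err; [exact: test01_nice|exact: measurable_obox].
    rewrite -(normr0 R) -(subrr (\1_(obox a b) x : R)); apply: cvg_norm.
    by apply: cvgB; [exact: boxfun_cvg|exact: cvg_cst].
  move=> /cvgrPdist_lt/(_ e e0)[n _ /(_ n (leqnn _))].
  by rewrite sub0r normrN => /(le_lt_trans (ler_norm _)) H; exists (boxfun n a b).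
- move=> S mS PS e e0; have e2 : 0 < e / 2 by rewrite divr_gt0.
  have [p tp Hp] := PS _ e2; have [n Hn] := chi_small _ e2.
  (* [1 - p] has no compact support; a large plateau restores it, at the price of the second error
     term. *)
  have nq : test01 (fun x => (1 - p x) * plateau (0 : 'rV[R]_N) n.+1%:R x).
    split=> [|x].
      apply: testfunMl; last exact: (chi_tf n).1.
      rewrite (_ : (fun x => _) = (fun x => 1 + -1 * p x)); last by apply/funext => x; rewrite mulN1r.
      apply: (smoothD (smooth_cst 1) (smoothM (smooth_cst (-1)) _)); exact: tp.1.1.
    have /andP[p0 p1] := tp.2 x; have /andP[c0 c1] := (chi_tf n).2 x.
    by rewrite mulr_ge0 ?subr_ge0//= mulr_ile1 ?subr_ge0// gerBl.
  exists (fun x => (1 - p x) * plateau (0 : 'rV[R]_N) n.+1%:R x) => //.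
  apply: le_lt_trans (_ : E (err p S) + E (fun x => 1 - plateau (0 : 'rV[R]_N) n.+1%:R x) < e); last first.
    by rewrite (splitr e) ltrD.
  apply: Es => //.
  - by apply: nice_err; [exact: test01_nice|exact: measurableC].
  - by apply: nice_err => //; exact: test01_nice.
  move=> x; rewrite /err.
  have /andP[p0 p1] := tp.2 x; have /andP[c0 c1] := (chi_tf n).2 x.
  set c := plateau _ _ x in c0 c1 *; set q := p x in p0 p1 *.
  rewrite !indicE in_setC; case: (x \in S) => /=.
    rewrite subr0 ger0_norm ?mulr_ge0 ?subr_ge0//.
    rewrite distrC ger0_norm ?subr_ge0//.
    nra.
  rewrite subr0 distrC (ger0_norm p0) ger0_norm ?subr_ge0; first nra.
  by rewrite mulr_ile1 ?subr_ge0// gerBl.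
- move=> F mF tF PF e e0; have e2 : 0 < e / 2 by rewrite divr_gt0.
  pose U n := \bigcup_(i < n) F i.
  have mU n : measurable (U n) by apply: bigcup_measurable => i _; exact: mF.
  have PU n : P (U n).
    elim: n => [|n IH].
      rewrite /U bigcup0 => [|i //]; move=> e' e'0; exists (fun=> 0).
        by split=> [|x]; [exact: testfun0|rewrite lexx ler01].
      rewrite (_ : err _ _ = (fun=> 0)) ?E0//; apply/funext => x.
      by rewrite /err indic0 subr0 normr0.
    rewrite /U bigcup_mkord big_ord_recr /= -bigcup_mkord -/(U n).
    move=> e' e'0; have e'2 : 0 < e' / 2 by rewrite divr_gt0.
    have [p tp Hp] := IH _ e'2; have [q tq Hq] := PF n _ e'2.
    (* This is [1 - (1 - p) * (1 - q)]: it stays in [0, 1] and its error is at most the sum of the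
       errors of [p] and [q]. *)
    have nr : test01 (fun x => p x + (1 - p x) * q x).
      split=> [|x].
        apply: testfunD; first exact: tp.1.
        apply: testfunMl; last exact: tq.1.
        rewrite (_ : (fun x => _) = (fun x => 1 + -1 * p x)); last by apply/funext => x; rewrite mulN1r.
        apply: (smoothD (smooth_cst 1) (smoothM (smooth_cst (-1)) _)); exact: tp.1.1.
      have /andP[p0 p1] := tp.2 x; have /andP[c0 c1] := tq.2 x.
      by apply/andP; split; nra.
    exists (fun x => p x + (1 - p x) * q x) => //.
    apply: le_lt_trans (_ : E (err p (U n)) + E (err q (F n)) < e'); last first.
      by rewrite (splitr e') ltrD.
    apply: Es => //.
    - by apply: nice_err; [exact: test01_nice|exact: measurableU].
    - by apply: nice_err => //; exact: test01_nice.
    - by apply: nice_err => //; exact: test01_nice.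
    move=> x; rewrite /err !indicE in_setU.
    have /andP[p0 p1] := tp.2 x; have /andP[c0 c1] := tq.2 x.
    case: (x \in U n); case: (x \in F n) => /=; rewrite ?subr0 ?[`|p x|]ger0_norm ?[`|q x|]ger0_norm//.
    + rewrite -(normrN (p x - 1)) -(normrN (q x - 1)) -(normrN (_ + _ - 1)) !ger0_norm; nra.
    + rewrite -(normrN (p x - 1)) -(normrN (_ + _ - 1)) !ger0_norm; nra.
    + rewrite -(normrN (q x - 1)) -(normrN (_ + _ - 1)) !ger0_norm; nra.
    + by rewrite ger0_norm; nra.
  have : E (fun x => \1_(\bigcup_k F k) x - \1_(U n) x) @[n --> \oo] --> 0.
    have sub n : U n `<=` \bigcup_k F k by move=> x [i _ Fx]; exists i.
    apply: Ec => [n|x].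
      split=> [|x]; first by apply: measurable_funB; apply: measurable_indic => //; exact: bigcup_measurable.
      rewrite !indicE; have [xU|xU] := boolP (x \in U n).
        by rewrite (mem_set (sub n x (set_mem xU))) subrr lexx ler01.
      by case: (x \in \bigcup_k _); rewrite /= subr0 ?lexx ?ler01.
    apply: cvg_near_cst; have [[i _ Fi]|nF] := pselect ((\bigcup_k F k) x).
      exists i.+1 => // n /= ni; rewrite !indicE !mem_set ?subrr//; last by exists i.
      by exists i.
    near=> n; rewrite !indicE !memNset ?subrr// => -[i _ Fi]; apply: nF; by exists i.
  move=> /cvgrPdist_lt/(_ (e / 2) e2)[n _ /(_ n (leqnn _))].
  rewrite sub0r normrN => /(le_lt_trans (ler_norm _)) H.
  have [p tp Hp] := PU n _ e2; exists p => //.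
  apply: le_lt_trans (_ : E (err p (U n)) + E (fun x => \1_(\bigcup_k F k) x - \1_(U n) x) < e); last first.
    by rewrite (splitr e) ltrD.
  have sub : U n `<=` \bigcup_k F k by move=> x [i _ Fx]; exists i.
  apply: Es.
  - by apply: nice_err; [exact: test01_nice|exact: bigcup_measurable].
  - by apply: nice_err => //; exact: test01_nice.
  - split=> [|x]; first by apply: measurable_funB; apply: measurable_indic => //; exact: bigcup_measurable.
    rewrite !indicE; have [xU|xU] := boolP (x \in U n).
      by rewrite (mem_set (sub x (set_mem xU))) subrr lexx ler01.
    by case: (x \in \bigcup_k _); rewrite /= subr0 ?lexx ?ler01.
  - move=> x; rewrite /err; set u := \1_(U n) x; set v := \1_(\bigcup_k F k) x.
    have uv : 0 <= v - u.
      rewrite /u /v !indicE subr_ge0; have [xU|xU] := boolP (x \in U n).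
        by rewrite (mem_set (sub x (set_mem xU))).
      exact: ler0n.
    rewrite -[X in _ <= _ + X](ger0_norm uv) [X in _ <= _ + X]distrC.
    apply: le_trans (ler_normD _ _); by rewrite addrA subrK.
Unshelve. all: by end_near.
Qed.
End quasi.

(* Layer-cake approximation: passes from indicators to bounded functions. *)
Lemma count_le_approx (R : realType) (L : nat) (y : R) : 0 <= y <= L%:R ->
  `|y - \sum_(k < L) (k.+1%:R <= y)%R%:R| <= 1.
Proof.
elim: L => [|L IH] /andP[y0 yL].
  have -> : y = 0 by apply/eqP; rewrite eq_le yL y0.
  by rewrite big_ord0 subr0 normr0 ler01.
rewrite big_ord_recr /=; have [yL'|Ly] := leP y L%:R.
  rewrite (_ : (L.+1%:R <= y) = false) ?addr0; first by apply: IH; rewrite y0.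
  by apply/negbTE; rewrite -ltNge (le_lt_trans yL')// ltr_nat.
rewrite (eq_bigr (fun=> 1)) => [|k _]; last first.
  by rewrite (le_trans _ (ltW Ly))// ler_nat.
rewrite sumr_const card_ord ler_norml; move: yL; rewrite -natr1 => yL.
by case: (_ <= y) / boolP => h; rewrite /=; move: h; rewrite -?ltNge => h; apply/andP; split; lra.
Qed.

Section agree.
Context (R : realType) d1 (T1 : measurableType d1) (m1 : {measure set T1 -> \bar R})
  d2 (T2 : measurableType d2) (m2 : {measure set T2 -> \bar R}).

(** A function with values in [0, K] is within [1/n] of the average of the indicators of its
    superlevel sets [k+1 <= n * p], on which the integrals agree. A general bounded function is
    shifted by [|C|]; the shift contributes equally on both sides, as the whole space is a
    measurable set. *)
Lemma agree_bounded d (Y : measurableType d) (g1 : T1 -> Y) (g2 : T2 -> Y) (a1 : T1 -> R) (a2 : T2 -> R) :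
  measurable_fun [set: T1] g1 -> measurable_fun [set: T2] g2 -> L1 m1 a1 -> L1 m2 a2 ->
  (forall A, measurable A -> \int[m1]_x (\1_A (g1 x) * a1 x) = \int[m2]_x (\1_A (g2 x) * a2 x)) ->
  forall (p : Y -> R) (C : R), measurable_fun [set: Y] p -> (forall y, `|p y| <= C) ->
  \int[m1]_x (p (g1 x) * a1 x) = \int[m2]_x (p (g2 x) * a2 x).
Proof.
move=> mg1 mg2 L1a L2a H.
have Lm1 (q : Y -> R) (C : R) : measurable_fun [set: Y] q -> (forall y, `|q y| <= C) -> L1 m1 (fun x => q (g1 x) * a1 x).
  by move=> mq qC; apply: (@L1M _ _ _ _ (fun x => q (g1 x)) a1 C) => //; exact: measurableT_comp.
have Lm2 (q : Y -> R) (C : R) : measurable_fun [set: Y] q -> (forall y, `|q y| <= C) -> L1 m2 (fun x => q (g2 x) * a2 x).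
  by move=> mq qC; apply: (@L1M _ _ _ _ (fun x => q (g2 x)) a2 C) => //; exact: measurableT_comp.
have ind1 A (y : Y) : `|\1_A y : R| <= 1.
  by rewrite indicE; case: (_ \in _); rewrite /= ?normr1 ?normr0.
have H0 (K : nat) (p : Y -> R) : measurable_fun [set: Y] p -> (forall y, 0 <= p y <= K%:R) ->
    \int[m1]_x (p (g1 x) * a1 x) = \int[m2]_x (p (g2 x) * a2 x).
  move=> mp pK.
  have pC y : `|p y| <= K%:R by have /andP[? ?] := pK y; rewrite ger0_norm.
  apply/eqP; rewrite -subr_eq0 -normr_le0; apply/ler_addgt0Pl => e e0; rewrite addr0.
  set I1 := \int[m1]_x `|a1 x|; set I2 := \int[m2]_x `|a2 x|.
  have I10 : 0 <= I1 by apply: Rintegral_ge0.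
  have I20 : 0 <= I2 by apply: Rintegral_ge0.
  (* Chosen so that the uniform error [1/n] costs at most [e] in the two integrals together. *)
  pose n := (Num.truncn ((I1 + I2) / e)).+1.
  have ne : n%:R^-1 * (I1 + I2) <= e.
    by rewrite ler_pdivrMl// -ler_pdivrMr// ltW// truncnS_gt.
  pose A (k : nat) := [set y | k.+1%:R <= n%:R * p y].
  have mA k : measurable (A k).
    rewrite -[A k]setTI.
    rewrite (_ : A k = (fun y => n%:R * p y) @^-1` `[k.+1%:R, +oo[); last first.
      by apply/seteqP; split => y /=; rewrite in_itv/= andbT.
    have mn : measurable_fun [set: Y] (fun y => n%:R * p y) by apply: measurable_funM.
    by apply: mn => //; exact: measurable_itv.
  pose q y := \sum_(k < K * n) n%:R^-1 * (\1_(A k) y : R).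
  have pq y : `|p y - q y| <= n%:R^-1.
    rewrite -(ler_pM2l (_ : 0 < n%:R)) ?ltr0n// divff ?pnatr_eq0// -[X in X * _](@ger0_norm _ n%:R)// -normrM.
    rewrite mulrBr mulr_sumr (eq_bigr (fun k : 'I_(K * n) => (k.+1%:R <= n%:R * p y)%R%:R)) => [|k _]; last first.
      rewrite mulrA divff ?pnatr_eq0// mul1r indicE; congr (_%:R); congr nat_of_bool.
      by apply/idP/idP => [/set_mem//|h]; exact: mem_set.
    apply: count_le_approx; have /andP[p0 pK'] := pK y.
    by rewrite mulr_ge0//= natrM mulrC ler_wpM2r.
  have mq : measurable_fun [set: Y] q.
    by apply: measurable_sum => k; apply: measurable_funM => //; exact: measurable_indic.
  have q_bd y : `|q y| <= n%:R^-1 + K%:R.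
    by rewrite -(subrK (p y) (q y)) (le_trans (ler_normD _ _))// lerD// distrC.
  have Eq : \int[m1]_x (q (g1 x) * a1 x) = \int[m2]_x (q (g2 x) * a2 x).
    transitivity (\sum_(k < K * n) n%:R^-1 * \int[m1]_x (\1_(A k) (g1 x) * a1 x)).
      under eq_Rintegral do rewrite mulr_suml.
      rewrite Rint_sum => [|k].
        apply: eq_bigr => k _; under eq_Rintegral do rewrite -mulrA.
        by rewrite RintZ//; apply: Lm1 => //; exact: measurable_indic.
      under eq_fun do rewrite -mulrA.
      by apply: L1Z; apply: Lm1 => //; exact: measurable_indic.
    transitivity (\sum_(k < K * n) n%:R^-1 * \int[m2]_x (\1_(A k) (g2 x) * a2 x)).
      by apply: eq_bigr => k _; rewrite H.
    under [RHS]eq_Rintegral do rewrite mulr_suml.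
    rewrite Rint_sum => [|k].
      apply: eq_bigr => k _; under [RHS]eq_Rintegral do rewrite -mulrA.
      by rewrite RintZ//; apply: Lm2 => //; exact: measurable_indic.
    under eq_fun do rewrite -mulrA.
    by apply: L1Z; apply: Lm2 => //; exact: measurable_indic.
  have D1 : `|\int[m1]_x (p (g1 x) * a1 x) - \int[m1]_x (q (g1 x) * a1 x)| <= n%:R^-1 * I1.
    rewrite -RintB; [|exact: Lm1 pC|exact: Lm1 q_bd].
    under eq_Rintegral do rewrite -mulrBl.
    have LL : L1 m1 (fun x => (p (g1 x) - q (g1 x)) * a1 x).
      by apply: (Lm1 (fun y => p y - q y) n%:R^-1) => //; exact: measurable_funB.
    rewrite (le_trans (Rint_abs LL))// -RintZ; last exact: L1_norm.
    apply: Rint_le => [||x]; [exact: L1_norm|by apply: L1Z; exact: L1_norm|].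
    by rewrite normrM ler_wpM2r.
  have D2 : `|\int[m2]_x (p (g2 x) * a2 x) - \int[m2]_x (q (g2 x) * a2 x)| <= n%:R^-1 * I2.
    rewrite -RintB; [|exact: Lm2 pC|exact: Lm2 q_bd].
    under eq_Rintegral do rewrite -mulrBl.
    have LL : L1 m2 (fun x => (p (g2 x) - q (g2 x)) * a2 x).
      by apply: (Lm2 (fun y => p y - q y) n%:R^-1) => //; exact: measurable_funB.
    rewrite (le_trans (Rint_abs LL))// -RintZ; last exact: L1_norm.
    apply: Rint_le => [||x]; [exact: L1_norm|by apply: L1Z; exact: L1_norm|].
    by rewrite normrM ler_wpM2r.
  apply: le_trans ne; rewrite mulrDr.
  apply: le_trans (lerD D1 D2); rewrite Eq [X in _ <= _ + X]distrC.
  by apply: le_trans (ler_normD _ _); rewrite addrA subrK.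
move=> p C mp pC.
pose K := (Num.truncn (`|C| + `|C|)).+1.
have mS : measurable_fun [set: Y] (fun y => p y + `|C|) by exact: measurable_funD.
have S01 y : 0 <= p y + `|C| <= K%:R.
  have : `|p y| <= `|C| by rewrite (le_trans (pC y))// ler_norm.
  rewrite ler_norml => /andP[h1 h2]; apply/andP; split; first lra.
  by rewrite (le_trans _ (ltW (truncnS_gt _)))// lerD2r.
have := H0 K _ mS S01.
have E1 : \int[m1]_x ((p (g1 x) + `|C|) * a1 x) = \int[m1]_x (p (g1 x) * a1 x) + `|C| * \int[m1]_x a1 x.
  under eq_Rintegral do rewrite mulrDl.
  by rewrite RintD ?RintZ//; [exact: Lm1 pC|exact: L1Z].
have E2 : \int[m2]_x ((p (g2 x) + `|C|) * a2 x) = \int[m2]_x (p (g2 x) * a2 x) + `|C| * \int[m2]_x a2 x.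
  under eq_Rintegral do rewrite mulrDl.
  by rewrite RintD ?RintZ//; [exact: Lm2 pC|exact: L1Z].
have E3 : \int[m1]_x a1 x = \int[m2]_x a2 x.
  have := H _ measurableT; under eq_Rintegral do rewrite indicT mul1r.
  by under [RHS]eq_Rintegral do rewrite indicT mul1r.
by rewrite E1 E2 E3 => /addIr.
Qed.

(** Since [quasi] is stable under sums, a single test function approximates the indicator for both
    densities at once. *)
Lemma agree_test N (g1 : T1 -> borel R N) (g2 : T2 -> borel R N) (a1 : T1 -> R) (a2 : T2 -> R) :
  measurable_fun [set: T1] g1 -> measurable_fun [set: T2] g2 -> L1 m1 a1 -> L1 m2 a2 ->
  (forall p, test01 p -> \int[m1]_x (p (g1 x) * a1 x) = \int[m2]_x (p (g2 x) * a2 x)) ->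
  forall (p : borel R N -> R) (C : R), measurable_fun [set: borel R N] p -> (forall y, `|p y| <= C) ->
  \int[m1]_x (p (g1 x) * a1 x) = \int[m2]_x (p (g2 x) * a2 x).
Proof.
move=> mg1 mg2 L1a L2a H; apply: agree_bounded => // A mA.
pose E1 h := \int[m1]_x (h (g1 x) * `|a1 x|).
pose E2 h := \int[m2]_x (h (g2 x) * `|a2 x|).
have qE : quasi (fun h => E1 h + E2 h) by apply: quasiD; exact: quasi_int.
apply/eqP; rewrite -subr_eq0 -normr_le0; apply/ler_addgt0Pl => e e0; rewrite addr0.
have [p tp Ep] := quasi_dense qE mA e0.
have ind1 (y : borel R N) : `|\1_A y : R| <= 1.
  by rewrite indicE; case: (_ \in _); rewrite /= ?normr1 ?normr0.
have p1 y : `|p y| <= 1 by have /andP[? ?] := tp.2 y; rewrite ger0_norm.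
have mp := (test01_nice tp).1.
have mI : measurable_fun [set: borel R N] (\1_A : borel R N -> R) by exact: measurable_indic.
have me := (nice_err (test01_nice tp) mA).
have e1 y : `|err p A y| <= 1 by have /andP[? ?] := me.2 y; rewrite ger0_norm.
have D1 : `|\int[m1]_x (\1_A (g1 x) * a1 x) - \int[m1]_x (p (g1 x) * a1 x)| <= E1 (err p A).
  have L3 : L1 m1 (fun x => \1_A (g1 x) * a1 x).
    by apply: (@L1M _ _ _ _ (fun x => \1_A (g1 x)) a1 1) => //; exact: measurableT_comp.
  have L4 : L1 m1 (fun x => p (g1 x) * a1 x).
    by apply: (@L1M _ _ _ _ (fun x => p (g1 x)) a1 1) => //; exact: measurableT_comp.
  rewrite -RintB// (le_trans (Rint_abs (L1B L3 L4)))//; apply: Rint_le; first exact: L1_norm (L1B L3 L4).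
    apply: (@L1M _ _ _ _ (fun x => err p A (g1 x)) _ 1) => //; last exact: L1_norm.
    by apply: measurableT_comp mg1; exact: me.1.
  by move=> x; rewrite -mulrBl normrM distrC.
have D2 : `|\int[m2]_x (\1_A (g2 x) * a2 x) - \int[m2]_x (p (g2 x) * a2 x)| <= E2 (err p A).
  have L3 : L1 m2 (fun x => \1_A (g2 x) * a2 x).
    by apply: (@L1M _ _ _ _ (fun x => \1_A (g2 x)) a2 1) => //; exact: measurableT_comp.
  have L4 : L1 m2 (fun x => p (g2 x) * a2 x).
    by apply: (@L1M _ _ _ _ (fun x => p (g2 x)) a2 1) => //; exact: measurableT_comp.
  rewrite -RintB// (le_trans (Rint_abs (L1B L3 L4)))//; apply: Rint_le; first exact: L1_norm (L1B L3 L4).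
    apply: (@L1M _ _ _ _ (fun x => err p A (g2 x)) _ 1) => //; last exact: L1_norm.
    by apply: measurableT_comp mg2; exact: me.1.
  by move=> x; rewrite -mulrBl normrM distrC.
apply: le_trans (ltW Ep); apply: le_trans (lerD D1 D2); rewrite (H p tp) [X in _ <= _ + X]distrC.
by apply: le_trans (ler_normD _ _); rewrite addrA subrK.
Qed.
End agree.

Section bounded_pairing.
Variables (R : realType) (N : nat) (mu : {measure set (borel R N) -> \bar R}).
Implicit Types (a : borel R N -> R) (C : R).

Lemma bounded_pairing_sets a C : L1 mu a ->
  (forall p, test01 p -> `|\int[mu]_x (p x * a x)| <= C) ->
  forall A, measurable A -> `|\int[mu]_x (\1_A x * a x)| <= C.
Proof.
move=> La H A mA; apply/ler_addgt0Pl => e e0.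
have qE := @quasi_int R N _ _ mu id a (@measurable_id _ _ _) La.
have [p tp Ep] := quasi_dense qE mA e0.
have ind1 (y : borel R N) : `|\1_A y : R| <= 1.
  by rewrite indicE; case: (_ \in _); rewrite /= ?normr1 ?normr0.
have p1 y : `|p y| <= 1 by have /andP[? ?] := tp.2 y; rewrite ger0_norm.
have mp := (test01_nice tp).1.
have mI : measurable_fun [set: borel R N] (\1_A : borel R N -> R) by exact: measurable_indic.
have me := (nice_err (test01_nice tp) mA).
have e1 y : `|err p A y| <= 1 by have /andP[? ?] := me.2 y; rewrite ger0_norm.
have L3 : L1 mu (fun x => \1_A x * a x) by apply: (L1M mI ind1).
have L4 : L1 mu (fun x => p x * a x) by apply: (L1M mp p1).
have D1 : `|\int[mu]_x (\1_A x * a x) - \int[mu]_x (p x * a x)| <= e.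
  apply: le_trans (ltW Ep).
  rewrite -RintB// (le_trans (Rint_abs (L1B L3 L4)))//; apply: Rint_le; first exact: L1_norm (L1B L3 L4).
    by apply: (L1M me.1 e1); exact: L1_norm.
  by move=> x; rewrite -mulrBl normrM distrC.
rewrite -(subrK (\int[mu]_x (p x * a x)) (\int[mu]_x (\1_A x * a x))).
by apply: le_trans (ler_normD _ _) _; apply: lerD => //; exact: H.
Qed.

(** The bound is used on the set where [a] is nonnegative and on its complement, whence the factor
    2. *)
Lemma bounded_sets_norm a C : L1 mu a ->
  (forall A, measurable A -> `|\int[mu]_x (\1_A x * a x)| <= C) ->
  \int[mu]_x `|a x| <= C + C.
Proof.
move=> La H.
pose P := [set x | 0 <= a x].
have mP : measurable P.
  rewrite (_ : P = [set: borel R N] `&` a @^-1` `[0, +oo[); last first.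
    by rewrite setTI; apply/seteqP; split => y /=; rewrite in_itv/= andbT.
  by apply: (L1_meas La) => //; exact: measurable_itv.
have L3 A : measurable A -> L1 mu (fun x => \1_A x * a x).
  move=> mA; apply: (@L1M _ _ _ _ _ _ 1) => // x.
  by rewrite indicE; case: (_ \in _); rewrite /= ?normr1 ?normr0.
have -> : \int[mu]_x `|a x| = \int[mu]_x (\1_P x * a x) - \int[mu]_x (\1_(~` P) x * a x).
  rewrite -RintB; [|exact: L3|by apply: L3; exact: measurableC].
  apply: eq_Rintegral => x _; rewrite !indicE in_setC; have [/set_mem xP|xP] := boolP (x \in P).
    by rewrite /= mul1r mul0r subr0 ger0_norm.
  rewrite /= mul1r mul0r sub0r ler0_norm// ltW// ltNge.
  by apply: contraNN xP => h; exact: mem_set.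
apply: lerD; first by apply: le_trans (H _ mP); exact: ler_norm.
by apply: le_trans (H _ (measurableC mP)); rewrite -normrN ler_norm.
Qed.

Lemma bounded_pairing_norm a C : L1 mu a ->
  (forall p, test01 p -> `|\int[mu]_x (p x * a x)| <= C) ->
  \int[mu]_x `|a x| <= C + C.
Proof. by move=> La H; apply: bounded_sets_norm => //; exact: bounded_pairing_sets. Qed.

(** Here [a] is only locally integrable to begin with. Its products with growing plateaus have [L^1]
    norm at most [2C], and Fatou's lemma passes to the limit. *)
Lemma bounded_pairing_L1 a C : measurable_fun [set: borel R N] a ->
  (forall p, testfun p -> L1 mu (fun x => p x * a x)) ->
  (forall p, test01 p -> `|\int[mu]_x (p x * a x)| <= C) -> L1 mu a.
Proof.
move=> ma La H; apply/integrableP; split; first exact/measurable_EFinP.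
pose chi (n : nat) := plateau (0 : 'rV[R]_N) n.+1%:R.
have tchi n : test01 (chi n).
  split; first by apply: testfun_plateau.
  by move=> x; rewrite plateau_ge0 plateau_le1.
have B n : (\int[mu]_x (`|chi n x * a x|)%:E <= (C + C)%:E)%E.
  have Ln := La _ (tchi n).1.
  rewrite -EFin_Rint; last exact: L1_norm.
  rewrite lee_fin; apply: bounded_pairing_norm => // p tp.
  under eq_Rintegral do rewrite mulrA.
  apply: H; split=> [|x]; first exact: testfunMr tp.1 (tchi n).1.1.
  have /andP[? ?] := tp.2 x; have /andP[? ?] := (tchi n).2 x.
  by rewrite mulr_ge0//= mulr_ile1.
apply: le_lt_trans (ltry (C + C)).
have F := @fatou _ _ _ mu _ measurableT (fun n x => (`|chi n x * a x|)%:E).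
have -> : (\int[mu]_x `|(EFin \o a) x| = \int[mu]_x limn_einf (fun n => (`|chi n x * a x|)%:E))%E.
  apply: eq_integral => x _ /=.
  have cx : (`|chi n x * a x|)%:E @[n --> \oo] --> (`|a x|)%:E.
    apply: cvg_near_cst; near=> n; rewrite /chi plateau1 ?mul1r// subr0 ltW//.
    rewrite (@le_lt_trans _ _ n%:R) ?ltr_nat//; near: n; exact: nbhs_infty_ger.
  by rewrite is_cvg_limn_einfE; [rewrite (cvg_lim _ cx)|apply/cvg_ex; exists (`|a x|)%:E].
apply: le_trans (F _ _) _ => [n|n x _|].
- by apply/measurable_EFinP; apply: measurableT_comp => //; exact: L1_meas (La _ (tchi n).1).
- by rewrite lee_fin.
rewrite limn_einf_lim; apply: lime_le; first exact: is_cvg_einfs.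
apply: nearW => n; apply: le_trans (B n).
by apply: ereal_inf_lbound; exists n => /=.
Unshelve. all: by end_near.
Qed.
End bounded_pairing.

(** * Lipschitz images of the cube *)

Section measurable_derive.
Variables (R : realType) (m : nat).
Implicit Types (f : 'rV[R]_m -> R) (v x : 'rV[R]_m).

Definition dquot f v (h : R) x : R := h^-1 * (f (h *: v + x) - f x).

Lemma dquot_continuous f v h : continuous f -> continuous (dquot f v h).
Proof.
move=> cf x; apply: (@continuousM _ _ (cst h^-1) (fun x => f (h *: v + x) - f x)); first exact: cst_continuous.
apply: continuousB; last exact: cf.
apply: (@continuous_comp _ _ _ (fun x => h *: v + x) f); last exact: cf.
by apply: continuousD; [exact: cst_continuous|move=> ?].
Qed.

(* The Cauchy criterion for difference quotients exhibits the set where f is derivable as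
   a countable intersection of countable unions of closed sets. *)
Definition dcauchy f v (j k : nat) := [set x : 'rV[R]_m | forall h h' : R, h != 0 -> h' != 0 ->
  `|h| < k.+1%:R^-1 -> `|h'| < k.+1%:R^-1 -> `|dquot f v h x - dquot f v h' x| <= j.+1%:R^-1].

Lemma closed_dcauchy f v j k : continuous f -> closed (dcauchy f v j k).
Proof.
move=> cf; rewrite (_ : dcauchy f v j k = \bigcap_(p in [set p : R * R | [/\ p.1 != 0, p.2 != 0, `|p.1| < k.+1%:R^-1 & `|p.2| < k.+1%:R^-1]])
   [set x | `|dquot f v p.1 x - dquot f v p.2 x| <= j.+1%:R^-1]); last first.
  by apply/seteqP; split=> [x H [h h'] /= [? ? ? ?]|x H h h' ? ? ? ?]; [exact: H|exact: (H (h, h'))].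
apply: closed_bigI => -[h h'] _ /=.
rewrite (_ : [set x | _] = (fun x => `|dquot f v h x - dquot f v h' x|) @^-1` [set t | t <= j.+1%:R^-1])//.
apply: closed_comp => [x _|]; last exact: closed_le.
apply: (@continuous_comp _ _ _ (fun x => dquot f v h x - dquot f v h' x)); last exact: norm_continuous.
by apply: continuousB; exact: dquot_continuous.
Qed.

Lemma derivable_dcauchy f v x : derivable f x v <-> (forall j, exists k, dcauchy f v j k x).
Proof.
rewrite /derivable (_ : (fun h : R => h^-1 *: _) = (fun h => dquot f v h x))//; split.
  move=> /cvg_ex[l fl] j.
  have := fl => /cvgrPdist_lt/(_ (j.+1%:R^-1 / 2)); rewrite divr_gt0// => /(_ isT).
  rewrite nearE /dnbhs /within /= => /nbhs_ballP[e /= e0 He].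
  exists (Num.truncn e^-1) => h h' h0 h'0 hk h'k.
  have ek : (Num.truncn e^-1).+1%:R^-1 <= e.
    by rewrite invf_ple ?posrE// ltW// truncnS_gt.
  have Hh : ball 0 e h by rewrite /ball /= sub0r normrN (lt_le_trans hk).
  have Hh' : ball 0 e h' by rewrite /ball /= sub0r normrN (lt_le_trans h'k).
  have := He _ Hh h0; have := He _ Hh' h'0; rewrite [in X in X -> _]distrC => H1 H2.
  have : `|dquot f v h' x - l| + `|l - dquot f v h x| < j.+1%:R^-1.
    by rewrite [X in _ < X]splitr ltrD.
  move=> /ltW; apply: le_trans; rewrite distrC; apply: le_trans (ler_normD _ _).
  by rewrite addrA subrK.
move=> H; apply/cauchy_cvgP/cauchy_ballP => e e0.
have [k Hk] := H (Num.truncn (2 / e)).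
have je : (Num.truncn (2 / e)).+1%:R^-1 < e.
  rewrite invf_plt ?posrE//; apply: lt_trans (truncnS_gt _).
  by rewrite ltr_pdivlMr// mulVf ?gt_eqF// ltr1n.
pose A := [set h : R | h != 0 /\ `|h| < k.+1%:R^-1].
have nA : 0^' A.
  by near=> h; split; [near: h; exact: nbhs_dnbhs_neq|near: h; apply: dnbhs0_lt].
exists ((fun h => dquot f v h x) @` A, (fun h => dquot f v h x) @` A) => /=.
  by split; apply: filterS nA => h Ah; exists h.
move=> [y y'] /= [[h [h0 hk] <-] [h' [h'0 h'k] <-]].
rewrite /ball /=; apply: le_lt_trans je; exact: Hk.
Unshelve. all: by end_near.
Qed.

Lemma measurable_derivable f v : continuous f ->
  measurable ([set x | derivable f x v] : set (borel R m)).
Proof.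
move=> cf; rewrite (_ : [set x | _] = \bigcap_j \bigcup_k dcauchy f v j k); last first.
  apply/seteqP; split=> [x /derivable_dcauchy H j _|x H].
    by have [k Hk] := H j; exists k.
  by apply/derivable_dcauchy => j; have [k _ Hk] := H j I; exists k.
apply: bigcapT_measurable => j; apply: bigcupT_measurable => k.
rewrite -[X in measurable X]setCK; apply: measurableC.
by apply: open_measurable_borel; apply: closed_openC; exact: closed_dcauchy.
Qed.

(* The derivative is a limit, whose value is 0 when it does not exist. *)
Lemma derive_nonderivable f v x : ~ derivable f x v -> 'D_v f x = 0.
Proof. by rewrite /derivable /derive => /dvgP ->. Qed.

(** On the measurable set of derivability the derivative is the limit of the quotients at [1/(n+1)];
    elsewhere it is 0, like the sequence multiplied by the indicator. *)
Lemma measurable_derive f v : continuous f ->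
  measurable_fun [set: borel R m] ('D_v f : borel R m -> R).
Proof.
move=> cf; have mD := measurable_derivable v cf.
apply: (@measurable_fun_cvg _ (borel R m) R _ (fun n x => \1_[set x | derivable f x v] x * dquot f v n.+1%:R^-1 x)).
  move=> n; apply: measurable_funM; first exact: measurable_indic.
  by apply: continuous_measurable_borel; exact: dquot_continuous.
move=> x _; have [df|ndf] := pselect (derivable f x v); last first.
  rewrite derive_nonderivable// indicE memNset//=.
  by under eq_cvg do rewrite mul0r; exact: cvg_cst.
rewrite indicE mem_set//=; under eq_cvg do rewrite mul1r.
have H : (fun h => dquot f v h x) @ 0^' --> 'D_v f x by exact: df.
apply: (cvg_comp _ _ _ H) => A; rewrite /dnbhs /within /= => /nbhs_ballP[e /= e0 He].
near=> n; apply: He; last by rewrite invr_eq0 pnatr_eq0.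
rewrite /ball /= sub0r normrN ger0_norm// invf_plt ?posrE//.
apply: (@le_lt_trans _ _ n%:R); last by rewrite ltr_nat.
near: n; exact: nbhs_infty_ger.
Unshelve. all: by end_near.
Qed.

End measurable_derive.

Section lip.
Variables (R : realType) (m N : nat).
Implicit Types (f : 'rV[R]_m -> 'rV[R]_N).

Lemma lipschitz_const f : lipschitz f -> exists2 L : R, 0 <= L & forall x y, `|f x - f y| <= L * `|x - y|.
Proof.
move=> [M [Mr HM]]; exists (`|M| + 1); first by rewrite addr_ge0.
move=> x y; have := HM (`|M| + 1); rewrite (le_lt_trans (ler_norm M)) ?ltrDl// => /(_ isT (x, y)) /=; exact.
Qed.

Lemma lipschitz_intro f (L : R) : (forall x y, `|f x - f y| <= L * `|x - y|) -> lipschitz f.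
Proof. by move=> H; apply: (@klipschitzW _ _ _ L _ _ (globally_properfilter (_ : _ (0, 0)))) => // -[x y] _ /=. Qed.

Lemma lipschitz_continuous f : lipschitz f -> continuous f.
Proof.
move=> /lipschitz_const[L L0 H] x; have F := nbhs_filter x.
apply: (iffRL (@cvgrPdist_lt _ _ _ (nbhs x) F f (f x))) => e e0; near=> y.
apply: le_lt_trans (H _ _) _; apply: (@le_lt_trans _ _ ((L + 1) * `|x - y|)).
  by rewrite ler_wpM2r// lerDl.
rewrite -ltr_pdivlMl ?ltr_wpDl//.
near: y; apply: cvgr_dist_lt => //.
by rewrite mulr_gt0// invr_gt0 ltr_wpDl.
Unshelve. all: by end_near.
Qed.

Lemma lip_coord_continuous f j : lipschitz f -> continuous (fun x => f x 0 j).
Proof.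
move=> lf x; apply: (@continuous_comp _ _ _ f (fun y : 'rV[R]_N => y 0 j)).
  exact: lipschitz_continuous.
exact: coord_continuous.
Qed.

Lemma measurable_partials f i j : lipschitz f ->
  measurable_fun [set: borel R m] (fun x : borel R m => partials f x i j).
Proof.
move=> lf; rewrite (_ : (fun x => _) = 'D_(delta_mx 0 i) (fun y => f y 0 j)).
  by apply: measurable_derive; exact: lip_coord_continuous.
by apply/funext => x; rewrite mxE.
Qed.

Lemma norm_delta_le (i : 'I_m) : `|delta_mx 0 i : 'rV[R]_m| <= 1.
Proof. by apply/norm_rV_le => // k; rewrite !mxE eqxx; case: (_ == _); rewrite /= ?normr1 ?normr0. Qed.

Lemma partials_le f (L : R) : 0 <= L -> (forall x y, `|f x - f y| <= L * `|x - y|) ->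
  forall x i j, `|partials f x i j| <= L.
Proof.
move=> L0 H x i j; rewrite mxE; have [df|ndf] := pselect (derivable (fun y => f y 0 j) x (delta_mx 0 i)); last first.
  by rewrite derive_nonderivable ?normr0.
apply: (closed_cvg (fun y : R => y <= L) (@closed_le R L) _ _ (cvg_norm df)).
near=> h; have h0 : h != 0 by near: h; exact: nbhs_dnbhs_neq.
rewrite /= normrM normfV ler_pdivrMl ?normr_gt0//.
have -> : f (h *: delta_mx 0 i + x) 0 j - f x 0 j = (f (h *: delta_mx 0 i + x) - f x) 0 j by rewrite !mxE.
have /norm_rV_le-/(_ (normr_ge0 _))-/(_ j) := lexx `|f (h *: delta_mx 0 i + x) - f x|.
move=> /le_trans; apply; apply: le_trans (H _ _) _.
by rewrite addrK normrZ [X in _ <= X]mulrC ler_wpM2l// ler_piMr// norm_delta_le.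
Unshelve. all: by end_near.
Qed.

(** A product of entries and not a minor: it is the coefficient in [multilinear_expand], where the
    sum runs over all [s]. *)
Definition jac f (s : {ffun 'I_m -> 'I_N}) (x : borel R m) : R := \prod_i partials f x i (s i).

Lemma measurable_jac f s : lipschitz f -> measurable_fun [set: borel R m] (jac f s).
Proof.
move=> lf; apply: measurable_prod => i _; exact: measurable_partials.
Qed.

Lemma jac_le f (L : R) s x : 0 <= L -> (forall x y, `|f x - f y| <= L * `|x - y|) -> `|jac f s x| <= L ^+ m.
Proof.
move=> L0 H; rewrite normr_prod -[X in _ ^+ X]card_ord -prodr_const.
by apply: ler_prod => i _; rewrite normr_ge0/= partials_le.
Qed.

Lemma measurable_lip f : lipschitz f -> measurable_fun [set: borel R m] (f : borel R m -> borel R N).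
Proof.
move=> lf; apply: (@measurability _ _ (borel R m) (borel R N) setT f (@open 'rV[R]_N) erefl).
move=> _ [U oU <-]; rewrite setTI; apply: open_measurable_borel.
apply: (@open_comp 'rV[R]_m 'rV[R]_N f) => // x _; exact: lipschitz_continuous.
Qed.

End lip.

Section cube_measure.
Variable R : realType.

Lemma measurable_cube m : measurable (@cube R m).
Proof.
rewrite (_ : @cube R m = \bigcap_(i in [set: 'I_m]) ((fun x : borel R m => (x : 'rV[R]_m) 0 i) @^-1` [set` `[0, 1]])); last first.
  apply/seteqP; split => x /= H i; last by have := H i I; rewrite /= in_itv.
  by move=> _ /=; rewrite in_itv; exact: H.
apply: fin_bigcap_measurable => // i _.
rewrite -[X in measurable X]setTI.
have mc : measurable_fun [set: borel R m] (fun x : borel R m => (x : 'rV[R]_m) 0 i).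
  by apply: continuous_measurable_borel; exact: coord_continuous.
by apply: mc => //; exact: measurable_itv.
Qed.

Lemma row_cons_cube m : @row_cons R m @^-1` (@cube R (1 + m)) = `[0, 1]%classic `*` @cube R m.
Proof.
apply/seteqP; split => [[t x] /= H|[t x] /= [Ht Hx] i].
  split=> /= [|i]; first by have := H (lshift m 0); rewrite in_itv/= row_mxEl mxE eqxx mulr1n.
  by have := H (rshift 1 i); rewrite row_mxEr.
rewrite -(splitK i); case: (fintype.split i) => j /=; last by rewrite row_mxEr.
by rewrite !ord1 row_mxEl mxE eqxx mulr1n; rewrite in_itv in Ht.
Qed.

Lemma lebesgue_cube m : lebesgue_rV R m (@cube R m) = 1%E.
Proof.
elim: m => [|m IH].
  by rewrite /= diracE mem_set// => -[].
rewrite -[LHS]/((@lebesgue_measure R \x lebesgue_rV R m)%E (@row_cons R m @^-1` (@cube R (1 + m)))).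
rewrite row_cons_cube product_measure1E//; last exact: measurable_cube.
rewrite IH mule1; have := @lebesgue_measure_itv R `[0, 1].
by rewrite /= lte_fin ltr01 oppr0 adde0.
Qed.

Lemma L1_cube m (f : borel R m -> R) (C : R) : measurable_fun setT f -> (forall x, `|f x| <= C) ->
  L1 (lebesgue_rV R m) (fun x => \1_(@cube R m) x * f x).
Proof.
move=> mf fC.
have mI : measurable_fun [set: borel R m] (\1_(@cube R m) : borel R m -> R) by apply: measurable_indic; exact: measurable_cube.
have LI : L1 (lebesgue_rV R m) (\1_(@cube R m)).
  apply/integrableP; split; first exact/measurable_EFinP.
  under eq_integral do rewrite /= ger0_norm// /comp.
  rewrite integral_indic//; last exact: measurable_cube.
  rewrite setIT; apply: (@le_lt_trans _ _ 1%E); last exact: ltry.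
  by rewrite le_eqVlt; apply/orP; left; apply/eqP; exact: lebesgue_cube.
apply: (@L1_ext _ _ _ _ (fun x => f x * \1_(@cube R m) x)) => [x|]; first by rewrite mulrC.
exact: (L1M mf fC LI).
Qed.

Lemma Rint_cube m (f : borel R m -> R) :
  \int[lebesgue_rV R m]_(x in @cube R m) f x = \int[lebesgue_rV R m]_x (\1_(@cube R m) x * f x).
Proof.
rewrite Rintegral_mkcond; apply: eq_Rintegral => x _.
by rewrite patchE indicE; case: (x \in _); rewrite /= ?mul1r ?mul0r.
Qed.

End cube_measure.
Arguments measurable_cube : clear implicits.

Section dominating.
Variables (R : realType) (m N : nat).
Variable (f : nat -> borel R m -> borel R N).
Hypothesis mf : forall r, measurable_fun [set: borel R m] (f r).

Definition cube_restr : {measure set (borel R m) -> \bar R} :=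
  mrestr (lebesgue_rV R m) (measurable_cube R m).

Definition push_cube (r : nat) : {measure set (borel R N) -> \bar R} :=
  measure_function_pushforward__canonical__measure_function_Measure cube_restr (mf r).

Lemma wgt_ge0 (r : nat) : 0 <= 1 / (2 ^ r.+1)%:R :> R.
Proof. by rewrite divr_ge0. Qed.

Definition wgt (r : nat) : {nonneg R} := NngNum (wgt_ge0 r).

Definition wpush (r : nat) : {measure set (borel R N) -> \bar R} := mscale (wgt r) (push_cube r).

(* The weights 2^-(r+1) keep the sum of the pushed measures finite. *)
Definition dom_measure : set (borel R N) -> \bar R := mseries wpush 0.

HB.instance Definition _ := Measure.on dom_measure.

Lemma dom_measure_fin : fin_num_fun dom_measure.
Proof.
apply: (@lty_fin_num_fun _ _ _ dom_measure).
apply: (@le_lt_trans _ _ (1%R%:E)); last exact: ltry.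
apply: le_trans (epsilon_trick0 xpredT ler01).
apply: lee_nneseries => r _ //.
rewrite -[X in (X <= _)%E]/((1 / (2 ^ r.+1)%:R)%:E * lebesgue_rV R m (setT `&` @cube R m))%E.
by rewrite setTI lebesgue_cube mule1.
Qed.

HB.instance Definition _ := Measure_isFinite.Build _ _ _ dom_measure dom_measure_fin.

Lemma dom_measure0 A r : measurable A -> dom_measure A = 0%E ->
  lebesgue_rV R m (f r @^-1` A `&` @cube R m) = 0%E.
Proof.
move=> mA A0.
have : (wpush r A <= dom_measure A)%E.
  rewrite /dom_measure /mseries (@nneseriesD1 _ _ r xpredT)// ?leeDl//.
    by apply: nneseries_ge0.
rewrite A0 measure_le0 => /eqP.
rewrite -[X in X = _ -> _]/((1 / (2 ^ r.+1)%:R)%:E * lebesgue_rV R m (f r @^-1` A `&` @cube R m))%E.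
move=> /eqP; rewrite mule_eq0 => /orP[|/eqP//].
by rewrite eqe mul1r invr_eq0 pnatr_eq0 expn_eq0.
Qed.

(** The push-forward under [f r] of the charge with density [a] on the cube charges no null set of
    [dom_measure], which contains a multiple of the pushed cube measure; [b] is its Radon-Nikodym
    density. *)
Lemma RN_push r (a : borel R m -> R) (C : R) : measurable_fun setT a -> (forall x, `|a x| <= C) ->
  exists2 b, L1 dom_measure b & forall (p : borel R N -> R) (D : R), measurable_fun setT p ->
   (forall y, `|p y| <= D) ->
   \int[lebesgue_rV R m]_x (p (f r x) * (\1_(@cube R m) x * a x)) = \int[dom_measure]_y (p y * b y).
Proof.
move=> ma aC; have La := L1_cube ma aC.
set a' := (fun x => _) in La.
pose nu0 : {charge set (borel R m) -> \bar R} := induced_charge La.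
pose nu : {charge set (borel R N) -> \bar R} :=
  measure_function_pushforward__canonical__charge_Charge nu0 (mf r).
have mfA A : measurable A -> measurable (f r @^-1` A).
  by move=> mA; rewrite -[X in measurable X]setTI; exact: mf.
have nuE A : nu A = (\int[lebesgue_rV R m]_(x in f r @^-1` A) (a' x)%:E)%E by [].
have numu : null_dominates dom_measure nu.
  apply/null_content_dominatesP => A mA A0.
  have E0 := dom_measure0 r mA A0.
  rewrite nuE (@negligible_integral _ _ _ _ _ (f r @^-1` A `&` @cube R m))//.
  - rewrite integral0_eq// => x [Ax nx]; rewrite /a' indicE memNset ?mul0r// => cx; exact: nx.
  - by apply: measurableI; [exact: mfA|exact: measurable_cube].
  - exact: mfA.
  - exact: (integrableS measurableT (mfA A mA) (@subsetT _ _) La).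
pose b := fun y => fine (Radon_Nikodym nu dom_measure y).
have bE y : (b y)%:E = Radon_Nikodym nu dom_measure y.
  by rewrite fineK//; exact: Radon_Nikodym_fin_num.
have Lb : L1 dom_measure b.
  rewrite /L1 (_ : EFin \o b = Radon_Nikodym nu dom_measure); first exact: Radon_Nikodym_integrable.
  by apply/funext => y; exact: bE.
exists b => // p D mp pD.
apply: (@agree_bounded _ _ _ _ _ _ _ _ _ (f r) id a' b) pD => //.
move=> A mA.
transitivity (fine (nu A)).
  rewrite nuE /Rintegral; congr fine; rewrite [RHS]integral_mkcond.
  apply: eq_integral => x _; rewrite patchE indicE -[x \in _ @^-1` _]/(f r x \in A).
  by case: (f r x \in A); rewrite /= ?mul1r ?mul0r.
rewrite (Radon_Nikodym_integral numu mA) /Rintegral; congr fine; rewrite [LHS]integral_mkcond.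
apply: eq_integral => x _; rewrite patchE indicE.
by case: (x \in A); rewrite /= ?mul1r ?mul0r ?bE.
Qed.

End dominating.

(** * Scaling and subdivision of the cube *)

Section scale1.
Variable R : realType.
Local Open Scope ereal_scope.
Let mR := measurableTypeR R.
Local Notation leb := (@lebesgue_measure R).

Definition affine (r b : R) (t : mR) : mR := (r * t + b)%R.

Let measurable_aff r b : measurable_fun [set: mR] (affine r b).
Proof. by apply: measurable_funD => //; apply: measurable_funM. Qed.

Let scaled (r : {nonneg R}) (b : R) : {measure set mR -> \bar R} :=
  mscale r (measure_function_pushforward__canonical__measure_function_Measure leb (measurable_aff r%:num b)).

(** The rescaled measure agrees with Lebesgue measure on half-open intervals, and these determine
    it. *)
Lemma lebesgue_scale (r b : R) (A : set mR) : (0 < r)%R -> measurable A ->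
  leb A = r%:E * leb (affine r b @^-1` A).
Proof.
move=> r0; pose rn := NngNum (ltW r0).
apply: (@lebesgue_measure_unique R (scaled rn b)) => _ [[a c] _ <-].
rewrite -[RHS]/(r%:E * leb (affine r b @^-1` `]a, c]%classic)).
have -> : affine r b @^-1` `]a, c]%classic = `]((a - b) / r)%R, ((c - b) / r)%R]%classic.
  apply/seteqP; split=> x /=; rewrite !in_itv/= /affine ltr_pdivrMr// ler_pdivlMr//.
    by rewrite ltrBlDr lerBrDr [(x * r)%R]mulrC.
  by rewrite ltrBlDr lerBrDr [(x * r)%R]mulrC.
rewrite !lebesgue_measure_itv/= !lte_fin ltr_pM2r ?invr_gt0// ltrD2r.
case: ifPn => // ac; last by rewrite mule0.
rewrite -!EFinD -EFinM; congr EFin; field; by rewrite gt_eqF.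
Qed.

Lemma ge0_integral_scale (r b : R) (D : set mR) (g : mR -> \bar R) : (0 < r)%R -> measurable D ->
  measurable_fun setT g -> (forall x, 0 <= g x) ->
  \int[leb]_(x in D) g x = r%:E * \int[leb]_(x in affine r b @^-1` D) g (affine r b x).
Proof.
move=> r0 mD mg g0; pose rn := NngNum (ltW r0).
rewrite (@eq_measure_integral _ _ _ _ (scaled rn b)); last first.
  by move=> A mA _; exact: lebesgue_scale.
rewrite ge0_integral_mscale//; last exact: measurable_funTS.
congr (_ * _).
have := @ge0_integral_pushforward _ _ _ _ _ (affine r b) (measurable_aff r b) leb D g mD.
by apply; [exact: measurable_funTS|move=> x _].
Qed.

Lemma subdivide1 (n : nat) (g : mR -> \bar R) : measurable_fun setT g -> (forall x, 0 <= g x) ->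
  \int[leb]_(x in `[0%R, 1%R]) g x =
  \sum_(c < n.+1) (n.+1%:R^-1)%:E * \int[leb]_(x in `[0%R, 1%R]) g (affine n.+1%:R^-1 (c%:R / n.+1%:R) x).
Proof.
move=> mg g0.
(* Half-open intervals make the pieces of the subdivision disjoint; the left endpoint is null. *)
have oc (h : mR -> \bar R) : measurable_fun setT h ->
    \int[leb]_(x in `[0%R, 1%R]) h x = \int[leb]_(x in `]0%R, 1%R]) h x.
  by move=> mh; apply/esym/integral_itv_obnd_cbnd; exact: measurable_funTS.
have mga c : measurable_fun setT (fun x => g (affine n.+1%:R^-1 (c%:R / n.+1%:R) x)).
  by apply: measurableT_comp => //; exact: measurable_aff.
rewrite oc// (eq_bigr (fun c : 'I_n.+1 => (n.+1%:R^-1)%:E * \int[leb]_(x in `]0%R, 1%R]) g (affine n.+1%:R^-1 (c%:R / n.+1%:R) x))); last first.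
  by move=> c _; rewrite oc.
have n0 : (0 < n.+1%:R :> R)%R by [].
suff H k : \int[leb]_(x in `]0%R, (k%:R / n.+1%:R)%R]) g x = \sum_(c < k) (n.+1%:R^-1)%:E * \int[leb]_(x in `]0%R, 1%R]) g (affine n.+1%:R^-1 (c%:R / n.+1%:R) x).
  by have := H n.+1; rewrite divff// gt_eqF.
elim: k => [|k IH].
  by rewrite big_ord0 mul0r set_itvoc0 integral_set0.
rewrite big_ord_recr/= -IH.
rewrite (@itv_bndbnd_setU _ _ _ (BRight (k%:R / n.+1%:R)%R)) ?bnd_simp ?divr_ge0//; last first.
  by rewrite ler_pM2r ?invr_gt0// ler_nat.
rewrite ge0_integral_setU//=.
- congr (_ + _).
  rewrite (@ge0_integral_scale n.+1%:R^-1 (k%:R / n.+1%:R)) ?invr_gt0//.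
  congr (_ * _); congr (integral _ _ _).
  have EE (x : R) : (k%:R / n.+1%:R < n.+1%:R^-1 * x + k%:R / n.+1%:R <= k.+1%:R / n.+1%:R)%R = (0 < x <= 1)%R.
    rewrite -(@natr1 _ k) mulrDl mul1r ltrDr addrC lerD2l pmulr_rgt0 ?invr_gt0//.
    by rewrite ger_pMr ?invr_gt0.
  by apply/seteqP; split=> x /=; rewrite !in_itv/= /affine EE.
- exact: measurable_funTS.
- apply/disj_setPS => y [/=]; rewrite !in_itv/= => /andP[_ yk] /andP[].
  by rewrite ltNge yk.
Qed.
End scale1.

Section subdivide.
Variable R : realType.
Local Open Scope ereal_scope.
Local Notation leb m := (lebesgue_rV R m).

(** Measurability in [t] is returned along with the formula because the induction in
    [subdivide_cube] integrates the partial integrals once more. *)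
Lemma cube_tonelli m (F : borel R (1 + m) -> \bar R) : measurable_fun setT F -> (forall x, 0 <= F x) ->
  measurable_fun [set: measurableTypeR R] (fun t => \int[leb m]_(x in @cube R m) F (@row_cons R m (t, x))) /\
  \int[leb m.+1]_(x in @cube R m.+1) F x =
  \int[@lebesgue_measure R]_(t in `[0%R, 1%R]) \int[leb m]_(x in @cube R m) F (@row_cons R m (t, x)).
Proof.
move=> mF F0.
have mFc : measurable_fun [set: (measurableTypeR R * borel R m)%type] (F \o @row_cons R m).
  by apply: measurableT_comp => //; exact: measurable_row_cons.
pose G (z : measurableTypeR R * borel R m) := if z.2 \in @cube R m then F (row_cons z) else 0.
have mG : measurable_fun [set: (measurableTypeR R * borel R m)%type] G.
  rewrite (_ : G = fun z => (\1_(@cube R m) z.2)%:E * F (row_cons z)); last first.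
    by apply/funext => z; rewrite /G indicE; case: ifP => _; rewrite /= ?mul1e ?mul0e.
  apply: emeasurable_funM => //; apply/measurable_EFinP.
  rewrite (_ : (fun z => _) = \1_([set: measurableTypeR R] `*` @cube R m)).
    by apply: measurable_indic; apply: measurableX => //; exact: measurable_cube.
  by apply/funext => z; rewrite !indicE in_setX in_setT.
have G0 z : 0 <= G z by rewrite /G; case: ifP.
have FG t : \int[leb m]_(x in @cube R m) F (@row_cons R m (t, x)) = fubini_F (leb m) G t.
  rewrite /fubini_F [LHS]integral_mkcond; congr (integral _ _ _).
split.
  rewrite (_ : (fun t => _) = fubini_F (leb m) G); last by apply/funext => t; rewrite FG.
  exact: measurable_fun_fubini_tonelli_F.
have H := @ge0_integral_pushforward _ _ _ _ _ _ (@measurable_row_cons R m) (@lebesgue_measure R \x leb m) (@cube R (1 + m)) F (measurable_cube R (1 + m)) (measurable_funTS mF) (fun y _ => F0 y).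
refine (etrans H _).
pose G' (z : measurableTypeR R * borel R m) := (\1_(`[0%R, 1%R]%classic : set (measurableTypeR R)) z.1)%:E * G z.
have mG' : measurable_fun [set: (measurableTypeR R * borel R m)%type] G'.
  apply: emeasurable_funM => //; apply/measurable_EFinP.
  rewrite (_ : (fun z => _) = \1_((`[0%R, 1%R]%classic : set (measurableTypeR R)) `*` [set: borel R m])).
    by apply: measurable_indic; apply: measurableX.
  by apply/funext => z; rewrite !indicE in_setX in_setT andbT.
have G'0 z : 0 <= G' z by rewrite mule_ge0.
transitivity (\int[@lebesgue_measure R \x leb m]_z G' z).
  rewrite integral_mkcond; apply: eq_integral => z _.
  rewrite patchE row_cons_cube /G' /G indicE.
  rewrite (_ : (z \in _) = (z.1 \in (`[0%R, 1%R]%classic : set (measurableTypeR R))) && (z.2 \in @cube R m)); last first.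
    by rewrite -in_setX.
  by do 2 case: (_ \in _); rewrite /= ?mul1e ?mul0e.
rewrite (@fubini_tonelli1 _ _ _ _ _ _ _ G')// [RHS]integral_mkcond.
apply: eq_integral => t _; rewrite patchE /fubini_F; case: ifPn => ht.
  by rewrite FG; apply: eq_integral => y _; rewrite /G' indicE ht mul1e.
by apply: integral0_eq => y _; rewrite /G' indicE (negbTE ht) mul0e.
Qed.

(** Induction on the dimension by Tonelli's theorem, subdividing the first coordinate by
    [subdivide1]; [S] lists the corners of the [(n+1)^m] subcubes. *)
Lemma subdivide_cube (n m : nat) : exists S : seq 'rV[R]_m,
  forall F : borel R m -> \bar R, measurable_fun setT F -> (forall x, 0 <= F x) ->
  \int[leb m]_(x in @cube R m) F x =
  \sum_(a <- S) (n.+1%:R^-1 ^+ m)%:E * \int[leb m]_(x in @cube R m) F (a + n.+1%:R^-1 *: (x : 'rV[R]_m))%R.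
Proof.
elim: m => [|m [S IH]].
  exists [:: 0%R] => F mF F0; rewrite big_seq1 expr0 mul1e; congr integral.
  by apply/funext => x; congr F; apply/rowP => -[].
exists [seq (@row_cons R m (c%:R / n.+1%:R, a)%R : 'rV[R]_m.+1) | c <- index_iota 0 n.+1, a <- S] => F mF F0.
have [mP ->] := cube_tonelli mF F0.
have mrow (c : R) : measurable_fun setT (fun x : borel R m => @row_cons R m (c, x)).
  by apply: (measurableT_comp (@measurable_row_cons R m)); exact: measurable_pair1.
pose sh k (a : 'rV[R]_k) (x : borel R k) : borel R k := (a + n.+1%:R^-1 *: (x : 'rV[R]_k))%R.
have msh k (a : 'rV[R]_k) : measurable_fun setT (sh k a).
  apply: (@measurability _ _ (borel R k) (borel R k) setT (sh k a) (@open 'rV[R]_k) erefl).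
  move=> _ [U oU <-]; rewrite setTI; apply: open_measurable_borel.
  apply: (@open_comp 'rV[R]_k 'rV[R]_k (sh k a)) => // x _.
  apply: (@continuousD _ _ _ (cst a) (fun x : 'rV[R]_k => n.+1%:R^-1 *: x)); first exact: cst_continuous.
  exact: scaler_continuous.
have sh_row c (a : 'rV[R]_m) t (x : borel R m) :
    sh m.+1 (@row_cons R m (c, a)) (@row_cons R m (t, x)) = @row_cons R m (affine n.+1%:R^-1 c t, sh m a x).
  apply/rowP => i; rewrite !mxE; case: fintype.split => j; rewrite !mxE //.
  by rewrite ord1 eqxx !mulr1n /affine addrC.
(* The intermediate stage: the last [m] coordinates are already contracted, the first one is not. *)
pose Fa a (z : borel R m.+1) := F (@row_cons R m ((@row_uncons R m z).1, sh m a (@row_uncons R m z).2)).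
have mFa a : measurable_fun setT (Fa a).
  apply: (measurableT_comp mF); apply: (measurableT_comp (@measurable_row_cons R m)).
  apply: measurable_fun_pair.
    by apply: (measurableT_comp measurable_fst); exact: measurable_row_uncons.
  apply: (measurableT_comp (msh m a)); apply: (measurableT_comp measurable_snd).
  exact: measurable_row_uncons.
have Fa0 a z : 0 <= Fa a z by exact: F0.
have FaE a t x : Fa a (@row_cons R m (t, x)) = F (@row_cons R m (t, sh m a x)).
  by rewrite /Fa row_consK.
pose H a t := \int[leb m]_(x in @cube R m) F (@row_cons R m (t, sh m a x)).
have mH a : measurable_fun [set: measurableTypeR R] (H a).
  have [+ _] := cube_tonelli (mFa a) (Fa0 a); congr measurable_fun.
  by apply/funext => t; apply: eq_integral => x _; rewrite FaE.
have H0 a t : 0 <= H a t by apply: integral_ge0.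
transitivity (\sum_(a <- S) (n.+1%:R^-1 ^+ m)%:E * \int[@lebesgue_measure R]_(t in `[0%R, 1%R]) H a t).
  rewrite (eq_integral (fun t => \sum_(a <- S) (n.+1%:R^-1 ^+ m)%:E * H a t)) => [|t _]; last first.
    by rewrite IH//; exact: measurableT_comp.
  rewrite ge0_integral_sum//; last 2 first.
  - by move=> a; apply: emeasurable_funM => //; exact: measurable_funTS.
  - by move=> a t _; rewrite mule_ge0// lee_fin exprn_ge0.
  apply: eq_bigr => a _; rewrite ge0_integralZl// ?lee_fin ?exprn_ge0//.
  exact: measurable_funTS.
rewrite big_allpairs_dep/= exchange_big/=; apply: eq_bigr => a _.
rewrite (subdivide1 n)// ge0_sume_distrr; last by move=> c _; rewrite mule_ge0 ?integral_ge0.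
rewrite big_mkord; apply: eq_bigr => c _.
rewrite muleA -EFinM -exprSr; congr (_ * _).
have mFs : measurable_fun setT (F \o sh m.+1 (@row_cons R m (c%:R / n.+1%:R, a)%R)).
  exact: measurableT_comp.
have [_ ->] := cube_tonelli mFs (fun x => F0 _).
by apply: eq_integral => t _; apply: eq_integral => x _; rewrite /= sh_row.
Qed.

Local Open Scope ring_scope.

(* Maps the unit cube onto its subcube of side 1/(n+1) with corner a. *)
Definition subcube (n m : nat) (a : 'rV[R]_m) (x : borel R m) : borel R m := a + n.+1%:R^-1 *: (x : 'rV[R]_m).

Lemma subcube_continuous n m (a : 'rV[R]_m) : continuous (subcube n a : 'rV[R]_m -> 'rV[R]_m).
Proof.
move=> x; apply: (@continuousD _ _ _ (cst a) (fun x : 'rV[R]_m => n.+1%:R^-1 *: x)); first exact: cst_continuous.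
exact: scaler_continuous.
Qed.

Lemma measurable_subcube n m (a : 'rV[R]_m) : measurable_fun setT (subcube n a).
Proof.
apply: (@measurability _ _ (borel R m) (borel R m) setT (subcube n a) (@open 'rV[R]_m) erefl).
move=> _ [U oU <-]; rewrite setTI; apply: open_measurable_borel.
by apply: (@open_comp 'rV[R]_m 'rV[R]_m (subcube n a)) => // x _; exact: subcube_continuous.
Qed.

(** The bound [C] is added to reach a nonnegative integrand; the constant, itself subdivided,
    cancels. *)
Lemma subdivide_real (n m : nat) : exists S : seq 'rV[R]_m,
  forall (F : borel R m -> R) (C : R), measurable_fun setT F -> (forall x, `|F x| <= C) ->
  \int[leb m]_(x in @cube R m) F x =
  \sum_(a <- S) n.+1%:R^-1 ^+ m * \int[leb m]_(x in @cube R m) F (subcube n a x).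
Proof.
have [S HS] := subdivide_cube n m; exists S.
have mI (F : borel R m -> R) (C : R) : measurable_fun setT F -> (forall x, `|F x| <= C) ->
    (\int[leb m]_(x in @cube R m) F x)%:E = (\int[leb m]_(x in @cube R m) (F x)%:E)%E.
  move=> mF FC; rewrite Rint_cube EFin_Rint; last exact: L1_cube FC.
  rewrite [RHS]integral_mkcond; apply: eq_integral => x _; rewrite patchE indicE.
  by case: (x \in _); rewrite /= ?mul1r ?mul0r.
have pos (F : borel R m -> R) (C : R) : measurable_fun setT F -> (forall x, `|F x| <= C) -> (forall x, 0 <= F x) ->
    \int[leb m]_(x in @cube R m) F x = \sum_(a <- S) n.+1%:R^-1 ^+ m * \int[leb m]_(x in @cube R m) F (subcube n a x).
  move=> mF FC F0; have mEF : measurable_fun setT (EFin \o F) by exact/measurable_EFinP.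
  apply: EFin_inj; rewrite (mI F C)// -sumEFin.
  refine (etrans (HS (EFin \o F) mEF (fun x => F0 x)) _).
  apply: eq_bigr => a _; rewrite EFinM; congr (_ * _)%E; rewrite (mI (F \o subcube n a) C)//.
    by apply: (measurableT_comp mF); exact: measurable_subcube.
  by move=> x; exact: FC.
move=> F C mF FC.
have C0 : 0 <= C by apply: le_trans (FC 0).
have add (G : borel R m -> R) : measurable_fun setT G -> (forall x, `|G x| <= C) ->
    \int[leb m]_(x in @cube R m) (G x + C) = \int[leb m]_(x in @cube R m) G x + \int[leb m]_(x in @cube R m) C.
  move=> mG GC; rewrite !Rint_cube -RintD.
  - by apply: eq_Rintegral => x _; rewrite mulrDr.
  - exact: L1_cube GC.
  - by apply: (@L1_cube _ _ (fun=> C) C) => // x; rewrite ger0_norm.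
have := pos (fun x => F x + C) (C + C) _ _ _.
rewrite add// => H.
have {}H : \int[leb m]_(x in @cube R m) F x + \int[leb m]_(x in @cube R m) C =
  \sum_(a <- S) n.+1%:R^-1 ^+ m * \int[leb m]_(x in @cube R m) (F (subcube n a x) + C).
  apply: H => [|x|x]; first exact: measurable_funD.
    by rewrite (le_trans (ler_normD _ _))// lerD// ger0_norm.
  by have := FC x; rewrite ler_norml => /andP[? _]; lra.
have HC := pos (fun=> C) C (measurable_cst _) (fun x => _) (fun=> C0).
apply: (addIr (\int[leb m]_(x in @cube R m) C)); rewrite H [in RHS]HC ?ger0_norm// -big_split /=.
apply: eq_bigr => a _; rewrite -mulrDr; congr (_ * _).
apply: (add (F \o subcube n a)) => [|x]; last exact: FC.
by apply: (measurableT_comp mF); exact: measurable_subcube.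
Qed.
End subdivide.

(** * Restriction of Lipschitz images of the cube to Borel sets *)

Section testfun_lip.
Variables (R : realType) (N : nat).

Lemma testfun_partial (f : 'rV[R]_N -> R) i : testfun f -> testfun ('D_(delta_mx 0 i) f).
Proof.
move=> [sf cf]; split; first exact: smooth_partial.
refine (@subclosed_compact _ _ _ _ cf _); first exact: closed_closure.
apply: supp1_sub_closed; first exact: closed_closure.
move=> x; apply: contra_neqP => xf; rewrite -(derive_cst 0 x (delta_mx 0 i)); apply: near_eq_derive.
have oA : open (~` supp1 f) by apply: closed_openC; exact: closed_closure.
by apply: filterS (open_nbhs_nbhs (conj oA xf)) => y /supp1_out ->.
Qed.

(** Mean value theorem along the segment from [y] to [x]; the partial derivatives are test functions
    again, hence bounded. *)
Lemma testfun_lip (f : 'rV[R]_N -> R) : testfun f ->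
  exists2 L : R, 0 <= L & forall x y, `|f x - f y| <= L * `|x - y|.
Proof.
move=> tf; have sf := tf.1.
have /choice[M HM] : forall i, exists M : R, 0 < M /\ forall x, `|'D_(delta_mx 0 i) f x| <= M.
  by move=> i; have [M M0 HM] := testfun_bounded (testfun_partial i tf); exists M.
exists (\sum_i M i); first by apply: sumr_ge0 => i _; have [/ltW] := HM i.
move=> x y; set v := x - y.
have dg (s : R) : is_derive s 1 (fun s : R => f (s *: v + y)) ('D_v f (s *: v + y)).
  have dl : is_derive (0 : R) 1 (fun h : R => f (h *: v + (s *: v + y))) ('D_v f (s *: v + y)).
    by apply/is_derive_lineP; apply: DeriveDef => //; exact: smooth_derivable_dir.
  rewrite (_ : (fun s => _) = (fun h : R => f (h *: v + (s *: v + y))) \o (fun r => r - s)); last first.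
    by apply/funext => r /=; rewrite addrA -scalerDl subrK.
  rewrite -[X in is_derive _ _ _ X]mulr1.
  apply: is_derive1_comp; rewrite ?subrr//.
  by apply: is_derive_eq; rewrite subr0.
have cg : continuous (fun s : R => f (s *: v + y)).
  by move=> s; apply/differentiable_continuous/derivable1_diffP; have [] := dg s.
have [c _] := MVT_segment (ler01) (fun x _ => dg x) (continuous_subspaceT cg).
rewrite scale1r scale0r add0r subrK subr0 mulr1 => ->.
rewrite smooth_deriveE// (le_trans (ler_norm_sum _ _ _))// mulr_suml; apply: ler_sum => i _.
rewrite normrM mulrC ler_pM//; first by have [_] := HM i; apply.
by have /norm_rV_le-/(_ (normr_ge0 _)) := lexx `|v|; apply.
Qed.
End testfun_lip.

Section bform.
Variables (R : realType) (m N : nat).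

(* Borel forms with bounded coefficients, on which cube_current still makes sense. *)
Definition bform (w : dform R m N) (C : R) :=
  [/\ forall x, alternating (w x),
      forall s, measurable_fun setT (fun x : borel R N => w x (basis_frame R s)) &
      forall x s, `|w x (basis_frame R s)| <= C].

Lemma form_expand (w : dform R m N) (f : 'rV[R]_m -> 'rV[R]_N) (x : borel R m) :
  alternating (w (f x)) ->
  w (f x) (partials f x) = \sum_s jac f s x * w (f x) (basis_frame R s).
Proof. by move=> aw; rewrite multilinear_expand//; exact: multilinear_alternating. Qed.

Lemma measurable_pull (w : dform R m N) C (f : 'rV[R]_m -> 'rV[R]_N) : lipschitz f -> bform w C ->
  measurable_fun setT (fun x : borel R m => w (f x) (partials f x)).
Proof.
move=> lf [aw mw _]; rewrite (_ : (fun x => _) = (fun x => \sum_s jac f s x * w (f x) (basis_frame R s))); last first.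
  by apply/funext => x; exact: form_expand.
apply: measurable_sum => s; apply: measurable_funM; first exact: measurable_jac.
apply: (measurableT_comp (mw s)); exact: measurable_lip.
Qed.

(** [K] depends on the map only; this makes the approximation in [restricted_chain] uniform in the
    form, as the mass requires. *)
Lemma pull_le (f : 'rV[R]_m -> 'rV[R]_N) : lipschitz f ->
  exists2 K : R, 0 <= K & forall w C, bform w C -> forall x, `|w (f x) (partials f x)| <= K * C.
Proof.
move=> /lipschitz_const[L L0 HL]; exists (#|{ffun 'I_m -> 'I_N}|%:R * L ^+ m).
  by rewrite mulr_ge0// exprn_ge0.
move=> w C [aw _ wC] x; rewrite form_expand// (le_trans (ler_norm_sum _ _ _))//.
rewrite -mulrA mulr_natl -sumr_const; apply: ler_sum => s _.
by rewrite normrM ler_pM//; exact: jac_le.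
Qed.

Lemma multilinear_scale (a : 'M[R]_(m, N) -> R) (r : R) A : multilinear a -> a (r *: A) = r ^+ m * a A.
Proof.
move=> ma; rewrite !(multilinear_expand _ ma) mulr_sumr; apply: eq_bigr => s _.
rewrite mulrA; congr (_ * _); rewrite -[X in _ ^+ X]card_ord -prodr_const -big_split /=.
by apply: eq_bigr => i _; rewrite mxE.
Qed.

(** Exact at every point: multiplication by [r] is a bijection of punctured neighbourhoods of 0, so
    either both derivatives exist or both take the default value 0. *)
Lemma partials_subcube n (a : 'rV[R]_m) (f : 'rV[R]_m -> 'rV[R]_N) x :
  partials (f \o subcube n a) x = n.+1%:R^-1 *: partials f (subcube n a x).
Proof.
apply/matrixP => i j; rewrite !mxE.
pose g y := f y 0 j; rewrite -[LHS]/('D_(delta_mx 0 i) (g \o subcube n a) x) -[X in _ * X]/('D_(delta_mx 0 i) g (subcube n a x)).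
set e := delta_mx 0 i; set r := n.+1%:R^-1.
have r0 : r != 0 by rewrite invr_eq0 pnatr_eq0.
have key h : dquot (g \o subcube n a) e h x = r * dquot g e (r * h) (subcube n a x).
  rewrite /dquot mulrA invfM mulrA divff// mul1r; congr (_ * _).
  congr (g _ - _); rewrite /subcube /= -/r scalerDr scalerA addrCA; by rewrite addrA.
have rh : (fun h : R => r * h) @ 0^' --> (0 : R)^'.
  move=> A; rewrite /dnbhs /within /= => /nbhs_ballP[e' /= e'0 He].
  apply/nbhs_ballP; exists (e' / `|r|) => /=; first by rewrite divr_gt0// normr_gt0.
  move=> h /=; rewrite /ball /= sub0r normrN ltr_pdivlMr ?normr_gt0// => hh h0.
  by apply: He; rewrite ?mulf_neq0// /ball /= sub0r normrN normrM mulrC.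
have dk l : (fun h => dquot g e h (subcube n a x)) @ 0^' --> l ->
    (fun h => dquot (g \o subcube n a) e h x) @ 0^' --> r * l.
  move=> H; under eq_fun do rewrite key.
  by apply: cvgM; [exact: cvg_cst|exact: (cvg_comp _ _ rh H)].
have [dg|ndg] := pselect (derivable g (subcube n a x) e).
  by apply: (@cvg_lim R); [exact: Rhausdorff|exact: (dk _ dg)].
rewrite (derive_nonderivable ndg) mulr0.
apply: (@derive_nonderivable R m (g \o subcube n a) e x).
move=> /cvg_ex[l Hl]; apply: ndg; apply/cvg_ex; exists (r^-1 * l).
have rh' : (fun h : R => r^-1 * h) @ 0^' --> (0 : R)^'.
  move=> A; rewrite /dnbhs /within /= => /nbhs_ballP[e' /= e'0 He].
  apply/nbhs_ballP; exists (e' * `|r|) => /=; first by rewrite mulr_gt0// normr_gt0.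
  move=> h /=; rewrite /ball /= sub0r normrN => hh h0.
  apply: He; rewrite ?mulf_neq0// ?invr_eq0// /ball /= sub0r normrN normrM normfV mulrC.
  by rewrite ltr_pdivrMr ?normr_gt0.
rewrite -[X in X @ _]/(fun h => dquot g e h (subcube n a x)).
have -> : (fun h => dquot g e h (subcube n a x)) = (fun h => r^-1 * dquot (g \o subcube n a) e (r^-1 * h) x).
  by apply/funext => h; rewrite key !mulrA mulVf// divff// !mul1r.
by apply: cvgM; [exact: cvg_cst|exact: (cvg_comp _ _ rh' Hl)].
Qed.

Lemma lipschitz_subcube n (a : 'rV[R]_m) (f : 'rV[R]_m -> 'rV[R]_N) : lipschitz f -> lipschitz (f \o subcube n a).
Proof.
move=> /lipschitz_const[L L0 HL]; apply: (@lipschitz_intro _ _ _ _ (L * n.+1%:R^-1)) => x y.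
apply: le_trans (HL _ _) _; rewrite -mulrA ler_wpM2l//.
by rewrite /subcube /= opprD addrACA subrr add0r -scalerBr normrZ ger0_norm.
Qed.

Lemma cube_currentE (f : 'rV[R]_m -> 'rV[R]_N) (w : dform R m N) :
  cube_current f w = \int[lebesgue_rV R m]_(x in @cube R m) w (f x) (partials f x).
Proof. by apply: eq_Rintegral => x _; rewrite /pullback mul1mx. Qed.

(* The test function ps approximates the indicator of E and varies by less than 1/4 on each
   subcube, so on a subcube that is misclassified by the threshold 1/2 the error
   |ps - 1_E| is at least 1/4. *)
Lemma restricted_chain (f : 'rV[R]_m -> 'rV[R]_N) (E : set (borel R m)) (e : R) :
  lipschitz f -> measurable E -> 0 < e ->
  exists p (z : 'I_p -> int) (g : 'I_p -> 'rV[R]_m -> 'rV[R]_N), (forall i, lipschitz (g i)) /\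
    forall w C, 0 <= C -> bform w C ->
    `|\int[lebesgue_rV R m]_(x in @cube R m) (\1_E x * w (f x) (partials f x)) - lipschitz_chain z g w| <= e * C.
Proof.
move=> lf mE e0; have [K K0 HK] := pull_le lf.
pose Ex (h : borel R m -> R) := \int[lebesgue_rV R m]_x (h x * `|\1_(@cube R m) x|).
have LI : L1 (lebesgue_rV R m) (\1_(@cube R m)).
  apply: (@L1_ext _ _ _ _ (fun x => \1_(@cube R m) x * 1)) => [x|]; first by rewrite mulr1.
  by apply: (@L1_cube _ _ (fun=> 1) 1) => // x; rewrite normr1.
have qE : quasi Ex by apply: (@quasi_int R m _ _ (lebesgue_rV R m) id) => //; exact: measurable_id.
(* Pointwise, misclassification costs at most [4 * K * C] times the error of [ps]; the summand 1
   keeps the quotient meaningful when [K = 0]. *)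
have e1 : 0 < e / (4 * K + 1) by rewrite divr_gt0// ltr_wpDl// mulr_ge0.
have [ps tps Eps] := quasi_dense qE mE e1.
have [L L0 HL] := testfun_lip tps.1.
pose n := Num.truncn (4 * L).
have nL : L * n.+1%:R^-1 <= 4^-1.
  by rewrite ler_pdivrMr// ler_pdivlMl// ltW// truncnS_gt.
have [S HS] := subdivide_real R n m.
pose p := size S; pose a (i : 'I_p) := nth 0 S i.
pose z (i : 'I_p) : int := if 2^-1 <= ps (a i) then 1 else 0.
exists p, z, (fun i => f \o subcube n (a i)); split; first by move=> i; exact: lipschitz_subcube.
move=> w C C0 bw; have [aw mw wC] := bw.
pose W x := w (f x) (partials f x).
have mW : measurable_fun setT (W : borel R m -> R) by exact: measurable_pull bw.
have WK x : `|W x| <= K * C by exact: HK.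
have m1 : measurable_fun setT (\1_E : borel R m -> R) by exact: measurable_indic.
have EW x : `|\1_E x * W x| <= K * C.
  by rewrite normrM indicE; case: (x \in E); rewrite /= ?normr1 ?normr0 ?mul1r ?mul0r// mulr_ge0.
have mEW : measurable_fun setT (fun x : borel R m => \1_E x * W x) by exact: measurable_funM.
have mEWa i : measurable_fun setT (fun x : borel R m => \1_E (subcube n (a i) x) * W (subcube n (a i) x)).
  by apply: (measurableT_comp mEW); exact: measurable_subcube.
have mWa i : measurable_fun setT (fun x : borel R m => W (subcube n (a i) x)).
  by apply: (measurableT_comp mW); exact: measurable_subcube.
pose er := err ps E.
have [mer er01] := nice_err (test01_nice tps) mE.
have er1 x : `|er x| <= 1 by have /andP[? ?] := er01 x; rewrite ger0_norm.
rewrite (HS _ (K * C))// /lipschitz_chain (big_nth 0) big_mkord -sumrB.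
apply: le_trans (ler_norm_sum _ _ _) _.
apply: (@le_trans _ _ (\sum_(i < p) n.+1%:R^-1 ^+ m * \int[lebesgue_rV R m]_(x in @cube R m) (4 * K * C * er (subcube n (a i) x)))).
  apply: ler_sum => i _.
  (* The volume factor of the subdivision appears on this side too, because a form is homogeneous of
     degree [m] in the frame. *)
  have -> : cube_current (f \o subcube n (a i)) w = n.+1%:R^-1 ^+ m * \int[lebesgue_rV R m]_(x in @cube R m) W (subcube n (a i) x).
    rewrite cube_currentE !Rint_cube -RintZ; last by apply: L1_cube => // x; exact: WK.
    apply: eq_Rintegral => x _; rewrite mulrCA; congr (_ * _).
    by rewrite partials_subcube multilinear_scale//; exact: multilinear_alternating.
  rewrite -/(a i) mulrCA -mulrBr normrM ger0_norm ?exprn_ge0// ler_wpM2l ?exprn_ge0//.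
  rewrite !Rint_cube -RintZ; last by apply: L1_cube => // x; exact: WK.
  have L1' : L1 (lebesgue_rV R m) (fun x => \1_(@cube R m) x * (\1_E (subcube n (a i) x) * W (subcube n (a i) x))).
    by apply: (@L1_cube _ _ _ (K * C)) => // x; exact: EW.
  have L2' : L1 (lebesgue_rV R m) (fun x => (z i)%:~R * (\1_(@cube R m) x * W (subcube n (a i) x))).
    by apply: L1Z; apply: (@L1_cube _ _ _ (K * C)) => // x; exact: WK.
  rewrite -RintB// (le_trans (Rint_abs (L1B L1' L2')))//; apply: Rint_le.
  - exact: L1_norm (L1B L1' L2').
  - apply: (@L1_cube _ _ _ (`|4 * K * C| * 1)); last by move=> x; rewrite normrM ler_wpM2l.
    by apply: measurable_funM => //; apply: (measurableT_comp mer); exact: measurable_subcube.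
  move=> x; rewrite (mulrCA (_%:~R)) -mulrBr normrM -mulrBl normrM.
  have [xc|xc] := pselect (@cube R m x); last by rewrite indicE memNset// normr0 !mul0r.
  rewrite indicE mem_set// normr1 !mul1r.
  set y := subcube n (a i) x.
  have d : `|ps y - ps (a i)| <= 4^-1.
    apply: le_trans (HL _ _) _; apply: le_trans nL; rewrite ler_wpM2l//.
    rewrite /y /subcube addrC addKr normrZ ger0_norm// ler_piMr//; apply/norm_rV_le => // j.
    by have /andP[? ?] := xc j; rewrite ger0_norm.
  have -> : 4 * K * C * er y = (4 * er y) * (K * C) by ring.
  apply: ler_pM; [exact: normr_ge0|exact: normr_ge0| |exact: WK].
  move: d; rewrite /er /err /z indicE ler_norml => /andP[d1 d2].
  have /andP[q0 q1] := tps.2 y.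
  case: (y \in E) => /=; case: ifPn; rewrite -?ltNge => h.
  - by rewrite subrr normr0 mulr_ge0.
  - rewrite subr0 normr1 distrC ger0_norm ?subr_ge0//; lra.
  - rewrite sub0r normrN normr1 subr0 ger0_norm//; lra.
  - by rewrite subr0 normr0 mulr_ge0.
have me4 : measurable_fun setT (fun x : borel R m => 4 * K * C * er x) by exact: measurable_funM.
have := HS (fun x => 4 * K * C * er x) (`|4 * K * C| * 1) me4 (fun x => _).
rewrite (big_nth 0) big_mkord => <-; last by move=> x; rewrite normrM ler_wpM2l.
rewrite Rint_cube (_ : (fun x => _) = (fun x => (4 * K * C) * (\1_(@cube R m) x * er x))); last first.
  by apply/funext => x; rewrite mulrCA.
rewrite RintZ; last exact: L1_cube er1.
have -> : \int[lebesgue_rV R m]_x (\1_(@cube R m) x * er x) = Ex er.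
  by apply: eq_Rintegral => x _; rewrite mulrC ger0_norm// indicE.
rewrite mulrAC ler_wpM2r//.
apply: (@le_trans _ _ ((4 * K) * (e / (4 * K + 1)))).
  by rewrite ler_wpM2l ?mulr_ge0//; exact: ltW.
have h : 0 < 4 * K + 1 by rewrite ltr_wpDl// mulr_ge0.
rewrite mulrCA; apply: ler_piMr; first exact: ltW.
by rewrite ler_pdivrMr// mul1r lerDl.
Qed.
End bform.

(** * Coefficients of rectifiable currents *)

Section null.
Context d (T : measurableType d) (R : realType) (mu : {measure set T -> \bar R}).
Local Notation I f := (\int[mu]_x f x).

Lemma Rint_null (Z : set T) (f g : T -> R) : measurable Z -> mu Z = 0%E ->
  measurable_fun setT f -> measurable_fun setT g -> (forall x, ~ Z x -> f x = g x) -> I f = I g.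
Proof.
move=> mZ Z0 mf mg fg; rewrite /Rintegral; congr fine; apply: ae_eq_integral => //.
- exact/measurable_EFinP.
- exact/measurable_EFinP.
- exists Z; split => // x /= /not_implyP[_ H]; apply: contrapT => /fg E; apply: H; by rewrite E.
Qed.

Lemma measurable_neq0 (f : T -> R) : measurable_fun setT f -> measurable [set x | f x != 0].
Proof.
move=> mf; rewrite (_ : [set x | _] = f @^-1` (~` [set 0])); last first.
  by apply/seteqP; split => x /= /eqP.
rewrite -[X in measurable X]setTI; apply: mf => //; exact: measurableC.
Qed.

Lemma Rint_abs0_null (f : T -> R) : L1 mu f -> I (fun x => `|f x|) = 0 -> mu [set x | f x != 0] = 0%E.
Proof.
move=> Lf If; have mf := L1_meas Lf.
apply: measure_negligible; first exact: measurable_neq0.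
have := iffLR (ae_eq_integral_abs mu measurableT (f := EFin \o f) _).
have mEf : measurable_fun setT (EFin \o f) by exact/measurable_EFinP.
move=> /(_ mEf) H.
have [] := H; first by have /= <- := EFin_Rint (L1_norm Lf); rewrite If.
move=> Z [mZ Z0 HZ]; exists Z; split => // x /= fx; apply: HZ => /= /(_ Logic.I) [] E.
by move: fx; rewrite E eqxx.
Qed.

Lemma L1_indicM (A : set T) (f : T -> R) : measurable A -> L1 mu f -> L1 mu (fun x => \1_A x * f x).
Proof.
move=> mA; apply: (@L1M _ _ _ _ _ _ 1); first exact: measurable_indic.
by move=> x; rewrite indicE; case: (_ \in _); rewrite /= ?normr1 ?normr0.
Qed.

(** The sum [g] of the successive differences has integral at most [K], so it is finite off a null
    set [Z]. There the sequence converges, and its distance from the first term is dominated by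
    [g]. *)
Lemma L1_complete (u : nat -> T -> R) (K : R) : 0 <= K -> (forall j, L1 mu (u j)) ->
  (forall j, I (fun x => `|u j x - u j.+1 x|) <= K / (2 ^ j.+1)%:R) ->
  exists2 a, L1 mu a & forall e : R, 0 < e -> exists J, forall j, (J <= j)%N ->
    I (fun x => `|u j x - a x|) <= e.
Proof.
move=> K0 Lu Hu; pose D j x := `|u j x - u j.+1 x|.
have LD j : L1 mu (D j) by apply: L1_norm; exact: L1B.
have D0 j x : (0 <= (D j x)%:E)%E by rewrite lee_fin normr_ge0.
pose g x : \bar R := (\sum_(0 <= j <oo) (D j x)%:E)%E.
have mg : measurable_fun setT g.
  apply: (@ge0_emeasurable_sum _ _ _ _ (fun j x => (D j x)%:E) xpredT) => [j x _ _|j _]; first exact: D0.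
  by apply/measurable_EFinP; exact: L1_meas.
have g0 x : (0 <= g x)%E by apply: nneseries_ge0 => j _ _; exact: D0.
have Ig : (\int[mu]_x g x <= K%:E)%E.
  rewrite integral_nneseries//; last first.
    by move=> j; apply/measurable_EFinP; exact: L1_meas.
  apply: le_trans (epsilon_trick0 xpredT K0).
  apply: lee_nneseries => [j _ _|j _]; first by apply: integral_ge0 => x _; exact: D0.
  by rewrite -EFin_Rint// lee_fin; exact: Hu.
have gint : mu.-integrable setT g.
  apply/integrableP; split => //; apply: le_lt_trans (ltry K).
  by under eq_integral do rewrite gee0_abs//.
pose Z := [set x | g x = +oo%E].
have mZ : measurable Z.
  rewrite (_ : Z = setT `&` g @^-1` [set +oo%E]); last by rewrite setTI.
  exact: mg.
have Z0 : mu Z = 0%E.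
  apply: (measure_negligible mZ).
  have [N [mN N0 HN]] := integrable_ae measurableT gint.
  by exists N; split => // x /= Zx; apply: HN => /= /(_ Logic.I); rewrite Zx.
(* Put to 0 on [Z], the functions converge at every point, and [a] can be defined as a pointwise
   limit. *)
pose v j x := \1_(~` Z) x * u j x.
have mv j : measurable_fun setT (v j).
  apply: measurable_funM; last exact: L1_meas.
  by apply: measurable_indic; exact: measurableC.
have gf x : ~ Z x -> g x \is a fin_num by move=> Zx; rewrite ge0_fin_numE// ltey; apply/eqP.
have psum x n : ~ Z x -> \sum_(0 <= j < n) D j x <= fine (g x).
  move=> Zx; rewrite -lee_fin fineK ?gf// -sumEFin /g.
  exact: nneseries_lim_ge.
pose G x := \1_(~` Z) x * fine (g x).
have LG : L1 mu G.
  apply: (@le_integrable _ _ _ mu _ measurableT _ g _ _ gint).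
    apply/measurable_EFinP; apply: measurable_funM; first by apply: measurable_indic; exact: measurableC.
    apply: measurableT_comp => //.
  move=> x _; rewrite /G /= indicE; have [Zx|Zx] := pselect (Z x).
    by rewrite memNset ?mul0r ?normr0 ?abse_ge0// => /(_ Zx).
  rewrite mem_set// mul1r [X in (_ <= X)%E]gee0_abs// -[X in (_ <= X)%E]fineK ?gf//.
  by rewrite lee_fin ger0_norm// fine_ge0.
have vG j x : `|v 0%N x - v j x| <= G x.
  rewrite /v /G indicE; have [Zx|Zx] := pselect (Z x).
    by rewrite memNset ?mul0r ?subrr ?normr0// => /(_ Zx).
  rewrite mem_set// !mul1r; apply: le_trans (psum x j Zx).
  elim: j => [|j IH]; first by rewrite subrr normr0 big_geq.
  rewrite big_nat_recr//=; apply: le_trans (lerD IH (lexx _)).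
  by apply: le_trans (ler_normD _ _); rewrite addrA subrK.
have cv x : cvgn (v ^~ x).
  have [Zx|Zx] := pselect (Z x).
    rewrite (_ : v^~ x = fun=> 0); first exact: is_cvg_cst.
    by apply/funext => j; rewrite /v indicE memNset ?mul0r// => /(_ Zx).
  have E : v^~ x = (fun j => v 0%N x + series (fun j => v j.+1 x - v j x) j).
    apply/funext => j; elim: j => [|j IH]; first by rewrite /series /= big_geq// addr0.
    by rewrite /series/= big_nat_recr//= addrA -IH addrC subrK.
  rewrite E; apply: is_cvgD; first exact: is_cvg_cst.
  apply: normed_cvg; apply: nondecreasing_is_cvgn.
    by apply: nondecreasing_series => j _ _ /=.
  exists (fine (g x)) => _ [j _ <-]; apply: le_trans (psum x j Zx).
  rewrite /series/=; apply: ler_sum => i _.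
  by rewrite /v /D indicE mem_set// !mul1r distrC.
pose a x := limn (v^~ x).
have va x : v j x @[j --> \oo] --> a x by exact: cv.
have Lv j : L1 mu (v j) by apply: L1_indicM => //; exact: measurableC.
have ma : measurable_fun setT a by apply: (measurable_fun_cvg mv) => x _; exact: va.
have avG x : `|v 0%N x - a x| <= G x.
  apply: (closed_cvg (fun y : R => y <= G x) (@closed_le R (G x)) _ _ (cvg_norm (cvgB (cvg_cst (v 0%N x)) (va x)))).
  by apply: nearW => j; exact: vG.
have LA : L1 mu a.
  apply: (@L1_ext _ _ _ _ (fun x => v 0%N x - (v 0%N x - a x))) => [x|]; first by rewrite subKr.
  apply: L1B => //; apply: (L1_le _ _ LG); first by apply: measurable_funB.
  by move=> x; rewrite [X in _ <= X]ger0_norm//; apply: le_trans (avG x).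
exists a => // e e0.
have h1 j : measurable_fun setT (fun x => `|v j x - a x|).
  by apply: measurableT_comp => //; exact: measurable_funB.
have h2 x : `|v j x - a x| @[j --> \oo] --> (0 : R).
  rewrite -[X in _ --> X](@normr0 _ R) -(subrr (a x)).
  by apply: cvg_norm; apply: cvgB; [exact: va|exact: cvg_cst].
have h3 j x : `| `|v j x - a x| | <= G x + G x.
  rewrite normr_id (_ : v j x - a x = (v 0%N x - a x) - (v 0%N x - v j x)); last by ring.
  by apply: le_trans (ler_normB _ _) _; rewrite lerD.
have [_] := Rint_dominated h1 h2 h3 (L1D LG LG).
rewrite Rint0 => /cvgrPdist_le/(_ e e0) [J _ HJ]; exists J => j /HJ /=.
rewrite sub0r normrN => H.
rewrite (@Rint_null Z _ (fun x => `|v j x - a x|))//.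
- by apply: le_trans H; exact: ler_norm.
- by apply: measurableT_comp => //; apply: measurable_funB => //; exact: L1_meas.
- by move=> x Zx; rewrite /v indicE mem_set// mul1r.
Qed.
End null.

Section coefs.
Variables (R : realType) (m N : nat).
Local Notation dform := (dform R m N).
Local Notation functional := (functional R m N).
Local Notation S := {ffun 'I_m -> 'I_N}.

(* Test and Borel forms are sums of these, so a current is determined by its values on them. *)
Definition pdx (p : 'rV[R]_N -> R) (s : S) : dform := fun x v => p x * dxf s v.

Lemma bform_pdx p s (D : R) : measurable_fun setT (p : borel R N -> R) -> (forall x, `|p x| <= D) ->
  bform (pdx p s) (D * (m`!)%:R).
Proof.
move=> mp pD; split=> [x|t|x t].
- exact/alternatingZ/alternating_dxf.
- by apply: measurable_funM.
- rewrite /pdx normrM ler_pM// (le_trans (@dxf_le _ _ _ _ _ 1 _ _))// ?expr1n ?mulr1//.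
  by move=> i j; rewrite basis_frameE; case: (_ == _); rewrite /= ?normr1 ?normr0.
Qed.

Lemma test_form_bform (w : dform) : test_form w -> exists2 C : R, 0 <= C & bform w C.
Proof.
move=> tw; have [aw sw _] := tw.
have /choice[M HM] : forall s : S, exists M : R, 0 < M /\ forall x, `|w x (basis_frame R s)| <= M.
  by move=> s; have [M M0 HM] := testfun_bounded (test_form_testfun (basis_frame R s) tw); exists M.
exists (\sum_s M s); first by apply: sumr_ge0 => s _; have [/ltW] := HM s.
split=> // [s|x s].
  apply: continuous_measurable_borel; exact: testfun_cont (test_form_testfun (basis_frame R s) tw).
rewrite (bigD1 s)//=; apply: (@le_trans _ _ (M s)); first by have [_] := HM s; apply.
by rewrite lerDl; apply: sumr_ge0 => t _; have [/ltW] := HM t.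
Qed.

Lemma bform_expand (w : dform) C : bform w C ->
  w = fun x v => (m`!)%:R^-1 * \sum_s w x (basis_frame R s) * dxf s v.
Proof. by move=> [aw _ _]; apply/funext => x; apply/funext => v; exact: alternating_dxf_expand. Qed.

Lemma L1_pull (f : 'rV[R]_m -> 'rV[R]_N) (w : dform) C : lipschitz f -> bform w C ->
  L1 (lebesgue_rV R m) (fun x => \1_(@cube R m) x * w (f x) (partials f x)).
Proof.
move=> lf bw; have [K K0 HK] := pull_le lf; apply: (@L1_cube _ _ _ (K * C)).
  exact: measurable_pull bw.
by move=> x; exact: HK.
Qed.

Lemma bform_coef (w : dform) C (s : S) : bform w C ->
  bform (pdx (fun x => w x (basis_frame R s)) s) (C * (m`!)%:R).
Proof. by move=> [_ mw wC]; exact: bform_pdx. Qed.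

Lemma cube_current_expand (f : 'rV[R]_m -> 'rV[R]_N) (w : dform) C : lipschitz f -> bform w C ->
  cube_current f w = (m`!)%:R^-1 * \sum_s cube_current f (pdx (fun x => w x (basis_frame R s)) s).
Proof.
move=> lf bw; rewrite cube_currentE Rint_cube.
rewrite (eq_bigr (fun s => \int[lebesgue_rV R m]_x (\1_(@cube R m) x * pdx (fun x => w x (basis_frame R s)) s (f x) (partials f x)))); last first.
  by move=> s _; rewrite cube_currentE Rint_cube.
rewrite -Rint_sum; last by move=> s; exact: L1_pull (bform_coef s bw).
rewrite -RintZ; last by apply: L1_sum => s; exact: L1_pull (bform_coef s bw).
apply: eq_Rintegral => x _; rewrite [in LHS](bform_expand bw) mulrCA; congr (_ * _).
by rewrite mulr_sumr.
Qed.

Lemma chain_expand p (z : 'I_p -> int) (f : 'I_p -> 'rV[R]_m -> 'rV[R]_N) (w : dform) C :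
  (forall i, lipschitz (f i)) -> bform w C ->
  lipschitz_chain z f w = (m`!)%:R^-1 * \sum_s lipschitz_chain z f (pdx (fun x => w x (basis_frame R s)) s).
Proof.
move=> lf bw; rewrite /lipschitz_chain exchange_big mulr_sumr; apply: eq_bigr => i _ /=.
by rewrite (cube_current_expand (lf i) bw) -mulr_sumr mulrCA.
Qed.

Lemma current_linear (Q : functional) (c : R) w e : is_current Q -> test_form w -> test_form e ->
  Q (fun x v => c * w x v + e x v) = c * Q w + Q e.
Proof. by move=> [+ _]; exact. Qed.

Lemma current0 (Q : functional) : is_current Q -> Q (fun _ _ => 0) = 0.
Proof.
move=> cQ; have := current_linear 1 cQ (test_form0 R m N) (test_form0 R m N).
have -> : (fun=> fun=> 1 * 0 + 0) = (fun=> fun=> 0) :> dform.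
  by apply/funext => x; apply/funext => v; rewrite mulr0 addr0.
by rewrite mul1r => /esym H; apply: (addrI (Q (fun=> fun=> 0))); rewrite addr0.
Qed.

Lemma currentZ (Q : functional) (c : R) w : is_current Q -> test_form w ->
  Q (fun x v => c * w x v) = c * Q w.
Proof.
move=> cQ tw; have := current_linear c cQ tw (test_form0 R m N); rewrite current0// addr0 => <-.
by congr Q; apply/funext => x; apply/funext => v; rewrite addr0.
Qed.

Lemma test_form_sum I (r : seq I) (w : I -> dform) : (forall i, test_form (w i)) ->
  test_form (fun x v => \sum_(i <- r) w i x v).
Proof.
move=> tw; elim: r => [|i r IH].
  rewrite (_ : (fun x v => _) = (fun _ _ => 0)); first exact: test_form0.
  by apply/funext => x; apply/funext => v; rewrite big_nil.
have := test_form_lin 1 (tw i) IH; congr test_form.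
by apply/funext => x; apply/funext => v; rewrite big_cons mul1r.
Qed.

Lemma current_sum (Q : functional) I (r : seq I) (w : I -> dform) : is_current Q -> (forall i, test_form (w i)) ->
  Q (fun x v => \sum_(i <- r) w i x v) = \sum_(i <- r) Q (w i).
Proof.
move=> cQ tw; elim: r => [|i r IH].
  rewrite big_nil -[RHS](current0 cQ); congr Q.
  by apply/funext => x; apply/funext => v; rewrite big_nil.
rewrite big_cons -IH -[X in X + _]mul1r -current_linear//; last exact: test_form_sum.
by congr Q; apply/funext => x; apply/funext => v; rewrite big_cons mul1r.
Qed.

Lemma test_form_pdx p s : testfun p -> test_form (pdx p s).
Proof. exact: test_form_dxf. Qed.

Lemma current_expand (Q : functional) (w : dform) : is_current Q -> test_form w ->
  Q w = (m`!)%:R^-1 * \sum_s Q (pdx (fun x => w x (basis_frame R s)) s).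
Proof.
move=> cQ tw; have ts s := test_form_pdx s (test_form_testfun (basis_frame R s) tw).
have [C _ bw] := test_form_bform tw.
rewrite -current_sum// -currentZ//; last exact: test_form_sum.
by congr Q; exact: bform_expand bw.
Qed.

(** The form is scaled by both signs of [1 / (c * m!)] to have comass at most 1, [m!] being a bound
    for [dxf s] on orthonormal frames. Homogeneity is assumed along multiples of [dxf s] so that the
    lemma applies to the difference of a current and a chain. *)
Lemma mass_pairing (D : functional) (e c : R) p s :
  (forall (r : R) p, testfun p -> D (pdx (fun x => r * p x) s) = r * D (pdx p s)) ->
  (mass D <= e%:E)%E -> testfun p -> 0 < c -> (forall x, `|p x| <= c) ->
  `|D (pdx p s)| <= c * (m`!)%:R * e.
Proof.
move=> lD mD tp c0 pc.
have k0 : 0 < c * (m`!)%:R by rewrite mulr_gt0// ltr0n fact_gt0.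
set k := c * _ in k0 *.
have H (r : R) : `|r| = k^-1 -> r * D (pdx p s) <= e.
  move=> rk; rewrite -lD// -lee_fin; apply: le_trans mD; apply: ereal_sup_ubound.
  exists (pdx (fun x => r * p x) s) => //; split=> //.
    by apply: test_form_pdx; apply: testfunMl => //; exact: smooth_cst.
  move=> x v ov; rewrite /pdx !normrM rk -mulrA ler_pdivrMl// mulr1 /k ler_pM//.
  by rewrite (le_trans (@dxf_le _ _ _ _ _ 1 _ _))// ?expr1n ?mulr1// => i j; exact: orthonormal_le1.
have r0 : 0 <= k^-1 by rewrite invr_ge0 ltW.
rewrite ler_norml; apply/andP; split.
  have := H (- k^-1); rewrite normrN ger0_norm// => /(_ erefl).
  by rewrite mulNr lerNl ler_pdivlMl// mulrN.
have := H k^-1; rewrite ger0_norm// => /(_ erefl).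
by rewrite -ler_pdivlMl ?invr_gt0// invrK.
Qed.

Variable mu : {measure set (borel R N) -> \bar R}.
Local Notation I f := (\int[mu]_x f x).

(* C is integration against c, also on Borel forms. *)
Definition coef (C : functional) (c : S -> borel R N -> R) :=
  (forall s, L1 mu (c s)) /\
  forall s (p : borel R N -> R) (D : R), measurable_fun setT p -> (forall x, `|p x| <= D) ->
    C (pdx p s) = I (fun x => p x * c s x).

Lemma coef_chain p (z : 'I_p -> int) (f : 'I_p -> 'rV[R]_m -> 'rV[R]_N) (b : 'I_p -> S -> borel R N -> R) :
  (forall i, coef (cube_current (f i)) (b i)) ->
  coef (lipschitz_chain z f) (fun s x => \sum_i (z i)%:~R * b i s x).
Proof.
move=> H; split=> [s|s q D mq qD].
  by apply: L1_sum => i; apply: L1Z; have [] := H i.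
have L i : L1 mu (fun x => q x * b i s x) by apply: (L1M mq qD); have [] := H i.
rewrite /lipschitz_chain.
rewrite (eq_bigr (fun i => I (fun x => (z i)%:~R * (q x * b i s x)))) => [|i _]; last first.
  by rewrite RintZ//; congr (_ * _); have [_] := H i; apply; eassumption.
rewrite -Rint_sum; last by move=> i; exact: L1Z.
by apply: eq_Rintegral => x _; rewrite mulr_sumr; apply: eq_bigr => i _; rewrite mulrCA.
Qed.

Lemma coefZ C c s (r : R) p D : coef C c -> measurable_fun setT (p : borel R N -> R) -> (forall x, `|p x| <= D) ->
  C (pdx (fun x => r * p x) s) = r * C (pdx p s).
Proof.
move=> [Lc H] mp pD; rewrite (H s p D)// (H s _ (`|r| * D)) => [||x]; last first.
- by rewrite normrM ler_wpM2l.
- exact: measurable_funM.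
rewrite -RintZ; last exact: (L1M mp pD).
by apply: eq_Rintegral => x _; rewrite mulrA.
Qed.

(* Mass bounds the L^1 norm of the differences c (j+1) - c j, so the coefficients converge. *)
Lemma rectifiable_coef (Q : functional) (C : nat -> functional) (c : nat -> S -> borel R N -> R) :
  is_current Q -> (forall j, coef (C j) (c j)) ->
  (forall j, (mass (fun w => Q w - C j w)%R <= ((2 ^ j.+1)%:R^-1)%:E)%E) ->
  exists a : S -> borel R N -> R,
    [/\ forall s, L1 mu (a s),
      forall s p, testfun p -> Q (pdx p s) = I (fun x => p x * a s x) &
      forall e : R, 0 < e -> exists J, forall j, (J <= j)%N -> forall s, I (fun x => `|c j s x - a s x|) <= e].
Proof.
move=> cQ Hc mQ.
have Lc j s : L1 mu (c j s) by have [] := Hc j.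
have HD j s p (D : R) : testfun p -> 0 < D -> (forall x, `|p x| <= D) ->
    `|Q (pdx p s) - I (fun x => p x * c j s x)| <= D * (m`!)%:R * (2 ^ j.+1)%:R^-1.
  move=> tp D0 pD; have mp : measurable_fun setT (p : borel R N -> R) by exact: testfun_measurable.
  have [_ /(_ s p D mp pD) <-] := Hc j.
  apply: (@mass_pairing (fun w => Q w - C j w)) => // r q tq.
  have [M _ qM] := testfun_bounded tq.
  have mq : measurable_fun setT (q : borel R N -> R) by exact: testfun_measurable.
  rewrite (coefZ _ _ (Hc j) mq qM) mulrBr; congr (_ - _).
  rewrite -currentZ//; last exact: test_form_pdx.
  by congr Q; apply/funext => x; apply/funext => v; rewrite /pdx mulrA.
(* The mass bounds at [j] and [j+1] give at most [2 * m! / 2^(j+1)] on test functions, and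
   [bounded_pairing_norm] doubles this. *)
have st s j : I (fun x => `|c j s x - c j.+1 s x|) <= 4 * (m`!)%:R / (2 ^ j.+1)%:R.
  set d := (2 ^ j.+1)%:R^-1 : R.
  have := @bounded_pairing_norm _ _ mu (fun x => c j s x - c j.+1 s x) (2 * (m`!)%:R * d) (L1B (Lc j s) (Lc j.+1 s)).
  rewrite (_ : 2 * (m`!)%:R * d + 2 * (m`!)%:R * d = 4 * (m`!)%:R * d); last by ring.
  apply => p [tp p01].
  have p1 x : `|p x| <= 1 by have /andP[? ?] := p01 x; rewrite ger0_norm.
  have mp : measurable_fun setT (p : borel R N -> R) by exact: testfun_measurable.
  rewrite (@eq_Rintegral _ _ _ mu _ (fun x => p x * c j s x - p x * c j.+1 s x)); last by move=> x _; rewrite mulrBr.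
  rewrite RintB; [|exact: (L1M mp p1 (Lc j s))|exact: (L1M mp p1 (Lc j.+1 s))].
  have := HD j s p 1 tp ltr01 p1; have := HD j.+1 s p 1 tp ltr01 p1.
  rewrite !mul1r -/d => H1 H2.
  have d' : (2 ^ j.+2)%:R^-1 <= d.
    by rewrite /d lef_pV2 ?posrE ?ltr0n ?expn_gt0// ler_nat leq_exp2l.
  have {}H1 := le_trans H1 (ler_wpM2l (ler0n R (m`!)) d').
  rewrite -(subrKA (Q (pdx p s))) (le_trans (ler_normD _ _))//.
  by rewrite [X in _ <= X](_ : _ = (m`!)%:R * d + (m`!)%:R * d); [rewrite distrC in H2; exact: lerD|ring].
have /choice[a Ha] : forall s, exists a, L1 mu a /\ forall e : R, 0 < e -> exists J, forall j, (J <= j)%N ->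
    I (fun x => `|c j s x - a x|) <= e.
  move=> s; have [|a La Ha] := @L1_complete _ _ _ mu (fun j => c j s) (4 * (m`!)%:R) _ (fun j => Lc j s) (st s).
    by rewrite mulr_ge0.
  by exists a.
have Ha2 e : 0 < e -> exists J, forall j, (J <= j)%N -> forall s, I (fun x => `|c j s x - a s x|) <= e.
  move=> e0; have /choice[J HJ] : forall s, exists J, forall j, (J <= j)%N -> I (fun x => `|c j s x - a s x|) <= e.
    by move=> s; have [_ /(_ e e0)] := Ha s.
  exists (\max_s J s) => j Jj s; apply: HJ; apply: leq_trans Jj; exact: leq_bigmax.
have La s : L1 mu (a s) by have [] := Ha s.
exists a; split => // s p tp.
have [D D0 pD] := testfun_bounded tp.
have mp : measurable_fun setT (p : borel R N -> R) by exact: testfun_measurable.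
apply/eqP; rewrite -subr_eq0 -normr_le0; apply/ler_addgt0Pl => e e0; rewrite addr0.
(* Collects the two errors: [D * m!] for the mass of [Q - C j], and [D] for the [L^1] distance
   between the coefficients. *)
pose k := D * (m`!)%:R + D.
have k0 : 0 < k by rewrite ltr_wpDl// mulr_ge0// ltW.
have ek : 0 < e / k by rewrite divr_gt0.
have [J HJ] := Ha2 _ ek.
pose j := maxn J (Num.truncn (e / k)^-1).
have je : (2 ^ j.+1)%:R^-1 <= e / k.
  rewrite invf_ple ?posrE ?ltr0n ?expn_gt0//; apply: le_trans (ltW (truncnS_gt _)) _.
  rewrite ler_nat; apply: leq_trans (ltnW (ltn_expl _ (ltnSn 1))).
  by rewrite ltnS leq_maxr.
have Lpc : L1 mu (fun x => p x * c j s x) by exact: (L1M mp pD).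
have Lpa : L1 mu (fun x => p x * a s x) by exact: (L1M mp pD).
rewrite -(subrKA (I (fun x => p x * c j s x))) (le_trans (ler_normD _ _))//.
have -> : e = D * (m`!)%:R * (e / k) + D * (e / k).
  by rewrite -mulrDl -/k mulrCA divff ?mulr1// gt_eqF.
apply: lerD.
  apply: le_trans (HD j s p D tp D0 pD) _; apply: ler_wpM2l => //.
  by rewrite mulr_ge0// ltW.
rewrite -RintB// (le_trans (Rint_abs (L1B Lpc Lpa)))//.
apply: (@le_trans _ _ (D * I (fun x => `|c j s x - a s x|))); last first.
  by apply: ler_wpM2l; [exact: ltW|apply: HJ; exact: leq_maxl].
have Ld : L1 mu (fun x => `|c j s x - a s x|) by apply: L1_norm; exact: L1B.
rewrite -RintZ//; apply: Rint_le; [exact: L1_norm (L1B Lpc Lpa)|exact: L1Z|].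
by move=> x; rewrite -mulrBr normrM ler_wpM2r.
Qed.

End coefs.

(** * Localization and gluing *)

Section cover.
Variables (R : realType) (m N : nat).

(* The cutoffs are plateaus at balls with rational centres and radii, hence countably many. *)
Lemma locality_cover (T : functional R m N) : loc_rectifiable T ->
  exists (chi : nat -> 'rV[R]_N -> R) (Q : nat -> functional R m N),
  [/\ forall i, test01 (chi i), forall i, rectifiable (Q i),
     forall i w, test_form w -> T (fun x v => chi i x * w x v) = Q i (fun x v => chi i x * w x v) &
     forall x : 'rV[R]_N, exists i, nbhs x [set y | chi i y = 1]].
Proof.
move=> [cT lT].
pose cen (q : 'rV[rat]_N * rat) : 'rV[R]_N := map_mx ratr q.1.
pose rad (q : 'rV[rat]_N * rat) : R := ratr q.2.
(* A plateau equal to 1 on the ball of radius [rad q] is supported in the ball of twice that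
   radius. *)
pose good q := 0 < rad q /\ exists2 Q : functional R m N, rectifiable Q &
  forall w, test_form w -> (forall x, form_supp w x -> `|x - cen q| <= 2 * rad q) -> T w = Q w.
have [Q0 [rQ0 _]] := lT 0.
have /choice[h Hh] : forall q, exists cQ : ('rV[R]_N -> R) * functional R m N,
    [/\ test01 cQ.1, rectifiable cQ.2,
      forall w, test_form w -> T (fun x v => cQ.1 x * w x v) = cQ.2 (fun x v => cQ.1 x * w x v) &
      good q -> forall y, `|y - cen q| < rad q -> cQ.1 y = 1].
  move=> q; have [gq|ngq] := pselect (good q).
    have [r0 [Q rQ HQ]] := gq; exists (plateau (cen q) (rad q), Q); split=> //=.
    - split; first exact: testfun_plateau.
      by move=> x; rewrite plateau_ge0 plateau_le1.
    - move=> w tw; apply: HQ.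
        by apply: test_formM => //; exact: smooth_plateau.
      apply: form_supp_sub_closed; first exact: (@closed_cball R N).
      move=> x v H; apply: plateau_supp => //; apply: contra_neq H => ->; by rewrite mul0r.
    - by move=> _ y /ltW; exact: plateau1.
  (* For the remaining indices the cutoff is 0, and any rectifiable current agrees with [T] on the
     zero form. *)
  exists (fun=> 0, Q0); split=> //=.
  - by split=> [|x]; [exact: testfun0|rewrite lexx ler01].
  - move=> w tw; have -> : (fun x v => 0 * w x v) = (fun=> fun=> 0).
      by apply/funext => x; apply/funext => v; rewrite mul0r.
    by rewrite current0// current0//; have [] := rQ0.
pose g (i : nat) := odflt (0, 0) (@unpickle ('rV[rat]_N * rat)%type i).
exists (fun i => (h (g i)).1), (fun i => (h (g i)).2); split=> [i|i|i w tw|x].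
- by have [] := Hh (g i).
- by have [] := Hh (g i).
- by have [_ _ + _] := Hh (g i); exact.
have [Q [rQ [U [oU Ux HU]]]] := lT x.
have /nbhs_ballP[e /= e0 eU] : nbhs x U by apply: open_nbhs_nbhs.
(* The rational centre is taken within half the radius of [x]. The support of the plateau then stays
   within 5/2 of the radius from [x], which is less than [e], while the plateau is 1 on a ball about
   [x]. *)
have e3 : 0 < e / 3 by rewrite divr_gt0.
have [r0 rI] := rat_in_itvoo e3.
move: rI; rewrite in_itv/= => /andP[r0p r0e].
have r2 : 0 < ratr r0 / 2 :> R by rewrite divr_gt0.
have /choice[c Hc] : forall i, exists q : rat, `|x 0 i - ratr q| <= ratr r0 / 2.
  move=> i; have lt : x 0 i - ratr r0 / 2 < x 0 i by rewrite ltrBlDr ltrDl.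
  have [q] := rat_in_itvoo lt; rewrite in_itv/= => /andP[q1 q2].
  by exists q; rewrite ger0_norm ?subr_ge0 ?ltW//; lra.
pose q := (\row_i c i, r0) : 'rV[rat]_N * rat.
have xq : `|x - cen q| <= ratr r0 / 2.
  by apply/norm_rV_le => [|i]; [exact: ltW|rewrite !mxE; exact: Hc].
have gq : good q.
  split => //; exists Q => // w tw ws; apply: HU => // y /ws yc; apply: eU.
  rewrite -ball_normE /ball_ /= distrC -(subrKA (cen q)).
  apply: (le_lt_trans (ler_normD _ _)); rewrite [X in _ + X]distrC.
  apply: (le_lt_trans (lerD yc xq)); rewrite /rad /=; lra.
exists (pickle q); rewrite /g pickleK /=.
have [_ _ _ /(_ gq) H] := Hh q.
have F := nbhs_filter x.
apply: filterS (nbhsx_ballx x _ r2) => y xy; apply: H.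
move: xy; rewrite -ball_normE /ball_ /= => xy.
rewrite -(subrKA x); apply: (le_lt_trans (ler_normD _ _)).
rewrite distrC; apply: (lt_le_trans (ltr_leD xy xq)); rewrite /rad /=; lra.
Qed.

End cover.

Section dominate.
Variables (R : realType) (m N : nat) (F : nat -> 'rV[R]_m -> 'rV[R]_N).
Hypothesis lF : forall r, lipschitz (F r).
Let mF r : measurable_fun setT (F r : borel R m -> borel R N) := measurable_lip (lF r).

Definition lip_measure : {measure set (borel R N) -> \bar R} := dom_measure mF.

Lemma lip_measure_fin : (lip_measure setT < +oo)%E.
Proof. by rewrite ltey_eq; apply/orP; left; exact: dom_measure_fin. Qed.

Lemma coef_lip r : exists b, coef lip_measure (cube_current (F r)) b.
Proof.
have b1 s : bform (@pdx R m N (fun=> 1) s) (1 * (m`!)%:R).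
  by apply: bform_pdx => // x; rewrite normr1.
have mJ s : measurable_fun setT (fun x : borel R m => dxf s (partials (F r) x)).
  have := measurable_pull (lF r) (b1 s); congr measurable_fun.
  by apply/funext => x; rewrite /pdx mul1r.
have [K K0 HK] := pull_le (lF r).
have JK s x : `|dxf s (partials (F r) x)| <= K * (1 * (m`!)%:R).
  by have := HK _ _ (b1 s) x; rewrite /pdx mul1r.
have /choice[b Hb] : forall s : {ffun 'I_m -> 'I_N}, exists b, L1 lip_measure b /\
    forall (p : borel R N -> R) (D : R), measurable_fun setT p ->
   (forall y, `|p y| <= D) -> cube_current (F r) (pdx p s) = \int[lip_measure]_y (p y * b y).
  move=> s; have [b Lb Hb] := RN_push mF r (mJ s) (JK s).
  exists b; split => // p D mp pD; rewrite -(Hb p D)// cube_currentE Rint_cube.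
  by apply: eq_Rintegral => x _; rewrite /pdx mulrCA.
exists b; split => [s|s p D mp pD]; first by have [] := Hb s.
by have [_] := Hb s; apply; eassumption.
Qed.
End dominate.

Section glue_coefficients.
Variables (R : realType) (m N : nat) (mu : {measure set (borel R N) -> \bar R}).
Variables (T : functional R m N) (s : {ffun 'I_m -> 'I_N}).
Variables (chi : nat -> 'rV[R]_N -> R) (A : nat -> borel R N -> R).
Hypothesis cT : is_current T.
Hypothesis chi01 : forall i, test01 (chi i).
Hypothesis chi1 : forall x : 'rV[R]_N, exists i, nbhs x [set y | chi i y = 1].
Hypothesis LA : forall i, L1 mu (A i).
Hypothesis TA : forall i p, testfun p ->
  T (pdx (fun x => chi i x * p x) s) = \int[mu]_x (chi i x * p x * A i x).
Local Notation I f := (\int[mu]_x f x).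

Let mchi i : measurable_fun setT (chi i : borel R N -> R).
Proof. by apply: continuous_measurable_borel; apply: testfun_cont; exact: (chi01 i).1. Qed.

Let chile i x : `|chi i x| <= 1.
Proof. by have [_ /(_ x)/andP[? ?]] := chi01 i; rewrite ger0_norm. Qed.

Let schi i : smooth (chi i). Proof. exact: (chi01 i).1.1. Qed.

Let meas p : testfun p -> measurable_fun setT (p : borel R N -> R).
Proof. by move=> tp; apply: continuous_measurable_borel; exact: testfun_cont. Qed.

(** Measures the disagreement of two local densities where both cutoffs are positive. It is null
    because [T] on [chi i * chi j * p] is computed by either density. *)
Let B i j (x : borel R N) := chi i x * (chi j x * (A i x - A j x)).

Let LB i j : L1 mu (B i j).
Proof. by apply: (L1M (mchi i) (chile i)); apply: (L1M (mchi j) (chile j)); exact: L1B. Qed.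

Let B0 i j : I (fun x => `|B i j x|) = 0.
Proof.
have := @bounded_pairing_norm _ _ mu (B i j) 0 (LB i j); rewrite addr0 => H.
apply/eqP; rewrite eq_le; apply/andP; split; last by apply: Rintegral_ge0 => x _.
apply: H => p [tp p01]; rewrite normr_le0.
have [D _ pD] := testfun_bounded tp.
have LM q f (C : R) : testfun q -> (forall x, `|q x| <= C) -> L1 mu f -> L1 mu (fun x => q x * f x).
  by move=> tq qC Lf; apply: (L1M (meas tq) qC Lf).
rewrite (@eq_Rintegral _ _ _ mu _ (fun x => chi i x * (chi j x * p x) * A i x - chi j x * (chi i x * p x) * A j x)); last first.
  by move=> x _; rewrite /B; ring.
have tji : testfun (fun x => chi j x * p x) by apply: testfunMl => //; exact: schi.
have tij : testfun (fun x => chi i x * p x) by apply: testfunMl => //; exact: schi.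
have bnd a b (x : 'rV[R]_N) : `|chi a x * (chi b x * p x)| <= 1 * (1 * D).
  by rewrite !normrM; do 2 (apply: ler_pM => //; rewrite ?mulr_ge0//).
rewrite RintB; last 2 first.
- by apply: (LM (fun x => chi i x * (chi j x * p x)) (A i) _ _ (bnd i j)) => //; apply: testfunMl => //; exact: schi.
- by apply: (LM (fun x => chi j x * (chi i x * p x)) (A j) _ _ (bnd j i)) => //; apply: testfunMl => //; exact: schi.
rewrite -(TA i tji) -(TA j tij) subr_eq0; apply/eqP; congr T.
by apply/funext => x; apply/funext => v; rewrite /pdx; ring.
Qed.

Let Zij i j := [set x | B i j x != 0].
Let Z := \bigcup_i \bigcup_j Zij i j.

Let mZ : measurable Z.
Proof.
apply: bigcupT_measurable => i; apply: bigcupT_measurable => j.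
by apply: measurable_neq0; exact: L1_meas.
Qed.

Let Z0 : mu Z = 0%E.
Proof.
apply: measure_negligible => //; apply: negligible_bigcup => i; apply: negligible_bigcup => j.
apply/negligibleP; first by apply: measurable_neq0; exact: L1_meas.
by apply: Rint_abs0_null; [exact: LB|exact: B0].
Qed.

Let A' i x := \1_(~` Z) x * A i x.

Let A'E i j x : chi i x * (chi j x * A' i x) = chi i x * (chi j x * A' j x).
Proof.
rewrite /A' indicE; have [Zx|Zx] := pselect (Z x).
  by rewrite memNset ?mul0r ?mulr0// => /(_ Zx).
rewrite mem_set// !mul1r; apply/eqP; rewrite -subr_eq0 -!mulrBr; apply/eqP.
by apply: contrapT => /eqP H; apply: Zx; exists i => //; exists j.
Qed.

(* The partition of unity subordinate to the cutoffs chi. *)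
Let eta i x := (\prod_(j < i) (1 - chi j x)) * chi i x.

Let sum_eta n x : \sum_(i < n) eta i x = 1 - \prod_(j < n) (1 - chi j x).
Proof.
elim: n => [|n IH]; first by rewrite !big_ord0 subrr.
by rewrite !big_ord_recr /= IH /eta; ring.
Qed.

Let sum_eta1 n i x : chi i x = 1 -> (i < n)%N -> \sum_(i < n) eta i x = 1.
Proof. by move=> c1 lin; rewrite sum_eta (bigD1 (Ordinal lin))//= c1 subrr mul0r subr0. Qed.

Let seta i : smooth (fun x => \prod_(j < i) (1 - chi j x)).
Proof.
apply: smooth_prod => j.
have := smoothD (@smooth_cst R N 1) (smoothM (@smooth_cst R N (-1)) (schi j)).
by congr smooth; apply/funext => x; rewrite mulN1r.
Qed.

Let prod_le i x : `|\prod_(j < i) (1 - chi j x)| <= 1.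
Proof.
suff /andP[? ?] : 0 <= \prod_(j < i) (1 - chi j x) <= 1 by rewrite ger0_norm.
elim/big_ind: _ => [|u v /andP[u0 u1] /andP[v0 v1]|j _]; first by rewrite ler01 lexx.
  by rewrite mulr_ge0//= mulr_ile1.
by have [_ /(_ x)/andP[? ?]] := chi01 j; apply/andP; split; lra.
Qed.

Let teta i p : testfun p -> testfun (fun x => (\prod_(j < i) (1 - chi j x)) * p x).
Proof. by move=> tp; apply: testfunMl => //; exact: seta. Qed.

(** Off [Z] the local densities agree wherever their cutoffs overlap, so the value at any index with
    [chi i x = 1] can be taken for [a x]. This index is chosen pointwise, without any measurability;
    [a] is measurable because the partial sums over the partition of unity equal it from some rank
    on. *)
Lemma glue_coefficients : exists2 a : borel R N -> R, measurable_fun setT a &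
  (forall p, testfun p -> L1 mu (fun x => p x * a x) /\ T (pdx p s) = I (fun x => p x * a x)) /\
  exists2 Z : set (borel R N), measurable Z /\ mu Z = 0%E &
    forall i x, ~ Z x -> chi i x * a x = chi i x * A i x.
Proof.
have [idx Hidx] := choice chi1.
have idx1 x : chi (idx x) x = 1 by exact: nbhs_singleton (Hidx x).
pose a (x : borel R N) : R := A' (idx x) x.
have aE i x : chi i x * a x = chi i x * A' i x.
  by have := A'E i (idx x) x; rewrite idx1 !mul1r => ->.
have mA' i : measurable_fun setT (A' i).
  by apply: measurable_funM; [apply: measurable_indic; exact: measurableC|exact: L1_meas].
have LA' i : L1 mu (A' i) by apply: L1_indicM => //; exact: measurableC.
have mprod i : measurable_fun setT (fun x : borel R N => \prod_(j < i) (1 - chi j x)).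
  by apply: measurable_prod => j _; apply: measurable_funB.
have etaA n x : \sum_(i < n) eta i x * A' i x = (\sum_(i < n) eta i x) * a x.
  rewrite mulr_suml; apply: eq_bigr => i _; by rewrite /eta -!mulrA aE.
have ma : measurable_fun setT a.
  apply: (@measurable_fun_cvg _ (borel R N) R _ (fun n x => \sum_(i < n) eta i x * A' i x)).
    move=> n; apply: measurable_sum => i; apply: measurable_funM => //; exact: measurable_funM.
  move=> x _; apply: cvg_near_cst.
  near=> n; rewrite etaA (@sum_eta1 n (idx x))// ?mul1r//.
  near: n; exact: nbhs_infty_gt.
exists a => //; split; last first.
  exists Z => // i x Zx; rewrite aE /A' indicE mem_set ?mul1r//.
move=> p tp; have [D D0 pD] := testfun_bounded tp.
(* Compactness of the support: finitely many of the open sets where a cutoff is locally 1 cover it,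
   so a finite part of the partition of unity already sums to 1 where [p] does not vanish. *)
have [n Hn] : exists n, forall x, p x != 0 -> exists2 j, (j < n)%N & chi j x = 1.
  have := tp.2; rewrite compact_cover => /(_ _ setT (fun i => [set x | chi i x = 1]°)).
  have op i : [set: nat] i -> open ([set x | chi i x = 1]°) by move=> _; exact: open_interior.
  have cov : supp1 p `<=` \bigcup_(i in [set: nat]) [set x | chi i x = 1]°.
    by move=> x _; have [i Hi] := chi1 x; exists i.
  move=> /(_ op cov)[E _ HE]; exists (\max_(i <- finmap.enum_fset E) i).+1 => x px.
  have /HE[i /= iE xi] : supp1 p x.
    by apply: contrapT => /supp1_out p0; rewrite p0 eqxx in px.
  exists i; last exact: (interior_subset xi).
  by rewrite ltnS; apply: (@leq_bigmax_seq _ (finmap.enum_fset E) xpredT id i).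
have pE x : p x = \sum_(i < n) eta i x * p x.
  have [->|px] := eqVneq (p x) 0; first by rewrite big1// => i _; rewrite mulr0.
  have [j jn cj] := Hn x px; by rewrite -mulr_suml (sum_eta1 cj jn) mul1r.
pose q i x := chi i x * ((\prod_(j < i) (1 - chi j x)) * p x).
have qE i x : q i x = eta i x * p x by rewrite /q /eta; ring.
have tq i : testfun (q i) by apply: testfunMl; [exact: schi|exact: teta].
have qD i x : `|q i x| <= D.
  rewrite /q !normrM (_ : D = 1 * (1 * D)); last by rewrite !mul1r.
  by do 2 (apply: ler_pM => //; rewrite ?mulr_ge0//).
have Lq i : L1 mu (fun x => q i x * A' i x) by exact: (L1M (meas (tq i)) (qD i)).
have paE x : p x * a x = \sum_(i < n) q i x * A' i x.
  rewrite [in LHS]pE mulr_suml; apply: eq_bigr => i _.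
  transitivity (chi i x * a x * (\prod_(j < i) (1 - chi j x) * p x)); first by rewrite /eta; ring.
  by rewrite aE /q; ring.
have -> : (fun x => p x * a x) = (fun x => \sum_(i < n) q i x * A' i x) by apply/funext => x; exact: paE.
split; first exact: L1_sum.
rewrite Rint_sum//.
transitivity (\sum_(i < n) T (pdx (q i) s)).
  rewrite -current_sum//; last by move=> i; exact: test_form_pdx.
  congr T; apply/funext => x; apply/funext => v; rewrite /pdx [in LHS]pE mulr_suml.
  by apply: eq_bigr => i _; rewrite qE.
apply: eq_bigr => i _; rewrite TA; last exact: teta.
apply: (Rint_null mZ Z0).
- by apply: measurable_funM; [exact: meas (tq i)|exact: L1_meas].
- exact: L1_meas.
- by move=> x Zx; rewrite /A' indicE mem_set// mul1r.
Unshelve. all: by end_near.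
Qed.
End glue_coefficients.

Section representation.
Variables (R : realType) (m N : nat).
Local Notation S := {ffun 'I_m -> 'I_N}.

Definition chain_data := {p : nat & (('I_p -> int) * ('I_p -> 'rV[R]_m -> 'rV[R]_N))%type}.

Definition chain_of (c : chain_data) : functional R m N := lipschitz_chain (projT2 c).1 (projT2 c).2.

(* A chain has finitely many maps; the indices beyond them give a constant map. *)
Definition chain_map (c : chain_data) (l : nat) : 'rV[R]_m -> 'rV[R]_N :=
  oapp (projT2 c).2 (fun=> 0) (insub l).

Lemma lipschitz_chain_map c l : (forall i, lipschitz ((projT2 c).2 i)) -> lipschitz (chain_map c l).
Proof.
move=> H; rewrite /chain_map; case: insubP => /= [i _ _|_]; first exact: H.
by apply: (@lipschitz_intro _ _ _ _ 0) => x y; rewrite subrr normr0 mul0r.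
Qed.

Lemma coef_chain_of (mu : {measure set (borel R N) -> \bar R}) c :
  (forall l, exists b, coef mu (cube_current (chain_map c l)) b) -> exists b, coef mu (chain_of c) b.
Proof.
move=> /choice[b Hb]; exists (fun s x => \sum_i ((projT2 c).1 i)%:~R * b i s x).
by apply: coef_chain => i; have := Hb i; rewrite /chain_map valK.
Qed.

(** The chains approximating all local pieces [Q i] involve countably many maps, so one
    [lip_measure] serves them all. On [V i] the cutoff is 1, so [a] coincides almost everywhere with
    the density of [Q i], which is an [L^1] limit of chain coefficients; this yields the last
    clause. *)
Lemma loc_rectifiable_rep (T : functional R m N) : loc_rectifiable T ->
  exists (mu : {measure set (borel R N) -> \bar R}) (a : S -> borel R N -> R) (V : nat -> set (borel R N)),
  [/\ (mu setT < +oo)%E, forall s, measurable_fun setT (a s),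
    forall s p, testfun p -> L1 mu (fun x => p x * a s x) /\ T (pdx p s) = \int[mu]_x (p x * a s x),
    (forall i, measurable (V i)) /\ (forall x, exists i, V i x) &
    forall i (e : R), 0 < e -> exists (c : chain_data) (b : S -> borel R N -> R),
      [/\ forall l, lipschitz ((projT2 c).2 l), coef mu (chain_of c) b,
        forall s, L1 mu (fun x => \1_(V i) x * (a s x - b s x)) &
        forall s, \int[mu]_x `|\1_(V i) x * (a s x - b s x)| <= e]].
Proof.
move=> lT; have [chi [Q [chi01 rQ TQ chi1]]] := locality_cover lT.
have /choice[ch Hch] : forall ij : nat * nat, exists c : chain_data, (forall l, lipschitz ((projT2 c).2 l)) /\
    (mass (fun w => Q ij.1 w - chain_of c w)%R <= ((2 ^ ij.2.+1)%:R^-1)%:E)%E.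
  move=> [i j]; have [_ H] := rQ i.
  have d0 : 0 < (2 ^ j.+1)%:R^-1 :> R by rewrite invr_gt0 ltr0n expn_gt0.
  have [p [z [f [lf Hm]]]] := H _ d0.
  by exists (existT (fun p => (('I_p -> int) * ('I_p -> 'rV[R]_m -> 'rV[R]_N))%type) p (z, f)).
(* Decodes three indices: the local piece, the precision of its chain, and the map within that
   chain. *)
pose g (r : nat) : (nat * nat) * nat := odflt ((0, 0), 0)%N (unpickle r).
pose F r := chain_map (ch (g r).1) (g r).2.
have lF r : lipschitz (F r) by apply: lipschitz_chain_map; have [] := Hch (g r).1.
pose mu := lip_measure lF.
have /choice[b Hb] : forall ij, exists b, coef mu (chain_of (ch ij)) b.
  move=> ij; apply: coef_chain_of => l.
  have := coef_lip lF (pickle (ij, l)); rewrite {2}/F /g pickleK; exact.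
have /choice[A HA] : forall i, exists A : S -> borel R N -> R,
    [/\ forall s, L1 mu (A s),
      forall s p, testfun p -> Q i (pdx p s) = \int[mu]_x (p x * A s x) &
      forall e : R, 0 < e -> exists J, forall j, (J <= j)%N -> forall s, \int[mu]_x `|b (i, j) s x - A s x| <= e].
  move=> i; apply: (@rectifiable_coef _ _ _ mu (Q i) (fun j => chain_of (ch (i, j)))).
  - by have [] := rQ i.
  - by move=> j; exact: Hb.
  - by move=> j; have [] := Hch (i, j).
have LA i s : L1 mu (A i s) by have [] := HA i.
have /choice[a Ha] : forall s, exists a : borel R N -> R, [/\ measurable_fun setT a,
    forall p, testfun p -> L1 mu (fun x => p x * a x) /\ T (pdx p s) = \int[mu]_x (p x * a x) &
    exists2 Z : set (borel R N), measurable Z /\ mu Z = 0%E &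
      forall i x, ~ Z x -> chi i x * a x = chi i x * A i s x].
  move=> s; have [||||i p tp|a ma [Ha HZ]] := @glue_coefficients R m N mu T s chi (fun i => A i s) => //.
  - by have [] := lT.
  - have -> : pdx (fun x => chi i x * p x) s = (fun x v => chi i x * pdx p s x v).
      by apply/funext => x; apply/funext => v; rewrite /pdx mulrA.
    rewrite TQ; last exact: test_form_pdx.
    have -> : (fun x v => chi i x * pdx p s x v) = pdx (fun x => chi i x * p x) s.
      by apply/funext => x; apply/funext => v; rewrite /pdx mulrA.
    have [_ + _] := HA i; apply; apply: testfunMl => //; exact: (chi01 i).1.1.
  - by exists a.
have mchi i : measurable_fun setT (chi i : borel R N -> R).
  by apply: continuous_measurable_borel; apply: testfun_cont; exact: (chi01 i).1.
pose V i : set (borel R N) := [set x | chi i x = 1].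
have mV i : measurable (V i).
  rewrite (_ : V i = setT `&` chi i @^-1` [set 1]); last by rewrite setTI.
  exact: mchi.
exists mu, a, V; split.
- exact: lip_measure_fin.
- by move=> s; have [] := Ha s.
- by move=> s p tp; have [_ /(_ p tp)] := Ha s.
- by split => // x; have [i /nbhs_singleton] := chi1 x; exists i.
move=> i e e0; have [_ _ /(_ e e0)[J HJ]] := HA i.
have Lb s : L1 mu (b (i, J) s) by have [] := Hb (i, J).
have key s : L1 mu (fun x => \1_(V i) x * (a s x - b (i, J) s x)) /\
   \int[mu]_x `|\1_(V i) x * (a s x - b (i, J) s x)| <= e.
  have [ma Ta [Z [mZ Z0] HZ]] := Ha s.
  have eqV x : ~ Z x -> \1_(V i) x * (a s x - b (i, J) s x) = \1_(V i) x * (A i s x - b (i, J) s x).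
    move=> Zx; rewrite indicE; have [Vx|Vx] := pselect (V i x); last by rewrite memNset// !mul0r.
    by have := HZ i x Zx; rewrite Vx !mul1r => ->.
  have LD : L1 mu (fun x => A i s x - b (i, J) s x) by exact: L1B.
  have LVA : L1 mu (fun x => \1_(V i) x * A i s x) by exact: L1_indicM.
  have La : L1 mu (fun x => \1_(V i) x * a s x).
    have [La' _] := Ta (chi i) (chi01 i).1.
    apply: (@L1_ext _ _ _ _ (fun x => \1_(V i) x * (chi i x * a s x))); last exact: L1_indicM.
    move=> x; rewrite indicE; have [Vx|Vx] := pselect (V i x); last by rewrite memNset// !mul0r.
    by rewrite Vx mul1r.
  have L : L1 mu (fun x => \1_(V i) x * (a s x - b (i, J) s x)).
    apply: (@L1_ext _ _ _ _ (fun x => \1_(V i) x * a s x - \1_(V i) x * b (i, J) s x)) => [x|].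
      by rewrite mulrBr.
    by apply: L1B => //; exact: L1_indicM.
  split => //.
  have LVD := L1_indicM (mV i) LD.
  rewrite (@Rint_null _ _ _ mu Z _ (fun x => `|\1_(V i) x * (A i s x - b (i, J) s x)|))//.
  - apply: le_trans (HJ J (leqnn _) s); apply: Rint_le.
    + exact: L1_norm LVD.
    + by apply: L1_norm; exact: L1B.
    + move=> x; rewrite normrM distrC ler_piMl// indicE; case: (x \in V i); by rewrite /= ?normr1 ?normr0.
  - by apply: L1_meas; exact: L1_norm L.
  - by apply: L1_meas; exact: L1_norm LVD.
  - by move=> x /eqV ->.
exists (ch (i, J)), (b (i, J)); split => //.
- by have [] := Hch (i, J).
- by move=> s; have [] := key s.
- by move=> s; have [] := key s.
Qed.
End representation.

(** * Extension to Borel forms *)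

Section mass.
Variables (R : realType) (m N : nat).
Implicit Types (T : functional R m N) (w : dform R m N).

Lemma mass_ge0 T : T (fun _ _ => 0) = 0 -> (0 <= mass T)%E.
Proof.
move=> T0; apply: ereal_sup_ubound; exists (fun _ _ => 0); last by rewrite T0.
by split=> [||x v _]; [exact: test_form0|move=> ? _|rewrite normr0 ler01].
Qed.

Lemma mass_bound T w (c : R) : (forall (r : R) w, test_form w -> T (fun x v => r * w x v) = r * T w) ->
  (mass T < +oo)%E -> test_form w -> 0 < c -> comass_le c w -> `|T w| <= c * fine (mass T).
Proof.
move=> hT mT tw c0 cw.
have T00 : T (fun _ _ => 0) = 0.
  have -> : (fun _ _ => 0) = (fun x v => 0 * w x v) :> dform R m N.
    by apply/funext => x; apply/funext => v; rewrite mul0r.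
  by rewrite hT// mul0r.
have mfin : mass T \is a fin_num by rewrite ge0_fin_numE// mass_ge0.
have H (r : R) : `|r| = c^-1 -> r * T w <= fine (mass T).
  move=> rc; rewrite -hT// -lee_fin fineK//; apply: ereal_sup_ubound.
  exists (fun x v => r * w x v) => //; split=> //.
    by apply: test_formM => //; exact: smooth_cst.
  by move=> x v ov; rewrite normrM rc ler_pdivrMl// mulr1; exact: cw.
have r0 : 0 <= c^-1 by rewrite invr_ge0 ltW.
rewrite ler_norml; apply/andP; split.
  have := H (- c^-1); rewrite normrN ger0_norm// => /(_ erefl).
  by rewrite mulNr lerNl ler_pdivlMl// mulrN.
have := H c^-1; rewrite ger0_norm// => /(_ erefl).
by rewrite ler_pdivrMl.
Qed.

(* Like a test form, but without compact support: this covers pullbacks by pi_x. *)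
Definition sform w (C : R) := [/\ forall x, alternating (w x), forall v, smooth (w^~ v) &
  forall x v, orthonormal v -> `|w x v| <= C].

Lemma sform_testM w C p : sform w C -> testfun p -> test_form (fun x v => p x * w x v).
Proof.
move=> [aw sw _] tp; apply: (@test_form_sub _ _ _ _ (supp1 p)).
- by move=> x; exact: alternatingZ.
- move=> v; exact: (smoothM tp.1 (sw v)).
- by have [] := tp.
- exact: closed_closure.
- by move=> x v; apply: contraPP => /supp1_out ->; rewrite mul0r eqxx.
Qed.

Lemma closed_measurable (K : set 'rV[R]_N) : closed K -> measurable (K : set (borel R N)).
Proof.
move=> cK; rewrite -[X in measurable X]setCK; apply: measurableC.
by apply: open_measurable_borel; exact: closed_openC.
Qed.

Lemma pairingM w xi (p : 'rV[R]_N -> R) x :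
  pairing (fun x v => p x * w x v) xi x = p x * pairing w xi x.
Proof. by rewrite /pairing mulr_sumr; apply: eq_bigr => s _; rewrite mulrCA. Qed.

Lemma pairing_coefM w xi (p : 'rV[R]_N -> R) x :
  pairing w (fun s x => p x * xi s x) x = p x * pairing w xi x.
Proof. by rewrite /pairing mulr_sumr; apply: eq_bigr => s _; rewrite mulrA. Qed.

End mass.

Section represents.
Variables (R : realType) (m N : nat).
Local Notation S := {ffun 'I_m -> 'I_N}.
Implicit Types (T : functional R m N) (w : dform R m N) (mu : {measure set (borel R N) -> \bar R}).

Lemma test01_le1 (p : 'rV[R]_N -> R) x : test01 p -> `|p x| <= 1.
Proof. by move=> [_ /(_ x)/andP[? ?]]; rewrite ger0_norm. Qed.

Lemma agree_id mu mu' a1 a2 : L1 mu a1 -> L1 mu' a2 ->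
  (forall p, test01 p -> \int[mu]_x (p x * a1 x) = \int[mu']_x (p x * a2 x)) ->
  forall (p : borel R N -> R) (C : R), measurable_fun setT p -> (forall x, `|p x| <= C) ->
  \int[mu]_x (p x * a1 x) = \int[mu']_x (p x * a2 x).
Proof.
move=> L1a L2a H p C mp pC.
exact: (agree_test (@measurable_id _ _ _) (@measurable_id _ _ _) L1a L2a H mp pC).
Qed.

Lemma agree_indic mu mu' a1 a2 : L1 mu a1 -> L1 mu' a2 ->
  (forall p, test01 p -> \int[mu]_x (p x * a1 x) = \int[mu']_x (p x * a2 x)) ->
  forall A : set (borel R N), measurable A -> \int[mu]_x (\1_A x * a1 x) = \int[mu']_x (\1_A x * a2 x).
Proof.
move=> L1a L2a H A mA; apply: (agree_id L1a L2a H (C := 1)); first exact: measurable_indic.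
by move=> x; rewrite indicE; case: (_ \in _); rewrite /= ?normr1 ?normr0.
Qed.

Lemma represents_meas mu xi T w : represents mu xi T -> (forall s, measurable_fun setT (fun x : borel R N => w x (basis_frame R s))) ->
  measurable_fun setT (pairing w xi : borel R N -> R).
Proof.
move=> [_ mxi _ _] mw.
by apply: measurable_sum => s; apply: measurable_funM => //; exact: mxi.
Qed.

Lemma represents_L1 mu xi T w : represents mu xi T -> test_form w -> L1 mu (pairing w xi).
Proof.
move=> [_ mxi ixi _] tw; have [C C0 [_ mw wC]] := test_form_bform tw.
have cK : compact (form_supp w) by have [] := tw.
have mK := closed_measurable (@closed_form_supp _ _ _ w).
apply: L1_sum => s.
apply: (@L1_ext _ _ _ _ (fun x : borel R N => w x (basis_frame R s) * (\1_(form_supp w : set (borel R N)) x * xi s x))).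
  move=> x; rewrite indicE; have [xK|xK] := pselect (form_supp w x).
    by rewrite mem_set// mul1r mulrC.
  by rewrite memNset// mul0r mulr0 form_supp_out// mulr0.
apply: (L1M (mw s) (fun x => wC x s)).
rewrite /L1; have := ixi s _ cK; rewrite (integrable_mkcond _ mK).
congr (_.-integrable _); apply/funext => x; rewrite patchE /= indicE.
by case: (x \in _); rewrite ?mul1r ?mul0r.
Qed.

Lemma represents_testM mu xi T w C p : represents mu xi T -> sform w C -> testfun p ->
  L1 mu (fun x => p x * pairing w xi x) /\ T (fun x v => p x * w x v) = \int[mu]_x (p x * pairing w xi x).
Proof.
move=> rT sw tp; have tpw := sform_testM sw tp.
have E : pairing (fun x v => p x * w x v) xi = fun x => p x * pairing w xi x.
  by apply/funext => x; exact: pairingM.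
split; first by rewrite -E; exact: (represents_L1 rT tpw).
by have [_ _ _ ->//] := rT; rewrite E.
Qed.

Lemma test_form_sform w : test_form w -> exists2 C, 0 < C & sform w C.
Proof.
move=> tw; have [aw sw _] := tw; have [C C0 [_ _ wC]] := test_form_bform tw.
exists (#|S|%:R * C + 1); first by rewrite ltr_wpDl// mulr_ge0.
split=> // x v ov; rewrite (multilinear_expand v (multilinear_alternating (aw x))).
apply: le_trans (ler_norm_sum _ _ _) _; apply: (@le_trans _ _ (#|S|%:R * C)); last by rewrite lerDl.
rewrite mulr_natl -sumr_const; apply: ler_sum => s _.
rewrite normrM -[X in _ <= X]mul1r; apply: ler_pM => //.
rewrite normr_prod; apply: (@le_trans _ _ (\prod_(i < m) 1)); last by rewrite big1_eq.
by apply: ler_prod => i _; rewrite normr_ge0/=; exact: orthonormal_le1.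
Qed.

(** The representation behind [extend] is an unknown one. Multiplying [w] by test functions shows
    that its density and the given one have equal integrals against them, hence over Borel sets. *)
Lemma extend_indic mu xi T w (A : set (borel R N)) : represents mu xi T -> test_form w -> measurable A ->
  extend T (fun x v => \1_A x * w x v) = \int[mu]_x (\1_A x * pairing w xi x).
Proof.
move=> rT tw mA; have [C _ sw] := test_form_sform tw.
rewrite /extend; set P := [set r | _].
have : P (get P).
  by apply: getPex; exists (\int[mu]_x pairing (fun x v => \1_A x * w x v) xi x); exists mu, xi.
move=> [mu' [xi' [rT' ->]]].
under eq_Rintegral do rewrite pairingM.
apply: (agree_indic (represents_L1 rT' tw) (represents_L1 rT tw)) => // p [tp _].
have [_ <-] := represents_testM rT sw tp.
by have [_ <-] := represents_testM rT' sw tp.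
Qed.

Lemma represents_homog mu xi T (r : R) w : represents mu xi T -> test_form w -> T (fun x v => r * w x v) = r * T w.
Proof.
move=> rT tw; have [_ _ _ HT] := rT.
rewrite !HT//; last by apply: (test_formM _ tw); exact: smooth_cst.
rewrite -RintZ; last exact: (represents_L1 rT tw).
by apply: eq_Rintegral => x _; rewrite (@pairingM _ _ _ w xi (fun=> r)).
Qed.

Lemma sform_meas w C s : sform w C -> measurable_fun setT (fun x : borel R N => w x (basis_frame R s)).
Proof. by move=> [_ sw _]; apply: continuous_measurable_borel; exact: smooth_continuous. Qed.

(** Finite mass replaces compact support: it bounds the integrals of [p * w] uniformly over the test
    functions [p] with values in [0, 1]. *)
Lemma sform_L1 mu xi T w C : 0 < C -> represents mu xi T -> (mass T < +oo)%E -> sform w C ->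
  L1 mu (pairing w xi).
Proof.
move=> C0 rT mT sw; apply: (@bounded_pairing_L1 _ _ mu (pairing w xi) (C * fine (mass T))).
- apply: (represents_meas rT) => s; exact: sform_meas sw.
- by move=> p tp; have [] := represents_testM rT sw tp.
- move=> p p01; have [tp _] := p01; have [_ <-] := represents_testM rT sw tp.
  apply: mass_bound => //.
  + by move=> r w' tw'; exact: represents_homog rT tw'.
  + exact: sform_testM sw tp.
  + move=> x v ov; rewrite normrM -[X in _ <= X]mul1r; apply: ler_pM => //; first exact: test01_le1.
    by have [_ _] := sw; apply.
Qed.

(** Finite mass makes the density integrable in both representations, so their agreement on test
    functions extends to the constant 1. *)
Lemma extend_sform mu xi T w C : 0 < C -> represents mu xi T -> (mass T < +oo)%E -> sform w C ->
  extend T w = \int[mu]_x pairing w xi x.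
Proof.
move=> C0 rT mT sw; rewrite /extend; set P := [set r | _].
have : P (get P) by apply: getPex; exists (\int[mu]_x pairing w xi x); exists mu, xi.
move=> [mu' [xi' [rT' ->]]].
transitivity (\int[mu']_x (1 * pairing w xi' x)); first by apply: eq_Rintegral => x _; rewrite mul1r.
transitivity (\int[mu]_x (1 * pairing w xi x)); last by apply: eq_Rintegral => x _; rewrite mul1r.
apply: (agree_id (sform_L1 C0 rT' mT sw) (sform_L1 C0 rT mT sw) _ (p := fun=> 1) (C := 1)) => //.
- move=> p [tp _]; have [_ <-] := represents_testM rT sw tp.
  by have [_ <-] := represents_testM rT' sw tp.
- by move=> y; rewrite normr1.
Qed.

End represents.

Section coefficients.
Variables (R : realType) (m N : nat).
Local Notation S := {ffun 'I_m -> 'I_N}.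
Variables (T : functional R m N) (mu : {measure set (borel R N) -> \bar R}) (a : S -> borel R N -> R).
Hypothesis cT : is_current T.
Hypothesis mufin : (mu setT < +oo)%E.
Hypothesis ma : forall s, measurable_fun setT (a s).
Hypothesis Ta : forall s p, testfun p -> L1 mu (fun x => p x * a s x) /\ T (pdx p s) = \int[mu]_x (p x * a s x).

(** The factor compensates for the sum over all [s] in [pairing], as in [alternating_dxf_expand]. *)
Definition xi_of (s : S) (x : 'rV[R]_N) : R := (m`!)%:R^-1 * a s x.

Lemma pairing_xi w x : pairing w xi_of x = (m`!)%:R^-1 * \sum_s w x (basis_frame R s) * a s x.
Proof. by rewrite /pairing mulr_sumr; apply: eq_bigr => s _; rewrite /xi_of -mulrA [a s x * _]mulrC. Qed.

Lemma represents_xi : represents mu xi_of T.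
Proof.
split.
- move=> K cK; apply: le_lt_trans mufin; apply: le_measure; rewrite ?inE//.
  by apply: closed_measurable; apply: compact_closed => //; exact: norm_hausdorff.
- by move=> s; apply: measurable_funM.
- move=> s K cK; have [r r0 Kr] := compact_supp_bounded cK.
  have mK : measurable (K : set (borel R N)).
    by apply: closed_measurable; apply: compact_closed => //; exact: norm_hausdorff.
  have [L _] := Ta s (testfun_plateau (0 : 'rV[R]_N) r0).
  rewrite (integrable_mkcond _ mK).
  have L' : L1 mu (fun x => (m`!)%:R^-1 * (\1_(K : set (borel R N)) x * (plateau 0 r x * a s x))).
    by apply: L1Z; exact: L1_indicM.
  move: L'; rewrite /L1; congr (_.-integrable _); apply/funext => x; rewrite patchE /= indicE.
  have [xK|xK] := pselect (K x); last by rewrite memNset// mul0r mulr0.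
  by rewrite mem_set// mul1r plateau1 ?mul1r// subr0; exact: Kr.
- move=> w tw; rewrite current_expand//.
  have tws s : testfun (w^~ (basis_frame R s)) by exact: test_form_testfun.
  rewrite (eq_bigr (fun s => \int[mu]_x (w x (basis_frame R s) * a s x))); last first.
    by move=> s _; have [_ ->] := Ta s (tws s).
  rewrite -Rint_sum; last by move=> s; have [] := Ta s (tws s).
  rewrite -RintZ; last by apply: L1_sum => s; have [] := Ta s (tws s).
  by apply: eq_Rintegral => x _; rewrite pairing_xi.
Qed.

Variable A : set (borel R N).
Hypothesis mA : measurable A.
Local Notation TA := (restrict_current T A).

Lemma restrictE w : test_form w -> TA w = \int[mu]_x (\1_A x * pairing w xi_of x).
Proof. by move=> tw; apply: extend_indic => //; exact: represents_xi. Qed.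

Lemma represents_restrict : represents mu (fun s x => \1_A x * xi_of s x) TA.
Proof.
have [r1 r2 r3 r4] := represents_xi; split => //.
- by move=> s; apply: measurable_funM => //; exact: measurable_indic.
- move=> s K cK; have mK : measurable (K : set (borel R N)).
    by apply: closed_measurable; apply: compact_closed => //; exact: norm_hausdorff.
  apply: (le_integrable mK _ _ (r3 s K cK)).
    apply/measurable_EFinP; apply: measurable_funTS; apply: measurable_funM; [exact: measurable_indic|exact: r2].
  move=> x _; rewrite /= lee_fin normrM ler_piMl// indicE; case: (_ \in _); by rewrite /= ?normr1 ?normr0.
- by move=> w tw; rewrite restrictE//; apply: eq_Rintegral => x _; rewrite (@pairing_coefM _ _ _ _ _ (\1_A)).
Qed.

(** [pairing] of [pdx p s] antisymmetrizes [a] in [s], so its integrand is not [p * a s] by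
    computation. The two densities are compared by testing instead. *)
Lemma restrict_pdx s p : testfun p -> TA (pdx p s) = \int[mu]_x (\1_A x * (p x * a s x)).
Proof.
move=> tp; have tps := test_form_pdx s tp; rewrite restrictE//.
have [C _ sps] := test_form_sform tps.
apply: (agree_indic (represents_L1 represents_xi tps) (Ta s tp).1) => // q [tq _].
have [_ <-] := represents_testM represents_xi sps tq.
have [_ H] := Ta s (testfunMl tq.1 tp).
transitivity (T (pdx (fun x => q x * p x) s)).
  by congr T; apply/funext => x; apply/funext => v; rewrite /pdx mulrA.
by rewrite H; apply: eq_Rintegral => x _; rewrite mulrA.
Qed.

(** Where the mass estimate of the motion is used: it bounds the pairings of the coefficient over
    [A] with all test functions. *)
Lemma restrict_coef_L1 s : (mass TA < +oo)%E -> L1 mu (fun x => \1_A x * a s x).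
Proof.
move=> mT; apply: (@bounded_pairing_L1 _ _ mu _ ((1 * (m`!)%:R) * fine (mass TA))).
- by apply: measurable_funM => //; exact: measurable_indic.
- move=> p tp; apply: (@L1_ext _ _ _ _ (fun x => \1_A x * (p x * a s x))) => [x|]; first by rewrite mulrCA.
  by apply: L1_indicM => //; have [] := Ta s tp.
- move=> p p01; have [tp _] := p01.
  rewrite (@eq_Rintegral _ _ _ mu _ (fun x => \1_A x * (p x * a s x))); last by move=> x _; rewrite mulrCA.
  rewrite -restrict_pdx//; apply: mass_bound => //.
  + by move=> r w tw; exact: represents_homog represents_restrict tw.
  + exact: test_form_pdx.
  + move=> x v ov; rewrite /pdx normrM; apply: ler_pM => //; first exact: test01_le1.
    by rewrite (le_trans (@dxf_le _ _ _ _ _ 1 _ _))// ?expr1n ?mulr1// => i j; exact: orthonormal_le1.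
Qed.

End coefficients.

(** * The projection to space *)

Section projection.
Variables (R : realType) (n : nat).
Local Notation pi := (@pi_x R n).
Implicit Types (p : 'rV[R]_(1 + n)) (x : 'rV[R]_n) (g : 'rV[R]_n -> R).

Lemma pi_xD (h : R) (v p : 'rV[R]_(1 + n)) : pi (h *: v + p) = h *: pi v + pi p.
Proof. by apply/rowP => j; rewrite !mxE. Qed.

Lemma pi_x_continuous : continuous pi.
Proof. by move=> x; exact: continuous_rsubmx. Qed.

Lemma pi_x_le p : `|pi p| <= `|p|.
Proof.
apply/norm_rV_le => // j; rewrite mxE.
by have /norm_rV_le-/(_ (normr_ge0 _))/(_ (rshift 1 j)) := lexx `|p|.
Qed.

Lemma dquot_pi g (v p : 'rV[R]_(1 + n)) : (fun h : R => h^-1 *: ((g \o pi) (h *: v + p) - (g \o pi) p)) =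
  (fun h : R => h^-1 *: (g (h *: pi v + pi p) - g (pi p))).
Proof. by apply/funext => h /=; rewrite pi_xD. Qed.

Lemma derive_pi g (v p : 'rV[R]_(1 + n)) : 'D_v (g \o pi) p = 'D_(pi v) g (pi p).
Proof. by rewrite [LHS]/derive dquot_pi. Qed.

Lemma derivable_pi g (v p : 'rV[R]_(1 + n)) : derivable g (pi p) (pi v) -> derivable (g \o pi) p v.
Proof. by move=> H; rewrite /derivable dquot_pi. Qed.

Lemma smooth_pi g : smooth g -> smooth (g \o pi).
Proof.
move=> sg; apply: (@smooth_coind _ _ [set f | exists2 g, smooth g & f = g \o pi]); last by exists g.
move=> _ [{}g {}sg ->]; split=> [x|i x|i].
- apply: (@continuous_comp _ _ _ pi g); [exact: pi_x_continuous|exact: smooth_continuous].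
- apply: derivable_pi; exact: smooth_derivable_dir.
- exists ('D_(pi (delta_mx 0 i)) g); first exact: smooth_derive.
  by apply/funext => x; rewrite derive_pi.
Qed.

(** The coordinates of the composition are coordinates of [f], so this holds also where [f] is not
    derivable. *)
Lemma partials_pi m (f : 'rV[R]_m -> 'rV[R]_(1 + n)) (x : 'rV[R]_m) : partials (pi \o f) x = rsubmx (partials f x).
Proof.
apply/matrixP => i j; rewrite !mxE; congr ('D__ _ x); by apply/funext => y /=; rewrite mxE.
Qed.

Lemma mul_partials_pi m (v : 'M[R]_(m, 1 + n)) p : v *m partials pi p = rsubmx v.
Proof.
have -> : partials pi p = col_mx 0 1%:M.
  apply/matrixP => i j; rewrite mxE.
  rewrite (_ : (fun y => _) = (fun y : 'rV[R]_(1 + n) => y 0 (rshift 1 j))); last first.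
    by apply/funext => y; rewrite mxE.
  have -> : 'D_(delta_mx 0 i) (fun y : 'rV[R]_(1 + n) => y 0 (rshift 1 j)) p = (delta_mx 0 i : 'rV[R]_(1 + n)) 0 (rshift 1 j).
    by apply: derive_val; exact: is_derive_coord.
  rewrite mxE eqxx /= -(splitK i); case: (fintype.split i) => l /=.
    by rewrite col_mxEu mxE (_ : (rshift 1 j == lshift n l) = false)//; apply/eqP => /eqP; rewrite eq_rlshift.
  by rewrite col_mxEd mxE eq_rshift eq_sym.
by rewrite -[in LHS](hsubmxK v) mul_row_col mulmx0 add0r mulmx1.
Qed.

Lemma mul_partials_at_time0 m (v : 'M[R]_(m, n)) x : rsubmx (v *m partials (@at_time0 R n) x) = v.
Proof.
have -> : partials (@at_time0 R n) x = row_mx 0 1%:M.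
  apply/matrixP => i j; rewrite mxE -(splitK j); case: (fintype.split j) => l /=.
    rewrite row_mxEl mxE (_ : (fun y => _) = fun=> 0); first exact: derive_cst.
    by apply/funext => y; rewrite /at_time0 row_mxEl mxE.
  rewrite row_mxEr mxE (_ : (fun y => _) = (fun y : 'rV[R]_n => y 0 l)); last first.
    by apply/funext => y; rewrite /at_time0 row_mxEr.
  have -> : 'D_(delta_mx 0 i) (fun y : 'rV[R]_n => y 0 l) x = (delta_mx 0 i : 'rV[R]_n) 0 l.
    by apply: derive_val; exact: is_derive_coord.
  by rewrite mxE eqxx eq_sym.
by rewrite mul_mx_row mulmx0 mulmx1 row_mxKr.
Qed.

Lemma pullbackE m (w : dform R m n) p v : pullback pi w p v = w (pi p) (rsubmx v).
Proof. by rewrite /pullback mul_partials_pi. Qed.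

Lemma alternating_rsubmx m (a : 'M[R]_(m, n) -> R) : alternating a ->
  alternating (fun v : 'M[R]_(m, 1 + n) => a (rsubmx v)).
Proof.
have rowr (v : 'M[R]_(m, 1 + n)) i : row i (rsubmx v) = rsubmx (row i v) by apply/rowP => j; rewrite !mxE.
have row'r (v : 'M[R]_(m, 1 + n)) i : row' i (rsubmx v) = rsubmx (row' i v) by apply/matrixP => l j; rewrite !mxE.
move=> [ma aa]; split=> [i A B C b c E EB EC|A i j ij E].
  apply: (ma i); rewrite ?rowr ?row'r ?E ?EB ?EC//.
  by apply/rowP => j; rewrite !mxE.
by apply: (aa _ i j ij); rewrite !rowr E.
Qed.

Lemma pull_coef_le m (w : dform R m n) C : (forall x, alternating (w x)) -> (forall x s, `|w x (basis_frame R s)| <= C) ->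
  forall p (v : 'M[R]_(m, 1 + n)), (forall i j, `|v i j| <= 1) -> `|pullback pi w p v| <= #|{ffun 'I_m -> 'I_n}|%:R * C.
Proof.
move=> aw wC p v v1; rewrite pullbackE (multilinear_expand _ (multilinear_alternating (aw _))).
apply: le_trans (ler_norm_sum _ _ _) _; rewrite mulr_natl -sumr_const; apply: ler_sum => s _.
rewrite normrM -[X in _ <= X]mul1r; apply: ler_pM => //.
rewrite normr_prod; apply: (@le_trans _ _ (\prod_(i < m) 1)); last by rewrite big1_eq.
by apply: ler_prod => i _; rewrite normr_ge0/= mxE.
Qed.

Lemma sform_pullback m (w : dform R m n) : test_form w -> exists2 C, 0 < C & sform (pullback pi w) C.
Proof.
move=> tw; have [aw sw _] := tw; have [C C0 [_ _ wC]] := test_form_bform tw.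
exists (#|{ffun 'I_m -> 'I_n}|%:R * C + 1); first by rewrite ltr_wpDl// mulr_ge0.
split=> [x|v|x v ov].
- rewrite (_ : pullback pi w x = fun v => w (pi x) (rsubmx v)); first exact: alternating_rsubmx.
  by apply/funext => v; rewrite pullbackE.
- rewrite (_ : (pullback pi w)^~ v = (w^~ (rsubmx v)) \o pi); first exact: smooth_pi.
  by apply/funext => x; rewrite pullbackE.
- apply: (@le_trans _ _ (#|{ffun 'I_m -> 'I_n}|%:R * C)); last by rewrite lerDl.
  by apply: pull_coef_le => // i j; exact: orthonormal_le1.
Qed.

Lemma ext_deriv_pullback m (w : dform R m n) p v :
  @ext_deriv R m.+1 (1 + n) (pullback pi w) p v = pullback pi (@ext_deriv R m.+1 n w) p v.
Proof.
rewrite pullbackE; apply: eq_bigr => j _; congr (_ * _).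
rewrite (_ : (fun y => _) = (fun x => w x (row' j (rsubmx v))) \o pi); last first.
  apply/funext => y /=; rewrite pullbackE; congr (w _ _).
  by apply/matrixP => a b; rewrite !mxE.
rewrite derive_pi; congr ('D__ _ _).
by apply/rowP => b; rewrite !mxE.
Qed.

Lemma time_coord p : time p = p 0 (lshift n 0).
Proof. by rewrite /time mxE. Qed.

Lemma measurable_slab (B : set (measurableTypeR R)) : measurable B -> measurable (@slab R n B : set (borel R (1 + n))).
Proof.
move=> mB.
have mt : measurable_fun [set: borel R (1 + n)] (fun p : borel R (1 + n) => (p : 'rV[R]_(1 + n)) 0 (lshift n 0)).
  by apply: continuous_measurable_borel; exact: coord_continuous.
have := mt measurableT _ mB; rewrite setTI; congr measurable.
by apply/seteqP; split => p; rewrite /slab /= time_coord.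
Qed.

Lemma norm_split p (r : R) : 0 <= r -> `|time p| <= r -> `|pi p| <= r -> `|p| <= r.
Proof.
move=> r0 tp xp; apply/norm_rV_le => // i; rewrite -(splitK i); case: (fintype.split i) => l /=.
  by rewrite ord1 -time_coord.
by have /norm_rV_le-/(_ r0)/(_ l) := xp; rewrite mxE.
Qed.

Lemma at_time0_norm x : `|at_time0 x| <= `|x|.
Proof.
apply: norm_split => //; first by rewrite time_coord /at_time0 row_mxEl mxE normr0.
by rewrite /pi_x /at_time0 row_mxKr.
Qed.

End projection.

Section cutoff_limit.
Variables (R : realType) (N : nat) (mu : {measure set (borel R N) -> \bar R}).

(* Used with cutoffs in time: the value of a current on a half-space is the limit of its
   values on cut-off test forms, which vanish from n0 on. *)
Lemma integral_cutoff0 (f : borel R N -> R) (A : set (borel R N)) (p : nat -> 'rV[R]_N -> R) (n0 : nat) :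
  L1 mu f -> (forall j, measurable_fun setT (p j : borel R N -> R)) -> (forall j x, 0 <= p j x <= 1) ->
  (forall x, exists j0, forall j, (j0 <= j)%N -> p j x = \1_A x) ->
  (forall j, (n0 <= j)%N -> \int[mu]_x (p j x * f x) = 0) ->
  \int[mu]_x (\1_A x * f x) = 0.
Proof.
move=> Lf mp p01 pA p0.
have h1 j : measurable_fun setT (fun x : borel R N => p j x * f x).
  by apply: measurable_funM; [exact: mp|exact: (L1_meas Lf)].
have h2 (x : borel R N) : p j x * f x @[j --> \oo] --> \1_A x * f x.
  have [j0 Hj] := pA x; apply: cvg_near_cst; exists j0 => // j /= jj.
  by rewrite Hj.
have h3 j (x : borel R N) : `|p j x * f x| <= `|f x|.
  by rewrite normrM ler_piMl//; have /andP[? ?] := p01 j x; rewrite ger0_norm.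
have [_ H] := Rint_dominated h1 h2 h3 (L1_norm Lf).
have H0 : \int[mu]_x (p j x * f x) @[j --> \oo] --> (0 : R).
  by apply: cvg_near_cst; exists n0 => // j /= jj; exact: p0.
exact: (cvg_unique _ H H0).
Qed.

End cutoff_limit.

(** * The boundary of the truncated motion *)

Section filling.
Variables (R : realType) (k n : nat).
Variables (T0 : functional R k n) (T : functional R k.+1 (1 + n)).
Variables (mu : {measure set (borel R (1 + n)) -> \bar R})
  (a : {ffun 'I_k.+1 -> 'I_(1 + n)} -> borel R (1 + n) -> R).
Hypothesis cT : is_current T.
Hypothesis mufin : (mu setT < +oo)%E.
Hypothesis ma : forall s, measurable_fun setT (a s).
Hypothesis Ta : forall s p, testfun p -> L1 mu (fun x => p x * a s x) /\ T (pdx p s) = \int[mu]_x (p x * a s x).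
Hypothesis bT : loc_rectifiable (boundary T).
Hypothesis sT : supported_in T (@slab R n [set s | 0 <= s]).
Hypothesis dT : forall w, test_form w -> boundary T w = T0 (pullback (@at_time0 R n) w).
Hypothesis T00 : T0 (fun _ _ => 0) = 0.
Local Notation xi := (xi_of a).
Local Notation pi := (@pi_x R n).
Let rT : represents mu xi T := represents_xi cT mufin ma Ta.

Let tgate (c d : R) (p : 'rV[R]_(1 + n)) : R := gate (c * time p + d).

Let smooth_tgate c d : smooth (tgate c d).
Proof.
rewrite (_ : tgate c d = fun p => gate (c * p 0 (lshift n 0) + d)); first exact: smooth_gate.
by apply/funext => p; rewrite /tgate time_coord.
Qed.

Let meas_tgate c d : measurable_fun setT (tgate c d : borel R (1 + n) -> R).
Proof. by apply: continuous_measurable_borel; apply: smooth_continuous; exact: smooth_tgate. Qed.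

Let tgate01 c d p : 0 <= tgate c d p <= 1.
Proof. by rewrite /tgate gate_ge0 gate_le1. Qed.

(** The cutoff [gate (- j * s - 1)] is 1 for times [s <= -2/j] and 0 for [s >= -1/j]. The gap below
    0 keeps the closed support of the cut-off form away from the half-space that carries [T]. *)
Lemma negative_part0 (w : dform R k.+1 (1 + n)) : test_form w ->
  \int[mu]_x (\1_(slab [set s | s < 0] : set (borel R (1 + n))) x * pairing w xi x) = 0.
Proof.
move=> tw; apply: (@integral_cutoff0 _ _ _ _ _ (fun j => tgate (- j%:R) (-1)) 1).
- exact: (represents_L1 rT tw).
- by move=> j; exact: meas_tgate.
- by move=> j x; exact: tgate01.
- move=> x; have [t0|t0] := ltP (time x) 0.
    exists (Num.truncn (2 / - time x)).+1 => j jj.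
    rewrite indicE mem_set// /tgate gate_ge1// mulNr -mulrN -lerBDr opprK.
    have H : 2 / - time x <= j%:R.
      by apply: le_trans (ltW (truncnS_gt _)) _; rewrite ler_nat.
    by rewrite ler_pdivrMr ?oppr_gt0// in H; apply: le_trans H; lra.
  exists 0%N => j _; rewrite indicE memNset//=; last by rewrite /slab /= ltNge t0.
  by apply: gate_le0; have := mulr_ge0 (ler0n R j) t0; rewrite mulNr; lra.
- move=> j j1; have [C C0 sw] := test_form_sform tw.
  have j0 : (0 : R) < j%:R by rewrite ltr0n.
  have tpw : test_form (fun x v => tgate (- j%:R) (-1) x * w x v) by apply: test_formM => //; exact: smooth_tgate.
  transitivity (T (fun x v => tgate (- j%:R) (-1) x * w x v)).
    have [_ _ _ ->//] := rT; apply: eq_Rintegral => x _; by rewrite pairingM.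
  apply: sT => //; apply/seteqP; split => // x [].
  have cl : closed [set p : 'rV[R]_(1 + n) | p 0 (lshift n 0) <= - j%:R^-1].
    rewrite (_ : [set p | _] = (fun p : 'rV[R]_(1 + n) => p 0 (lshift n 0)) @^-1` [set t | t <= - j%:R^-1])//.
    apply: closed_comp => [p _|]; [exact: coord_continuous|exact: closed_le].
  move=> /(form_supp_sub_closed cl) H; rewrite /slab /= time_coord => x0.
  have /H : forall y v, tgate (- j%:R) (-1) y * w y v != 0 -> [set p : 'rV[R]_(1 + n) | p 0 (lshift n 0) <= - j%:R^-1] y.
    move=> y v; apply: contraPP => /= /negP; rewrite -ltNge => yj.
    have -> : tgate (- j%:R) (-1) y = 0.
      apply: gate_le0; rewrite time_coord mulNr; rewrite ltrNl -[X in _ < X]mulr1 ltr_pdivlMl// mulrN in yj; lra.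
    by rewrite mul0r eqxx.
  by move=> /= /(le_trans x0); rewrite leNgt oppr_lt0 invr_gt0 j0.
Qed.

(** The cutoff is 1 from time [t] on and 0 up to [t - 1/j]; for [j >= 1/t] it vanishes at time 0,
    where the boundary lives. The boundary needs a representation of its own, provided by its local
    rectifiability. *)
Lemma boundary_restrict0 (t : R) (w : dform R k (1 + n)) : 0 < t -> test_form w ->
  restrict_current (boundary T) (slab [set s | t <= s]) w = 0.
Proof.
move=> t0 tw; have [mu' [a' [_ [mufin' ma' Ta' _ _]]]] := loc_rectifiable_rep bT.
have rB : represents mu' (xi_of a') (boundary T) by apply: represents_xi => //; have [] := bT.
have mA : measurable (slab [set s | t <= s] : set (borel R (1 + n))).
  by apply: measurable_slab; rewrite -set_itvcy; exact: measurable_itv.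
rewrite /restrict_current (extend_indic rB tw mA).
apply: (@integral_cutoff0 _ _ _ _ _ (fun j => tgate j%:R (1 - j%:R * t)) (Num.truncn t^-1).+1).
- exact: (represents_L1 rB tw).
- by move=> j; exact: meas_tgate.
- by move=> j x; exact: tgate01.
- move=> x; have [tt|tt] := leP t (time x).
    exists 0%N => j _; rewrite indicE mem_set// /tgate gate_ge1//.
    have tt' : 0 <= time x - t by rewrite subr_ge0.
    by have := mulr_ge0 (ler0n R j) tt'; rewrite mulrBr; lra.
  exists (Num.truncn (1 / (t - time x))).+1 => j jj.
  rewrite indicE memNset/=; last by rewrite /slab /= leNgt tt.
  rewrite /tgate gate_le0//.
  have H : 1 / (t - time x) <= j%:R.
    by apply: le_trans (ltW (truncnS_gt _)) _; rewrite ler_nat.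
  by rewrite ler_pdivrMr ?subr_gt0// mulrBr in H; lra.
- move=> j jj.
  have tpw : test_form (fun x v => tgate j%:R (1 - j%:R * t) x * w x v) by apply: test_formM => //; exact: smooth_tgate.
  transitivity (boundary T (fun x v => tgate j%:R (1 - j%:R * t) x * w x v)).
    have [_ _ _ ->//] := rB; apply: eq_Rintegral => x _; by rewrite pairingM.
  rewrite dT// -[RHS]T00; congr T0; apply/funext => x; apply/funext => v.
  rewrite /pullback {1}/tgate gate_le0 ?mul0r//.
  rewrite time_coord /at_time0 row_mxEl mxE mulr0 add0r subr_le0.
  have H : t^-1 <= j%:R by apply: le_trans (ltW (truncnS_gt _)) _; rewrite ler_nat.
  by rewrite -ler_pdivrMr// div1r.
Qed.

Lemma ext_derivZ (r : R) (w : dform R k (1 + n)) : test_form w ->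
  @ext_deriv R k.+1 (1 + n) (fun x v => r * w x v) = fun x v => r * @ext_deriv R k.+1 (1 + n) w x v.
Proof.
move=> tw; have := ext_deriv_lin r tw (test_form0 R k (1 + n)).
have -> : (fun x v => r * w x v + 0) = (fun x v => r * w x v).
  by apply/funext => x; apply/funext => v; rewrite addr0.
move=> ->; apply/funext => x; apply/funext => v.
rewrite [X in _ + X](_ : _ = 0) ?addr0//.
by apply: big1 => j _; rewrite derive_cst mulr0.
Qed.

(** For [t > 0] the boundary term of the slice vanishes on test forms, and a homogeneous functional
    of mass 0 is 0 on test forms. *)
Lemma slice_zero (t : R) (w : dform R k (1 + n)) : 0 < t -> test_form w -> (mass (slice T t) <= 0)%E ->
  \int[mu]_x (\1_(slab [set s | t <= s] : set (borel R (1 + n))) x * pairing (@ext_deriv R k.+1 (1 + n) w) xi x) = 0.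
Proof.
move=> t0 tw m0.
have mA : measurable (slab [set s | t <= s] : set (borel R (1 + n))).
  by apply: measurable_slab; rewrite -set_itvcy; exact: measurable_itv.
have slE w' : test_form w' -> slice T t w' = restrict_current T (slab [set s | t <= s]) (@ext_deriv R k.+1 (1 + n) w').
  by move=> tw'; rewrite /slice boundary_restrict0// subr0.
have hS (r : R) w' : test_form w' -> slice T t (fun x v => r * w' x v) = r * slice T t w'.
  move=> tw'; have trw : test_form (fun x v => r * w' x v) by apply: (test_formM _ tw'); exact: smooth_cst.
  rewrite !slE// ext_derivZ//.
  exact: (represents_homog r (represents_restrict cT mufin ma Ta mA) (test_form_ext_deriv tw')).
rewrite -(restrictE cT mufin ma Ta mA (test_form_ext_deriv tw)) -slE//.
have [C C0 [_ _ wC]] := test_form_sform tw.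
have mlt : (mass (slice T t) < +oo)%E by apply: le_lt_trans m0 _; exact: ltry.
have := mass_bound hS mlt tw C0 wC.
have -> : mass (slice T t) = 0%E.
  apply/eqP; rewrite eq_le m0 mass_ge0//.
  have -> : (fun _ _ => 0) = (fun x v => 0 * w x v) :> dform R k (1 + n).
    by apply/funext => x; apply/funext => v; rewrite mul0r.
  by rewrite hS// mul0r.
by rewrite mulr0 normr_le0 => /eqP.
Qed.

(** Stokes' formula on the slab: of the integral over all times, the part before 0 vanishes by the
    support of [T] and the part from [t] on by the slice. *)
Lemma slab_integral (t : R) (w : dform R k (1 + n)) : 0 < t -> test_form w -> (mass (slice T t) <= 0)%E ->
  \int[mu]_x (\1_(slab `[0, t[ : set (borel R (1 + n))) x * pairing (@ext_deriv R k.+1 (1 + n) w) xi x) =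
  T0 (pullback (@at_time0 R n) w).
Proof.
move=> t0 tw m0; rewrite -dT// /boundary.
have tdw := test_form_ext_deriv tw.
have [_ _ _ ->//] := rT.
set f := pairing _ xi; have Lf : L1 mu f by exact: (represents_L1 rT tdw).
pose A1 : set (borel R (1 + n)) := slab [set s | s < 0].
pose A2 : set (borel R (1 + n)) := slab `[0, t[.
pose A3 : set (borel R (1 + n)) := slab [set s | t <= s].
have m1 : measurable A1 by apply: measurable_slab; rewrite -set_itvNyo; exact: measurable_itv.
have m2 : measurable A2 by apply: measurable_slab; exact: measurable_itv.
have m3 : measurable A3 by apply: measurable_slab; rewrite -set_itvcy; exact: measurable_itv.
rewrite (@eq_Rintegral _ _ _ mu _ (fun x => (\1_A1 x * f x + \1_A2 x * f x) + \1_A3 x * f x) f); last first.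
  move=> x _; rewrite -!mulrDl -[LHS]mul1r; congr (_ * _); rewrite !indicE.
  have [t1|t1] := ltP (time x) 0.
    rewrite (@mem_set _ A1)// (@memNset _ A2) ?(@memNset _ A3) ?addr0//.
      by rewrite /A3 /slab /= leNgt (lt_trans t1 t0).
    by rewrite /A2 /slab /= in_itv/= leNgt t1.
  rewrite (@memNset _ A1) ?add0r; last by rewrite /A1 /slab /= ltNge t1.
  have [t2|t2] := ltP (time x) t.
    rewrite (@mem_set _ A2) ?(@memNset _ A3) ?addr0//.
      by rewrite /A3 /slab /= leNgt t2.
    by rewrite /A2 /slab /= in_itv/= t1.
  rewrite (@memNset _ A2) ?(@mem_set _ A3) ?add0r//.
  by rewrite /A2 /slab /= in_itv/= ltNge t2 andbF.
have L1' := L1_indicM m1 Lf; have L2 := L1_indicM m2 Lf; have L3 := L1_indicM m3 Lf.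
rewrite RintD//; last exact: L1D.
rewrite RintD// (negative_part0 tdw) slice_zero// add0r addr0//.
Qed.

End filling.

(** * Rectifiability of the pushed current *)

Section chains.
Variables (R : realType) (m N : nat).

Definition is_chain (D : functional R m N) := exists p (z : 'I_p -> int) (f : 'I_p -> 'rV[R]_m -> 'rV[R]_N),
  (forall i, lipschitz (f i)) /\ D = lipschitz_chain z f.

Lemma is_chain0 : is_chain (fun=> 0).
Proof.
exists 0%N, (fun=> 0), (fun=> fun=> 0); split => [[]//|].
by apply/funext => w; rewrite /lipschitz_chain big_ord0.
Qed.

Lemma is_chainD D1 D2 : is_chain D1 -> is_chain D2 -> is_chain (fun w => D1 w + D2 w).
Proof.
move=> [p1 [z1 [f1 [l1 ->]]]] [p2 [z2 [f2 [l2 ->]]]].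
exists (p1 + p2)%N, (fun i => match fintype.split i with inl j => z1 j | inr j => z2 j end),
  (fun i => match fintype.split i with inl j => f1 j | inr j => f2 j end); split=> [i|].
  by case: (fintype.split i).
have H1 i : fintype.split (lshift p2 i) = inl i := unsplitK (inl i).
have H2 i : fintype.split (rshift p1 i) = inr i := unsplitK (inr i).
apply/funext => w; rewrite /lipschitz_chain [RHS]big_split_ord.
by under [X in _ = X + _]eq_bigr do rewrite H1; under [X in _ = _ + X]eq_bigr do rewrite H2.
Qed.

Lemma is_chainZ (r : int) D : is_chain D -> is_chain (fun w => r%:~R * D w).
Proof.
move=> [p [z [f [lf ->]]]]; exists p, (fun i => r * z i), f; split => //.
apply/funext => w; rewrite /lipschitz_chain mulr_sumr; apply: eq_bigr => i _.
by rewrite intrM mulrA.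
Qed.

Lemma is_chain_sum I (r : seq I) (D : I -> functional R m N) : (forall i, is_chain (D i)) ->
  is_chain (fun w => \sum_(i <- r) D i w).
Proof.
move=> HD; elim: r => [|i r IH].
  by have := is_chain0; congr is_chain; apply/funext => w; rewrite big_nil.
have := is_chainD (HD i) IH; congr is_chain; by apply/funext => w; rewrite big_cons.
Qed.

(* When N < m there is no orthonormal frame, and the comass bound says nothing about M. *)
Lemma comass_coef (w : dform R m N) (M : R) : (forall x, alternating (w x)) -> comass_le M w ->
  if (m <= N)%N then 0 <= M /\ forall x s, `|w x (basis_frame R s)| <= M
  else forall x s, w x (basis_frame R s) = 0.
Proof.
move=> aw wM; case: ifPn => mN.
  have M0 : 0 <= M.
    pose s0 : {ffun 'I_m -> 'I_N} := [ffun i => widen_ord mN i].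
    apply: le_trans (wM 0 (basis_frame R s0) _); first exact: normr_ge0.
    by apply: orthonormal_basis_frame => i j; rewrite !ffunE => /(congr1 val) /= /val_inj.
  split => // x s; apply: alternating_basis_frame_le => // v; exact: wM.
move=> x s; have : ~~ injectiveb s.
  apply/negP => /injectiveP /leq_card; rewrite !card_ord; exact/negP.
move=> /injectivePn[i [j ij sij]].
by have [_ H] := aw x; apply: (H _ i j) => //; apply/rowP => l; rewrite !mxE sij.
Qed.

End chains.

Section push.
Variables (R : realType) (k n : nat).
Local Notation m := k.+1.
Local Notation S := {ffun 'I_m -> 'I_(1 + n)}.
Local Notation pi := (@pi_x R n).
Variables (T : functional R m (1 + n)).
Variables (mu : {measure set (borel R (1 + n)) -> \bar R}) (a : S -> borel R (1 + n) -> R).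
Variable V : nat -> set (borel R (1 + n)).
Hypothesis cT : is_current T.
Hypothesis mufin : (mu setT < +oo)%E.
Hypothesis ma : forall s, measurable_fun setT (a s).
Hypothesis Ta : forall s p, testfun p -> L1 mu (fun x => p x * a s x) /\ T (pdx p s) = \int[mu]_x (p x * a s x).
Hypothesis mV : forall i, measurable (V i).
Hypothesis covV : forall x, exists i, V i x.
Hypothesis chV : forall i (e : R), 0 < e -> exists (c : chain_data R m (1 + n)) (b : S -> borel R (1 + n) -> R),
      [/\ forall l, lipschitz ((projT2 c).2 l), coef mu (chain_of c) b,
        forall s, L1 mu (fun x => \1_(V i) x * (a s x - b s x)) &
        forall s, \int[mu]_x `|\1_(V i) x * (a s x - b s x)| <= e].
Variable A : set (borel R (1 + n)).
Hypothesis mA : measurable A.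
Hypothesis mTA : (mass (restrict_current T A) < +oo)%E.
Local Notation xi := (xi_of a).
Local Notation I f := (\int[mu]_x f x).

Definition pushed : functional R m n := push_current pi (restrict_current T A).
Local Notation G := pushed.

Let rTA : represents mu (fun s x => \1_A x * xi s x) (restrict_current T A) := represents_restrict cT mufin ma Ta mA.

Lemma pushedE w : test_form w -> L1 mu (fun x => \1_A x * pairing (pullback pi w) xi x) /\
  G w = I (fun x => \1_A x * pairing (pullback pi w) xi x).
Proof.
move=> tw; have [C C0 sw] := sform_pullback tw.
have E : pairing (pullback pi w) (fun s x => \1_A x * xi s x) = (fun x => \1_A x * pairing (pullback pi w) xi x).
  by apply/funext => x; rewrite (@pairing_coefM _ _ _ _ _ (\1_A)).
split; first by rewrite -E; exact: (sform_L1 C0 rTA mTA sw).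
by rewrite /pushed /push_current (extend_sform C0 rTA mTA sw) E.
Qed.

Let pc (w : dform R m n) (s : S) (x : borel R (1 + n)) : R := pullback pi w x (basis_frame R s).
Let K : R := #|{ffun 'I_m -> 'I_n}|%:R.

Let K0 : 0 <= K. Proof. exact: ler0n. Qed.

Let pcle w C : (forall x, alternating (w x)) -> (forall x s, `|w x (basis_frame R s)| <= C) -> forall s x, `|pc w s x| <= K * C.
Proof.
move=> aw wC s x; apply: pull_coef_le => // i j; rewrite basis_frameE.
by case: (_ == _); rewrite /= ?normr1 ?normr0.
Qed.

Let mpc w s : test_form w -> measurable_fun setT (pc w s).
Proof.
move=> tw; have [C C0 [_ sw _]] := sform_pullback tw.
by apply: continuous_measurable_borel; apply: smooth_continuous; exact: sw.
Qed.

Let La s : L1 mu (fun x => \1_A x * a s x).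
Proof. exact: (restrict_coef_L1 cT mufin ma Ta mA s mTA). Qed.

Let Lpa w s : test_form w -> L1 mu (fun x => pc w s x * (\1_A x * a s x)).
Proof.
move=> tw; have [aw _ _] := tw; have [C _ [_ _ wC]] := test_form_bform tw.
exact: (L1M (mpc s tw) (pcle aw wC s) (La s)).
Qed.

Lemma pushed_coef w : test_form w ->
  G w = (m`!)%:R^-1 * \sum_s I (fun x => pc w s x * (\1_A x * a s x)).
Proof.
move=> tw; have [_ ->] := pushedE tw.
rewrite -Rint_sum; last by move=> s; exact: Lpa.
rewrite -RintZ; last by apply: L1_sum => s; exact: Lpa.
apply: eq_Rintegral => x _; rewrite pairing_xi mulrCA; congr (_ * _).
by rewrite mulr_sumr; apply: eq_bigr => s _; rewrite mulrCA.
Qed.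

Let finv_le1 (x : R) : 0 <= x -> (m`!)%:R^-1 * x <= x.
Proof. by move=> x0; rewrite ler_piMl// invf_le1 ?ler1n ?ltr0n fact_gt0. Qed.

Lemma coef_sum_le (F H : S -> borel R (1 + n) -> R) (C e : R) :
  (forall s, measurable_fun setT (F s)) -> (forall s x, `|F s x| <= C) ->
  (forall s, L1 mu (H s)) -> 0 <= C -> (forall s, I (fun x => `|H s x|) <= e) ->
  `|(m`!)%:R^-1 * \sum_s I (fun x => F s x * H s x)| <= #|{: S}|%:R * (C * e).
Proof.
move=> mF FC LH C0 He; rewrite normrM ger0_norm//.
apply: le_trans (finv_le1 (normr_ge0 _)) _; apply: le_trans (ler_norm_sum _ _ _) _.
rewrite mulr_natl -sumr_const; apply: ler_sum => s _.
have L := L1M (mF s) (FC s) (LH s).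
apply: le_trans (Rint_abs L) _; apply: (@le_trans _ _ (C * I (fun x => `|H s x|))); last by rewrite ler_wpM2l.
rewrite -RintZ; last exact: L1_norm.
apply: Rint_le; [exact: L1_norm|apply: L1Z; exact: L1_norm|].
by move=> x; rewrite normrM ler_wpM2r.
Qed.

Lemma pushed_current : is_current G.
Proof.
split=> [r w e tw te|C0 _].
  have twe := test_form_lin r tw te.
  have [Lw ->] := pushedE tw; have [Le ->] := pushedE te; have [_ ->] := pushedE twe.
  rewrite -RintZ// -RintD//; last exact: L1Z.
  apply: eq_Rintegral => x _; rewrite mulrCA -mulrDr; congr (_ * _).
  rewrite /pairing mulr_sumr -big_split; apply: eq_bigr => s _ /=.
  by rewrite !pullbackE mulrDr mulrCA.
pose B := #|{: S}|%:R * (K * \sum_s I (fun x => `|\1_A x * a s x|)).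
(* For [n < m] the comass hypothesis allows negative [M], so the constant must be 0; the forms
   vanish in that case. *)
exists (if (m <= n)%N then B else 0), 0%N => w M tw _ /(_ [::] isT) wM.
have [aw _ _] := tw; have := comass_coef aw wM; rewrite pushed_coef//; case: ifPn => mn.
  move=> [M0 wM'].
  have := @coef_sum_le (pc w) (fun s x => \1_A x * a s x) (K * M) (\sum_s I (fun x => `|\1_A x * a s x|))
    (fun s => mpc s tw) (pcle aw wM') La (mulr_ge0 K0 M0).
  rewrite (_ : _ * (K * M * _) = B * M); last by rewrite /B; ring.
  apply => s; rewrite (bigD1 s)//= lerDl; apply: sumr_ge0 => t _.
  by apply: Rintegral_ge0.
move=> w0; rewrite mul0r big1 ?mulr0 ?normr0// => s _.
rewrite (@eq_Rintegral _ _ _ mu _ (fun=> 0)) ?Rint0// => x _.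
have /normr0_eq0 -> : `|pc w s x| = 0.
  apply/eqP; rewrite eq_le normr_ge0 andbT -[X in _ <= X](mulr0 K).
  by apply: (pcle aw) => y t; rewrite w0 normr0.
by rewrite mul0r.
Qed.

Lemma lipschitz_pi (f : 'rV[R]_m -> 'rV[R]_(1 + n)) : lipschitz f -> lipschitz (pi \o f).
Proof.
move=> /lipschitz_const[L L0 HL]; apply: (@lipschitz_intro _ _ _ _ L) => x y.
apply: le_trans (HL x y); apply: le_trans (pi_x_le (f x - f y)).
by rewrite le_eqVlt; apply/orP; left; apply/eqP; congr `|_|; apply/rowP => j; rewrite !mxE.
Qed.

(** Two approximations of error [e / 2]. On [V i] the coefficients are replaced by those of a
    Lipschitz chain. What remains is this chain on the form cut off by [E], that is, the maps
    [pi \o f l] restricted to the preimages of [E], and [restricted_chain] applies to each of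
    them. *)
Lemma piece_chain i (E : set (borel R (1 + n))) (e : R) : measurable E -> E `<=` V i -> E `<=` A -> 0 < e ->
  exists2 D : functional R m n, is_chain D & forall w, test_form w -> (forall x s, `|w x (basis_frame R s)| <= 1) ->
    `|(m`!)%:R^-1 * \sum_s I (fun x => pc w s x * (\1_E x * a s x)) - D w| <= e.
Proof.
move=> mE EV EA e0.
pose k1 := #|{: S}|%:R * K + 1.
have k10 : 0 < k1 by rewrite ltr_wpDl// mulr_ge0.
pose e2 := e / 2 / k1.
have e20 : 0 < e2 by rewrite !divr_gt0.
have [c [b [lf [Lb Hb] LV HV]]] := chV i e20.
move: c lf Hb => [p [z f]] /= lf Hb.
rewrite /chain_of /= in Hb.
(* The multiplicities of the chain amplify the error of each restricted cube; the summand 1 keeps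
   the constant positive. *)
pose k2 := \sum_l `|(z l)%:~R : R| + 1.
have k20 : 0 < k2 by rewrite ltr_wpDl// sumr_ge0.
pose e3 := e / 2 / k2.
have e30 : 0 < e3 by rewrite !divr_gt0.
have mfE l : measurable (f l @^-1` E : set (borel R m)).
  by have := measurable_lip (lf l) measurableT mE; rewrite setTI.
have /choice[D HD] : forall l, exists D : functional R m n, is_chain D /\ forall w C, 0 <= C -> bform w C ->
    `|\int[lebesgue_rV R m]_(x in @cube R m) (\1_(f l @^-1` E : set (borel R m)) x * w (pi (f l x)) (partials (pi \o f l) x)) - D w| <= e3 * C.
  move=> l; have [q [y [g [lg Hg]]]] := restricted_chain (lipschitz_pi (lf l)) (mfE l) e30.
  by exists (lipschitz_chain y g); split => //; exists q, y, g.
exists (fun w => \sum_l (z l)%:~R * D l w).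
  by apply: is_chain_sum => l; apply: is_chainZ; have [] := HD l.
move=> w tw w1; have [aw _ _] := tw.
have pcK s x : `|pc w s x| <= K by have := pcle aw w1 s x; rewrite mulr1.
have m1E : measurable_fun setT (\1_E : borel R (1 + n) -> R) by exact: measurable_indic.
have Eb s x : `|\1_E x * pc w s x| <= K.
  by rewrite normrM -[X in _ <= X]mul1r; apply: ler_pM => //; rewrite indicE; case: (_ \in _); rewrite /= ?normr1 ?normr0.
have mEp s : measurable_fun setT (fun x => \1_E x * pc w s x).
  by apply: measurable_funM => //; exact: mpc.
have LEa s : L1 mu (fun x => \1_E x * a s x).
  apply: (@L1_ext _ _ _ _ (fun x => \1_E x * (\1_A x * a s x))); last exact: (L1_indicM mE (La s)).
  move=> x; rewrite [\1_E x]indicE; have [xE|xE] := pselect (E x); last by rewrite memNset// !mul0r.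
  by rewrite indicE (mem_set (EA _ xE)) mul1r.
pose X := (m`!)%:R^-1 * \sum_s I (fun x => pc w s x * (\1_E x * b s x)).
pose wE : dform R m (1 + n) := fun x v => \1_E x * pullback pi w x v.
have bwE : bform wE K.
  split=> [x|s|x s]; [|exact: mEp|exact: Eb].
  apply: alternatingZ; have [C C0 [+ _ _]] := sform_pullback tw; exact.
have bw1 : bform w 1.
  by have [C C0 [_ mw _]] := test_form_bform tw; split.
have XE : X = lipschitz_chain z f wE.
  rewrite (chain_expand z lf bwE) /X; congr (_ * _); apply: eq_bigr => s _.
  rewrite (Hb s _ K (mEp s) (Eb s)).
  by apply: eq_Rintegral => x _; rewrite mulrCA mulrA.
have first : `|(m`!)%:R^-1 * \sum_s I (fun x => pc w s x * (\1_E x * a s x)) - X| <= e / 2.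
  rewrite /X -mulrBr -sumrB.
  rewrite (eq_bigr (fun s => I (fun x => (\1_E x * pc w s x) * (\1_(V i) x * (a s x - b s x))))); last first.
    move=> s _; rewrite -RintB; last 2 first.
    - exact: (L1M (mpc s tw) (pcK s) (LEa s)).
    - by apply: (L1M (mpc s tw) (pcK s)); exact: L1_indicM.
    apply: eq_Rintegral => x _; rewrite [\1_E x]indicE.
    have [xE|xE] := pselect (E x); last by rewrite memNset// !mul0r !mulr0 subrr.
    by rewrite mem_set// indicE (mem_set (EV _ xE)) !mul1r mulrBr.
  apply: le_trans (coef_sum_le mEp Eb LV K0 HV) _.
  rewrite mulrA (_ : e / 2 = k1 * e2); last by rewrite /e2 mulrCA divff ?mulr1 ?gt_eqF.
  by rewrite ler_wpM2r ?(ltW e20)// /k1 lerDl.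
have second : `|X - \sum_l (z l)%:~R * D l w| <= e / 2.
  rewrite XE /lipschitz_chain -sumrB; apply: le_trans (ler_norm_sum _ _ _) _.
  apply: (@le_trans _ _ (\sum_l `|(z l)%:~R : R| * e3)); last first.
    rewrite -mulr_suml (_ : e / 2 = k2 * e3); last by rewrite /e3 mulrCA divff ?mulr1 ?gt_eqF.
    by rewrite ler_wpM2r ?(ltW e30)// /k2 lerDl.
  apply: ler_sum => l _; rewrite -mulrBr normrM ler_wpM2l//.
  have [_ /(_ w 1 ler01 bw1)] := HD l; rewrite mulr1; apply: le_trans.
  rewrite le_eqVlt; apply/orP; left; apply/eqP; congr (`| _ - _ |).
  rewrite cube_currentE; apply: eq_Rintegral => x _; rewrite /wE pullbackE partials_pi !indicE.
  by congr (_ * _).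
rewrite -(subrKA X) (le_trans (ler_normD _ _))//.
by rewrite [X in _ <= X]splitr; exact: lerD.
Qed.

Let U := seqDU V.

Let mU i : measurable (U i).
Proof. by rewrite /U /seqDU; apply: measurableD => //; apply: bigsetU_measurable. Qed.

Let U_sum x : exists i0, forall p, \sum_(i < p) \1_(U i) x = (i0 < p)%N%:R :> R.
Proof.
have [i0 _ Ux] : (\bigcup_i U i) x.
  by rewrite /U -seqDU_bigcup_eq; have [i Vx] := covV x; exists i.
exists i0 => p; have z i : i != i0 -> \1_(U i) x = 0 :> R.
  move=> ii; rewrite indicE memNset// => Uix; move/negP: ii; apply; apply/eqP.
  by apply: (trivIset_seqDU V) => //; exists x.
have [ip|ip] := ltnP i0 p.
  rewrite (bigD1 (Ordinal ip))//= indicE mem_set// big1 ?addr0// => i ii; exact: z.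
rewrite big1// => i _; apply: z; apply/eqP => ii.
by have := ltn_ord i; rewrite ii ltnNge ip.
Qed.

(** Dominated convergence: each point lies in one of the disjoint sets [U i], so the remainder is
    eventually 0 there. *)
Let tail_small (e : R) : 0 < e -> exists p, forall s,
  I (fun x => `|(1 - \sum_(i < p) \1_(U i) x) * (\1_A x * a s x)|) <= e.
Proof.
move=> e0.
have m1 j : measurable_fun setT (fun x : borel R (1 + n) => 1 - \sum_(i < j) \1_(U i) x : R).
  by apply: measurable_funB => //; apply: measurable_sum => i; exact: measurable_indic.
have b1 j x : `|1 - \sum_(i < j) \1_(U i) x : R| <= 1.
  by have [i0 ->] := U_sum x; case: (i0 < j)%N; rewrite /= ?subrr ?normr0 ?subr0 ?normr1.
have /choice[P HP] : forall s, exists P, forall p, (P <= p)%N -> I (fun x => `|(1 - \sum_(i < p) \1_(U i) x) * (\1_A x * a s x)|) <= e.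
  move=> s; have L j := L1_norm (L1M (m1 j) (b1 j) (La s)).
  have h2 (x : borel R (1 + n)) : `|(1 - \sum_(i < p) \1_(U i) x) * (\1_A x * a s x)| @[p --> \oo] --> (0 : R).
    apply: cvg_near_cst; have [i0 Hi] := U_sum x; exists i0.+1 => // p /= ip.
    by rewrite Hi ip subrr mul0r normr0.
  have h3 j (x : borel R (1 + n)) : `| `|(1 - \sum_(i < j) \1_(U i) x) * (\1_A x * a s x)| | <= `|\1_A x * a s x|.
    by rewrite normr_id normrM ler_piMl.
  have [_] := Rint_dominated (fun j => L1_meas (L j)) h2 h3 (L1_norm (La s)).
  rewrite Rint0 => /cvgrPdist_le/(_ e e0) [J _ HJ]; exists J => p /HJ /=.
  by rewrite sub0r normrN; apply: le_trans; exact: ler_norm.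
exists (\max_s P s) => s; apply: HP; exact: leq_bigmax.
Qed.

(** The cover is made disjoint so that the errors add up without overlap. Finitely many pieces carry
    the coefficients up to [e / 2], and each piece is a limit of chains by [piece_chain]. Both
    estimates are uniform over forms of comass at most 1. *)
Lemma pushed_rectifiable : rectifiable G.
Proof.
split; first exact: pushed_current.
move=> e e0; pose k1 := #|{: S}|%:R * K + 1.
have k10 : 0 < k1 by rewrite ltr_wpDl// mulr_ge0.
pose e4 := e / 2 / k1.
have e40 : 0 < e4 by rewrite !divr_gt0.
have [p Hp] := tail_small e40.
(* Divided by [p + 1] because [p] may be 0. *)
have e5 : 0 < e / 2 / p.+1%:R by rewrite !divr_gt0.
have /choice[D HD] : forall i : 'I_p, exists D : functional R m n, is_chain D /\
    forall w, test_form w -> (forall x s, `|w x (basis_frame R s)| <= 1) ->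
    `|(m`!)%:R^-1 * \sum_s I (fun x => pc w s x * (\1_(U i `&` A) x * a s x)) - D w| <= e / 2 / p.+1%:R.
  move=> i; have [||||D cD HD] := @piece_chain i (U i `&` A) (e / 2 / p.+1%:R) => //.
  - exact: measurableI.
  - by move=> x [+ _]; rewrite /U; exact: subset_seqDU.
  - by exists D.
have [q [z [f [lf EF]]]] := is_chain_sum (index_enum _) (fun i => (HD i).1).
exists q, z, f; split => //; rewrite -EF.
apply: ge_ereal_sup => _ [w [tw _ w1] <-]; rewrite lee_fin.
have [aw _ _] := tw.
have wle : forall x s, `|w x (basis_frame R s)| <= 1.
  move=> x s; have := comass_coef aw w1; case: ifPn => _; first by move=> [_]; apply.
  by move=> ->; rewrite normr0.
have pcK s x : `|pc w s x| <= K by have := pcle aw wle s x; rewrite mulr1.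
apply: le_trans (ler_norm _) _.
pose X i := (m`!)%:R^-1 * \sum_s I (fun x => pc w s x * (\1_(U i `&` A) x * a s x)).
rewrite -(subrKA (\sum_(i < p) X i)) (le_trans (ler_normD _ _))//.
rewrite [X in _ <= X]splitr; apply: lerD; last first.
  rewrite -sumrB; apply: le_trans (ler_norm_sum _ _ _) _.
  apply: (@le_trans _ _ (\sum_(i < p) e / 2 / p.+1%:R)).
    by apply: ler_sum => i _; have [_] := HD i; exact.
  rewrite sumr_const card_ord -(mulr_natr _ p) mulrAC ler_pdivrMr ?ltr0n//.
  by apply: ler_wpM2l; [rewrite divr_ge0// ltW|rewrite ler_nat].
rewrite pushed_coef// /X -mulr_sumr -mulrBr exchange_big -sumrB /=.
have LUA i s : L1 mu (fun x => pc w s x * (\1_(U i `&` A) x * a s x)).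
  apply: (L1M (mpc s tw) (pcK s)).
  apply: (@L1_ext _ _ _ _ (fun x => \1_(U i) x * (\1_A x * a s x))) => [x|]; last exact: L1_indicM.
  by rewrite indicI /= mulrA.
rewrite (eq_bigr (fun s => I (fun x => pc w s x * ((1 - \sum_(i < p) \1_(U i) x) * (\1_A x * a s x))))); last first.
  move=> s _; rewrite -Rint_sum// -RintB; [|exact: Lpa|exact: L1_sum].
  apply: eq_Rintegral => x _; rewrite mulrBl mul1r mulrBr; congr (_ - _).
  rewrite mulr_suml mulr_sumr; apply: eq_bigr => i _.
  by congr (_ * _); rewrite indicI /= mulrA.
have LT s : L1 mu (fun x => (1 - \sum_(i < p) \1_(U i) x) * (\1_A x * a s x)).
  apply: (@L1M _ _ _ _ _ _ 1) => //.
    by apply: measurable_funB => //; apply: measurable_sum => i; exact: measurable_indic.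
  by move=> x; have [i0 ->] := U_sum x; case: (i0 < p)%N; rewrite /= ?subrr ?normr0 ?subr0 ?normr1.
apply: le_trans (coef_sum_le (fun s => mpc s tw) pcK LT K0 Hp) _.
rewrite mulrA (_ : e / 2 = k1 * e4); last by rewrite /e4 mulrCA divff ?mulr1 ?gt_eqF.
by rewrite ler_wpM2r ?(ltW e40)// /k1 lerDl.
Qed.

End push.

Section transfer.
Variables (R : realType) (m N : nat).
Implicit Types (T S : functional R m N).

Lemma mass_eq T S : functional_eq T S -> mass T = mass S.
Proof.
move=> TS; congr ereal_sup; apply/seteqP; split => _ [w [tw uw cw] <-]; exists w => //.
  by rewrite TS.
by rewrite TS.
Qed.

Lemma loc_rectifiable_eq T S : functional_eq T S -> loc_rectifiable S -> loc_rectifiable T.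
Proof.
move=> TS [[linS bS] lS]; split; first split=> [r w e tw te|K cK].
- by rewrite !TS//; [exact: linS|exact: test_form_lin].
- have [C [r H]] := bS K cK; exists C, r => w M tw; rewrite TS//; exact: H.
move=> x; have [Q [rQ [U [oU Ux HU]]]] := lS x; exists Q; split => //.
by exists U; split=> // w tw wU; rewrite TS//; exact: HU.
Qed.

Lemma rectifiable_loc T : rectifiable T -> loc_rectifiable T.
Proof. by move=> rT; split=> [|x]; [have [] := rT|exists T; split=> //; exists setT; split=> //; exact: openT]. Qed.

Lemma mass_measureT T : mass_measure T setT = mass T.
Proof.
apply/eqP; rewrite eq_le; apply/andP; split.
  by apply: ereal_inf_lbound; exists setT => //; split => //; exact: openT.
by apply: le_ereal_inf_tmp => _ [U [oU TU] <-]; rewrite (_ : U = setT)//; apply/seteqP; split.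
Qed.

End transfer.

(** * The filling *)

Section cylinder.
Variables (R : realType) (k n : nat).
Local Notation pi := (@pi_x R n).

(* The pullback by pi_x is cut off by a plateau that is 1 on a ball containing
   [0, t] times the support of w0. *)
Lemma cylinder_form (w0 : dform R k n) (t : R) : test_form w0 -> 0 < t ->
  exists W : dform R k (1 + n), [/\ test_form W,
    forall p v, 0 <= time p < t -> @ext_deriv R k.+1 (1 + n) W p v = pullback pi (@ext_deriv R k.+1 n w0) p v &
    pullback (@at_time0 R n) W = w0].
Proof.
move=> tw t0; have [_ _ cw] := tw.
have [rho rho0 Hrho] := compact_supp_bounded cw.
pose r' := t + rho; have r'0 : 0 < r' by rewrite addr_gt0.
(* At times in [0, t) a point of norm at least [r] cannot lie over the support of [w0], since such
   points have norm at most [r']. The margin leaves open neighbourhoods in both cases; these are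
   needed for derivatives, also at time 0. *)
pose r := r' + 1; have r0 : 0 < r by rewrite addr_gt0.
pose phi : 'rV[R]_(1 + n) -> R := plateau 0 r.
pose W : dform R k (1 + n) := fun p v => phi p * pullback pi w0 p v.
have [C C0 sw] := sform_pullback tw.
exists W; split.
- exact: sform_testM sw (testfun_plateau _ r0).
- move=> p v /andP[p0 pt]; rewrite -ext_deriv_pullback; apply: eq_bigr => j _; congr (_ * _).
  suff H : nbhs p [set y | forall v', W y v' = pullback pi w0 y v'].
    by apply: near_eq_derive; apply: filterS H => y; exact.
  have [pr|pr] := ltP `|p| r.
    have oA : open [set y : 'rV[R]_(1 + n) | `|y| < r].
      apply: (@open_comp _ _ (fun y : 'rV[R]_(1 + n) => `|y|) [set s | s < r]); last exact: open_lt.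
      by move=> y _; exact: norm_continuous.
    apply: filterS (open_nbhs_nbhs (conj oA pr)) => y /= yr v'.
    by rewrite /W /phi plateau1 ?mul1r// subr0 ltW.
  have np : ~ form_supp w0 (pi p).
    move=> /Hrho H; have : `|p| <= r'.
      apply: norm_split; first exact: ltW.
        by rewrite ger0_norm// (le_trans (ltW pt))// lerDl ltW.
      by apply: le_trans H _; rewrite lerDr ltW.
    by move=> /(le_trans pr); rewrite leNgt ltrDl ltr01.
  have oA : open (pi @^-1` (~` form_supp w0)).
    apply: open_comp; first by move=> y _; exact: pi_x_continuous.
    by apply: closed_openC; exact: closed_form_supp.
  apply: filterS (open_nbhs_nbhs (conj oA np)) => y /= yn v'.
  by rewrite /W pullbackE form_supp_out// mulr0.
- apply/funext => x; apply/funext => v; rewrite /pullback /W pullbackE mul_partials_at_time0.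
  rewrite {2}/at_time0 /pi_x row_mxKr.
  have [xs|xs] := pselect (form_supp w0 x); last by rewrite form_supp_out// mulr0.
  rewrite /phi plateau1 ?mul1r// subr0; apply: le_trans (at_time0_norm x) _.
  by apply: le_trans (Hrho _ xs) _; rewrite /r /r' addrAC lerDr addr_ge0// ltW.
Qed.

End cylinder.

Theorem theoremA (R : realType) (k n : nat) (hkn : (1 <= k <= n)%N)
  (T0 : functional R k n)
  (hT0 : loc_integral T0)
  (hcycle : forall w, test_form w -> boundary T0 w = 0)
  (hfin : (mass T0 < +oo)%E)
  (hsupp : exists K : set 'rV[R]_n, compact K /\ supported_in T0 K)
  (hpos : (0 < mass T0)%E)
  (T : functional R k.+1 (1 + n))
  (nu : R -> {measure set (borel R n) -> \bar R})
  (hmotion : enhanced_motion T0 T nu)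
  (Fopt : functional R k.+1 n)
  (hF : optimal_filling T0 Fopt) :
  (((fine (mass Fopt) / fine (mass T0)) ^+ 2)%:E <= extinction_time nu)%E.
Proof.
have [[[lT lbT] sT] dT [_ nu0] hslice hB] := hmotion.
have [[[[cF _] _] mF _] dF minF] := hF.
have [[cT0 _] _] := hT0.
have T00 : T0 (fun _ _ => 0) = 0 by exact: current0.
have [cT _] := lT.
have [mu [a [V [mufin ma Ta [mV cV] chV]]]] := loc_rectifiable_rep lT.
set M := fine (mass Fopt); set M0 := fine (mass T0).
have M0fin : mass T0 = M0%:E by rewrite fineK// ge0_fin_numE// ltW.
have M00 : 0 < M0 by rewrite -lte_fin -M0fin.
have F0 : (0 <= mass Fopt)%E by apply: mass_ge0; exact: current0.
have Mfin : mass Fopt = M%:E by rewrite fineK// ge0_fin_numE.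
have Mge0 : 0 <= M by rewrite -lee_fin -Mfin.
rewrite leNgt; apply/negP => tauM.
(* Time 0 belongs to the set, as [nu 0] has total mass [mass T0 > 0]; the supremum of an empty set
   would be [-oo]. *)
have tau0 : (0%:E <= extinction_time nu)%E.
  apply: ereal_sup_ubound; exists 0 => //; split => //.
  by rewrite nu0// mass_measureT.
have [e tauE] : exists e : R, extinction_time nu = e%:E.
  exists (fine (extinction_time nu)); rewrite fineK// ge0_fin_numE//.
  by apply: lt_trans tauM _; exact: ltry.
rewrite tauE lee_fin in tau0; rewrite tauE lte_fin in tauM.
set r := (M / M0) ^+ 2 in tauM.
(* The domination of the slice holds for almost every time only; the interval from [e] to [r] has
   positive length, so it is not contained in the exceptional null set. *)
have [t /andP[et tr] Ht] : exists2 t : R, e < t < r & forall A : set (borel R n), measurable A ->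
    (mass_measure (slice T t) (@pi_x R n @^-1` A) <= nu t A)%E.
  apply: contrapT => H; move: hslice => [N [mN N0 HN]].
  have sub : `]e, r[%classic `<=` N.
    move=> t /=; rewrite in_itv/= => etr; apply: HN => /= Ht.
    by apply: H; exists t => //; apply: Ht; rewrite (le_trans tau0)//; have /andP[/ltW] := etr.
  have : (lebesgue_measure (`]e, r[%classic : set (measurableTypeR R)) <= lebesgue_measure N)%E.
    by apply: le_measure; rewrite ?inE//; exact: measurable_itv.
  rewrite N0 lebesgue_measure_itv/= lte_fin tauM -EFinD lee_fin subr_le0 leNgt.
  by rewrite tauM.
have t0 : 0 < t by apply: le_lt_trans tau0 et.
(* Beyond the supremum [nu t] has no mass, and it dominates the mass of the slice. *)
have slice0 : (mass (slice T t) <= 0)%E.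
  have : ~ (0 < nu t setT)%E.
    move=> nt; have : (t%:E <= extinction_time nu)%E.
      by apply: ereal_sup_ubound; exists t => //; split => //; exact: ltW.
    by rewrite tauE lee_fin leNgt et.
  move/negP; rewrite -leNgt; apply: le_trans.
  by have := Ht setT measurableT; rewrite preimage_setT mass_measureT.
(* The right end is excluded because [slice] cuts at [t <= s]. *)
pose B : set (measurableTypeR R) := `[0, t[%classic.
have mB : measurable B by exact: measurable_itv.
have lB : lebesgue_measure B = t%:E by rewrite lebesgue_measure_itv/= lte_fin t0 oppr0 adde0.
(* The first bound is the competitor's mass; the second gives the restricted current finite mass, so
   that its push-forward can be computed. *)
have [mG mTA] := hB B mB.
rewrite lB M0fin poweR_EFin powR12_sqrt ?(ltW t0)// in mG mTA.
pose A : set (borel R (1 + n)) := slab B.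
have mA : measurable A by exact: measurable_slab.
have {}mTA : (mass (restrict_current T A) < +oo)%E by apply: le_lt_trans mTA _; rewrite -EFinD -EFinM ltry.
pose G := pushed T A.
have dG : functional_eq (boundary G) T0.
  (* The form [W] is compactly supported in space-time, restricts to [w0] at time 0, and over the
     slab its derivative is the pullback of that of [w0]; so Stokes' formula for [T] computes the
     boundary of [G]. *)
  move=> w0 tw0; have [W [tW dW atW]] := cylinder_form tw0 t0.
  have [_ GE] := pushedE cT mufin ma Ta mA mTA (test_form_ext_deriv tw0).
  rewrite -[LHS]/(pushed T A (@ext_deriv R k.+1 n w0)) GE.
  rewrite -[in RHS]atW -(slab_integral cT mufin ma Ta lbT sT dT T00 t0 tW slice0).
  apply: eq_Rintegral => p _; rewrite [\1_A p]indicE.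
  have [Ap|nAp] := pselect (A p); last by rewrite !memNset// !mul0r.
  rewrite !mem_set// !mul1r; apply: eq_bigr => s _; congr (_ * _).
  by rewrite dW//; move: Ap; rewrite /A /B /slab /= in_itv.
have rG : rectifiable G by exact: (pushed_rectifiable cT mufin ma Ta mV cV chV mA mTA).
have mGfin : (mass G < +oo)%E by apply: le_lt_trans mG _; rewrite -EFinM ltry.
have iG : integral_current G.
  split; first split.
  - exact: rectifiable_loc.
  - by apply: loc_rectifiable_eq dG _; have [] := hT0.
  - exact: mGfin.
  - by rewrite (mass_eq dG).
(* Minimality gives [M <= sqrt t * M0], whereas [t < r] and [sqrt r = M / M0] give the strict
   opposite. *)
have := le_trans (minF G iG dG) mG; rewrite Mfin -EFinM lee_fin leNgt => /negP; apply.
rewrite -ltr_pdivlMr//.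
have Mr : M / M0 = Num.sqrt r by rewrite sqrtr_sqr ger0_norm// divr_ge0// ltW.
by rewrite Mr ltr_sqrt// (lt_trans t0).
Qed.
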